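(* Let $n\ge 1$ and $\mathbf d=(d_1,\ldots,d_n)$ be a tuple of positive integers, and let $\mathcal H=V(f)\subset\mathbb{C}^n$ be a generic hypersurface through $\mathbf 0$. Then the number of $\mathbf d$-osculants of $\mathcal H$ is equal to the number of primitive $\mathbf d$-necklaces.
   Context: Write $|\mathbf d|=d_1+\cdots+d_n$. A $\mathbf d$-parametrization is a polynomial map $\mathbf x(t)=(x_1(t),\ldots,x_n(t)):\mathbb{C}\to\mathbb{C}^n$ with $x_i\in\mathbb{C}[t]$ of degree $d_i$ and $\mathbf x(0)=\mathbf 0$; it is $k$-fold if it is generically $k$-to-one onto its image. For $f\in\mathbb{C}[x_1,\ldots,x_n]$ with $f(\mathbf 0)=0$, a parametrization $\mathbf x(t)$ approximates $\mathcal H=V(f)$ at $\mathbf 0$ to order $\gamma$ if $f(\mathbf x(t))\equiv 0 \pmod{t^\gamma}$. A $\mathbf d$-osculant of $\mathcal H$ is a curve $\mathbf x(\mathbb{C})\subset\mathbb{C}^n$ which is the image of a $1$-fold $\mathbf d$-parametrization approximating $\mathcal H$ to order $|\mathbf d|$; osculants are counted as distinct curves (two parametrizations with the same image give the same osculant). Only the coefficients of $f$ on monomials of total degree at most $|\mathbf d|$ affect this condition; ''generic'' means that this (projectivized) coefficient vector of $f$ lies in a dense Zariski open subset of the space of such coefficient vectors. A $\mathbf d$-necklace is a circular arrangement of $|\mathbf d|$ beads, $d_i$ of them of color $i$, considered up to cyclic rotation; it is primitive if its orbit under rotation has exactly $|\mathbf d|$ elements. *)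

(* Defs.v *)
From HB Require Import structures.
From mathcomp Require Import all_boot all_order all_algebra.
From mathcomp Require Import reals.
From mathcomp Require Import complex.
From mathcomp Require Import mpoly.

Set Implicit Arguments.
Unset Strict Implicit.
Unset Printing Implicit Defensive.

Import Order.TTheory GRing.Theory Num.Theory.
Local Open Scope ring_scope.

Section Osculants.
Variable C : fieldType.
Variable n : nat.

Definition dsum (d : 'I_n -> nat) : nat := (\sum_(i < n) d i)%N.

Definition pmap := 'I_n -> {poly C}.

Definition pt (x : pmap) (t : C) : 'rV[C]_n := \row_(i < n) (x i).[t].

Definition is_dparam (d : 'I_n -> nat) (x : pmap) : Prop :=
  (forall i, size (x i) = (d i).+1) /\ (forall i, (x i).[0] = 0).

(* x is 1-fold: generically one-to-one onto its image, i.e. outside a finite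
   set B of points of C^n, every point of the image has exactly one preimage *)
Definition onefold (x : pmap) : Prop :=
  exists B : seq 'rV[C]_n,
    forall s t, pt x s \notin B -> pt x s = pt x t -> s = t.

Definition fcomp (f : {mpoly C[n]}) (x : pmap) : {poly C} :=
  mmap (@polyC C) x f.

Definition approximates (f : {mpoly C[n]}) (x : pmap) (g : nat) : Prop :=
  ('X^g %| fcomp f x)%R.

Definition osc_param (f : {mpoly C[n]}) (d : 'I_n -> nat) (x : pmap) : Prop :=
  [/\ is_dparam d x, onefold x & approximates f x (dsum d)].

Definition same_image (x y : pmap) : Prop :=
  forall p, (exists t, pt x t = p) <-> (exists t, pt y t = p).

Definition num_osculants_eq (f : {mpoly C[n]}) (d : 'I_n -> nat) (k : nat) : Prop :=
  exists g : 'I_k -> pmap,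
    [/\ forall i, osc_param f d (g i),
        forall i j, same_image (g i) (g j) -> i = j
      & forall x, osc_param f d x -> exists i, same_image x (g i)].

(* monomials of total degree between 1 and |d| : the coordinates of the
   coefficient vectors of f (with f(0) = 0) that matter *)
Definition coefmon (D : nat) := {m : 'X_{1..n < D.+1} | (0 < mdeg m)%N}.

Definition coefvec (D : nat) (f : {mpoly C[n]}) : 'I_#|{: coefmon D}| -> C :=
  fun j => f@_(bmnm (val (enum_val j))).

End Osculants.
Arguments coefvec {C n} D f j.

Section Necklaces.
Variable n : nat.

Definition necklace_orbit (D : nat) (w : D.-tuple 'I_n) : {set D.-tuple 'I_n} :=
  [set [tuple of rot k w] | k : 'I_D].

Definition dwords (d : 'I_n -> nat) : {set (dsum d).-tuple 'I_n} :=
  [set w : (dsum d).-tuple 'I_n | [forall i, count_mem i w == d i]].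

Definition primitive_necklaces (d : 'I_n -> nat) : {set {set (dsum d).-tuple 'I_n}} :=
  [set necklace_orbit w | w in
     [set w in dwords d | #|necklace_orbit w| == dsum d]].

Definition num_primitive_necklaces (d : 'I_n -> nat) : nat :=
  #|primitive_necklaces d|.

End Necklaces.

(* Main.v *)
Require Import Defs.
From HB Require Import structures.
From mathcomp Require Import all_boot all_order all_algebra.
From mathcomp Require Import reals.
From mathcomp Require Import complex.
From mathcomp Require Import mpoly.
From mathcomp Require Import perm fraction cyclic separable cyclotomic mxtens.
From mathcomp Require Import ring zify.

Set Implicit Arguments.
Unset Strict Implicit.
Unset Printing Implicit Defensive.

Import Order.TTheory GRing.Theory Num.Theory.
Local Open Scope ring_scope.

(* Write D = |d|. The coefficients a of a d-parametrization x are D unknowns,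
   and the coefficient E_k of t^k in f(x(t)) is weighted homogeneous of degree
   k in them. An osculant can be reparametrized so that E_1 = .. = E_(D-1) = 0
   and E_D = -1, uniquely up to t -> zeta t with zeta^D = 1.

   For f0 = prod_i (1 + x_i) - 1 the normalized solutions are the
   factorizations 1 - t^D = prod_i (1 + x_i(t)), that is, the colourings of the
   D-th roots of unity by words w with d_i letters i, and zeta acts by rotation.
   Monomials e_w indexed by the same words form a basis of C[a] over
   C[E_1, .., E_D]: setting top coefficients a_(i, d_i) to 0 one after the
   other reduces d to d - 1_i, and the product of the top coefficients is E_D.

   Freeness and spanning are open conditions on f, so for generic f the
   coordinates act on the fibre E = (0, .., 0, -1) by commuting matrices of size
   #words with simple joint spectrum: there are exactly #words solutions. The
   e_w being homogeneous, the number of solutions fixed by zeta^k is the trace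
   sum_w zeta^(k deg e_w), the same for f as for f0; hence the number of free
   orbits is the number of primitive necklaces. Finally, lower semicontinuity of
   the rank transfers from f0 to f that solutions in free orbits are
   generically injective and that distinct orbits have distinct images, both
   being expressed by the non-vanishing of a resultant. *)

(** * Generic properties and regular functions *)

(** The solutions are algebraic, not rational, functions of [F], so a solution at [F0] cannot be
    followed to one at [F]. Everything is moved through matrices with regular entries, whose ranks
    and traces know only numbers of solutions. A count bounded below by its value at [F0] yields a
    statement about individual solutions once the set counted at [F] lies in a set of that same
    cardinality. This is the case here: a parametrization in a non-free orbit is never 1-fold, and
    two parametrizations in one orbit have the same image, so the resultants can be nonzero only on
    free orbits and on pairs of different orbits, and the trace formula makes these sets equally
    large for [F0] and [F]. Only finitely many open conditions may be imposed. Freeness over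
    C[E_1, .., E_D] consists of infinitely many, hence the size bounds, uniform in [F], that
    accompany each use of it. A resultant handles two polynomials, not n: one coordinate is paired
    with the combination sum_i z^i x_i, and z is chosen so that this loses nothing for f0. *)

Section Generic.
Variables (C : fieldType) (M : nat) (F0 : 'I_M -> C).
Implicit Types (Q : ('I_M -> C) -> Prop) (phi psi : ('I_M -> C) -> C).

(** Openness around the fixed point [F0]: each condition comes from a function that is nonzero at
    [F0], and a conjunction from the product of the polynomials. *)
Definition generic Q := exists P : {mpoly C[M]},
  P.@[F0] != 0 /\ forall F, P.@[F] != 0 -> Q F.

Lemma generic_at Q : generic Q -> Q F0.
Proof. by case=> P [P0 h]; apply: h. Qed.

Lemma generic_all Q : (forall F, Q F) -> generic Q.
Proof. by move=> h; exists 1; split; rewrite ?rmorph1 ?oner_neq0. Qed.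

Lemma generic_and Q1 Q2 :
  generic Q1 -> generic Q2 -> generic (fun F => Q1 F /\ Q2 F).
Proof.
case=> P1 [P10 h1] [P2 [P20 h2]]; exists (P1 * P2).
rewrite mevalM mulf_neq0 //; split=> // F; rewrite mevalM mulf_eq0 negb_or.
by case/andP=> /h1 ? /h2.
Qed.

Lemma generic_imp Q1 Q2 :
  generic Q1 -> (forall F, Q1 F -> Q2 F) -> generic Q2.
Proof. by case=> P [P0 h] h12; exists P; split=> // F /h /h12. Qed.

Lemma generic_forall (I : finType) (Q : I -> ('I_M -> C) -> Prop) :
  (forall i, generic (Q i)) -> generic (fun F => forall i, Q i F).
Proof.
move=> h; suff: generic (fun F => forall i, i \in enum I -> Q i F).
  by move=> g; apply: generic_imp g _ => F hF i; apply: hF; rewrite mem_enum.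
elim: (enum I) => [|i s IH]; first exact: generic_all.
apply: generic_imp (generic_and (h i) IH) _ => F [hi hs] j.
by rewrite inE => /predU1P[->//|]; apply: hs.
Qed.

(** A rational function defined at [F0]. Where [den] vanishes [phi] is free, so it may take the
    default values of [^-1] and [invmx] there. *)
Definition regular phi := exists num den : {mpoly C[M]},
  den.@[F0] != 0 /\ forall F, den.@[F] != 0 -> phi F = num.@[F] / den.@[F].

Lemma regular_ext phi psi :
  generic (fun F => phi F = psi F) -> regular phi -> regular psi.
Proof.
case=> P [P0 h] [num [den [d0 hd]]]; exists (P * num), (P * den).
rewrite mevalM mulf_neq0 //; split=> // F; rewrite !mevalM mulf_eq0 negb_or.
by case/andP=> hP hden; rewrite -h // hd // -mulf_div divff // mul1r.
Qed.

Lemma regular_eq phi psi : phi =1 psi -> regular phi -> regular psi.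
Proof. by move=> e; apply: regular_ext; apply: generic_all. Qed.

Lemma regular_const c : regular (fun=> c).
Proof.
exists c%:MP, 1; rewrite rmorph1 oner_neq0; split=> // F _.
by rewrite mevalC rmorph1 divr1.
Qed.

Lemma regular_coord j : regular (fun F => F j).
Proof.
exists 'X_j, 1; rewrite rmorph1 oner_neq0; split=> // F _.
by rewrite mevalXU rmorph1 divr1.
Qed.

Lemma regularD phi psi :
  regular phi -> regular psi -> regular (fun F => phi F + psi F).
Proof.
case=> n1 [d1 [d10 h1]] [n2 [d2 [d20 h2]]].
exists (n1 * d2 + n2 * d1), (d1 * d2); rewrite mevalM mulf_neq0 //; split=> // F.
rewrite !mevalM mulf_eq0 negb_or => /andP[hd1 hd2].
by rewrite h1 // h2 // mevalD !mevalM addf_div.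
Qed.

Lemma regularM phi psi :
  regular phi -> regular psi -> regular (fun F => phi F * psi F).
Proof.
case=> n1 [d1 [d10 h1]] [n2 [d2 [d20 h2]]].
exists (n1 * n2), (d1 * d2); rewrite mevalM mulf_neq0 //; split=> // F.
rewrite !mevalM mulf_eq0 negb_or => /andP[hd1 hd2].
by rewrite h1 // h2 // mulf_div.
Qed.

Lemma regularN phi : regular phi -> regular (fun F => - phi F).
Proof.
move=> h; apply: regular_eq (regularM (regular_const (-1)) h) => F.
by rewrite mulN1r.
Qed.

Lemma regular_sum (I : Type) (s : seq I) (P : pred I) (f : I -> _) :
  (forall i, regular (f i)) -> regular (fun F => \sum_(i <- s | P i) f i F).
Proof.
move=> h; elim: s => [|i s IH].
  by apply: regular_eq (regular_const 0) => F; rewrite big_nil.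
case Pi: (P i).
  by apply: regular_eq (regularD (h i) IH) => F; rewrite big_cons Pi.
by apply: regular_eq IH => F; rewrite big_cons Pi.
Qed.

Lemma regular_prod (I : Type) (s : seq I) (P : pred I) (f : I -> _) :
  (forall i, regular (f i)) -> regular (fun F => \prod_(i <- s | P i) f i F).
Proof.
move=> h; elim: s => [|i s IH].
  by apply: regular_eq (regular_const 1) => F; rewrite big_nil.
case Pi: (P i).
  by apply: regular_eq (regularM (h i) IH) => F; rewrite big_cons Pi.
by apply: regular_eq IH => F; rewrite big_cons Pi.
Qed.

Lemma regular_neq0 phi :
  regular phi -> phi F0 != 0 -> generic (fun F => phi F != 0).
Proof.
case=> num [den [d0 h]]; rewrite h // mulf_eq0 negb_or => /andP[n0 _].
exists (num * den); rewrite mevalM mulf_neq0 //; split=> // F.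
rewrite mevalM mulf_eq0 negb_or => /andP[nF dF].
by rewrite h // mulf_neq0 // invr_eq0.
Qed.

Lemma regularV phi : regular phi -> phi F0 != 0 -> regular (fun F => (phi F)^-1).
Proof.
case=> num [den [d0 h]]; rewrite h // mulf_eq0 negb_or => /andP[n0 _].
exists (den * den), (num * den); rewrite mevalM mulf_neq0 //; split=> // F.
rewrite !mevalM mulf_eq0 negb_or => /andP[nF dF].
by rewrite h // invf_div -mulf_div divff // mulr1.
Qed.

Definition regularmx m n (A : ('I_M -> C) -> 'M[C]_(m, n)) :=
  forall i j, regular (fun F => A F i j).

Lemma regularmx_const m n (A : 'M[C]_(m, n)) : regularmx (fun=> A).
Proof. by move=> i j; apply: regular_const. Qed.

Lemma regularmxM m n p (A : _ -> 'M_(m, n)) (B : _ -> 'M_(n, p)) :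
  regularmx A -> regularmx B -> regularmx (fun F => A F *m B F).
Proof.
move=> hA hB i j.
apply: (@regular_eq (fun F => \sum_k A F i k * B F k j)).
  by move=> F; rewrite mxE.
by apply: regular_sum => k; apply: regularM.
Qed.

Lemma regularmxD m n (A B : _ -> 'M_(m, n)) :
  regularmx A -> regularmx B -> regularmx (fun F => A F + B F).
Proof.
move=> hA hB i j; apply: regular_eq (regularD (hA i j) (hB i j)) => F.
by rewrite mxE.
Qed.

Lemma regularmxZ m n phi (A : _ -> 'M_(m, n)) :
  regular phi -> regularmx A -> regularmx (fun F => phi F *: A F).
Proof.
move=> hp hA i j; apply: regular_eq (regularM hp (hA i j)) => F.
by rewrite mxE.
Qed.

Lemma regularmx_sum (I : Type) (s : seq I) m n (A : I -> _ -> 'M_(m, n)) :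
  (forall i, regularmx (A i)) -> regularmx (fun F => \sum_(i <- s) A i F).
Proof.
move=> hA i j; apply: (@regular_eq (fun F => \sum_(k <- s) A k F i j)).
  by move=> F; rewrite summxE.
by apply: regular_sum => k; apply: hA.
Qed.

Lemma regular_det n (A : _ -> 'M_n) :
  regularmx A -> regular (fun F => \det (A F)).
Proof.
move=> hA; apply: regular_sum => s.
by apply: regularM; [exact: regular_const | apply: regular_prod => i; apply: hA].
Qed.

Lemma regular_invmx n (A : _ -> 'M_n) :
  regularmx A -> \det (A F0) != 0 -> regularmx (fun F => invmx (A F)).
Proof.
move=> hA A0 i j.
apply: (@regular_ext (fun F => (\det (A F))^-1 * cofactor (A F) j i)).
  apply: generic_imp (regular_neq0 (regular_det hA) A0) _ => F hF.
  by rewrite /invmx unitmxE unitfE hF !mxE.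
apply: regularM; first exact: regularV (regular_det hA) A0.
apply: regularM; first exact: regular_const.
by apply: regular_det => k l; apply: regular_eq (hA (lift j k) (lift i l)) => F; rewrite !mxE.
Qed.

(** Lower semicontinuity without minors: with one-sided inverses [L] and [R] of the factors in a
    rank factorization of [A F0], the square matrix [L *m A F *m R] has that rank as its size and is
    the identity at [F0]. *)
Lemma generic_rank m n (A : _ -> 'M_(m, n)) :
  regularmx A -> generic (fun F => (\rank (A F0) <= \rank (A F))%N).
Proof.
move=> hA.
have /row_fullP[L hL] := col_base_full (A F0).
have /row_freeP[R hR] := row_base_free (A F0).
have h0 : L *m A F0 *m R = 1%:M.
  transitivity (L *m (col_base (A F0) *m row_base (A F0)) *m R).
    by rewrite mulmx_base.
  by rewrite mulmxA hL mul1mx.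
have hreg : regularmx (fun F => L *m A F *m R).
  by apply: regularmxM (regularmxM _ hA) _; apply: regularmx_const.
have := regular_neq0 (regular_det hreg); rewrite h0 det1 oner_neq0.
move/(_ isT)=> g; apply: generic_imp g _ => F; rewrite -unitfE -unitmxE => u.
rewrite -{1}(mxrank_unit u).
by apply: leq_trans (mxrankM_maxl _ _) (mxrankM_maxr _ _).
Qed.

End Generic.

(** * Matrices with simple spectrum *)

Section Eigen.
Variable C : closedFieldType.

Lemma eigenvector_horner n (A : 'M[C]_n.+1) (v : 'rV_n.+1) a p :
  v *m A = a *: v -> v *m horner_mx A p = p.[a] *: v.
Proof.
move=> h; elim/poly_ind: p => [|p c IH].
  by rewrite rmorph0 mulmx0 horner0 scale0r.
rewrite rmorphD rmorphM /= horner_mx_X horner_mx_C mulmxDr mulmxA IH.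
by rewrite -scalemxAl h scalerA mul_mx_scalar -scalerDl !hornerE.
Qed.

(** The polynomial in [A] with roots all the eigenvalues but the i-th kills every row of [X] but the
    i-th, and so isolates one coefficient of a linear relation. *)
Lemma eigenvectors_free n (A : 'M[C]_n) (X : 'M_n) (mu : 'I_n -> C) :
  injective mu -> (forall i, row i X *m A = mu i *: row i X) ->
  (forall i, row i X != 0) -> X \in unitmx.
Proof.
case: n A X mu => [|n] A X mu mu_inj hX X0.
  by rewrite unitmxE det_mx00 unitr1.
rewrite -row_free_unit; apply: inj_row_free => u uX.
apply/rowP => i; rewrite [RHS]mxE.
pose q : {poly C} := \prod_(j | j != i) ('X - (mu j)%:P).
have: u *m X *m horner_mx A q = 0 by rewrite uX mul0mx.
rewrite (mulmx_sum_row u X) mulmx_suml (bigD1 i) //= big1 ?addr0 => [|j ji].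
  rewrite -scalemxAl (eigenvector_horner _ (hX i)) scalerA => /eqP.
  rewrite scalemx_eq0 (negPf (X0 i)) orbF mulf_eq0 => /orP[/eqP//|].
  rewrite horner_prod => /eqP/eqP/prodf_eq0[j ji].
  by rewrite !hornerE subr_eq0 (inj_eq mu_inj) eq_sym (negPf ji).
rewrite -scalemxAl (eigenvector_horner _ (hX j)) horner_prod (bigD1 j) //=.
by rewrite !hornerE subrr mul0r scale0r scaler0.
Qed.

Variables (M : nat) (F0 : 'I_M -> C).

Definition regularp (p : ('I_M -> C) -> {poly C}) :=
  forall i, regular F0 (fun F => (p F)`_i).

Lemma regularpM p q :
  regularp p -> regularp q -> regularp (fun F => p F * q F).
Proof.
move=> hp hq i.
apply: (@regular_eq _ _ _ (fun F => \sum_(j < i.+1) (p F)`_j * (q F)`_(i - j))).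
  by move=> F; rewrite coefM.
by apply: regular_sum => k; apply: regularM.
Qed.

Lemma regularp_sum (I : Type) (s : seq I) (p : I -> _) :
  (forall i, regularp (p i)) -> regularp (fun F => \sum_(i <- s) p i F).
Proof.
move=> h i; apply: (@regular_eq _ _ _ (fun F => \sum_(j <- s) (p j F)`_i)).
  by move=> F; rewrite coef_sum.
by apply: regular_sum => j; apply: h.
Qed.

Lemma regularp_const p : regularp (fun=> p).
Proof. by move=> i; apply: regular_const. Qed.

Lemma regularp_prod (I : Type) (s : seq I) (p : I -> _) :
  (forall i, regularp (p i)) -> regularp (fun F => \prod_(i <- s) p i F).
Proof.
move=> h; elim: s => [|i s IH] k.
  by apply: regular_eq (regularp_const 1 k) => F; rewrite big_nil.
by apply: regular_eq (regularpM (h i) IH k) => F; rewrite big_cons.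
Qed.

Lemma regularp_char_poly n (A : _ -> 'M_n) :
  regularmx F0 A -> regularp (fun F => char_poly (A F)).
Proof.
move=> hA; apply: regularp_sum => s; apply: regularpM.
  exact: regularp_const.
apply: regularp_prod => i k; move: (s i) => j {s}.
have h : regular F0 (fun F => (('X : {poly C}) *+ (i == j))`_k
                              - (k == 0%N)%:R * A F i j).
  apply: regularD; first exact: regular_const.
  by apply/regularN/regularM; [exact: regular_const | exact: hA].
apply: regular_eq h => F; rewrite !mxE coefB coefC mulr_natl.
by case: (k == 0)%N.
Qed.

(* Simplicity of the spectrum amounts to the invertibility of chi'(A), where
   chi is the characteristic polynomial of A. *)
Lemma generic_simple_spectrum n (A : _ -> 'M_n) (V : 'M_n) (mu : 'I_n -> C) :
  regularmx F0 A -> injective mu ->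
  (forall i, row i V *m A F0 = mu i *: row i V) -> (forall i, row i V != 0) ->
  generic F0 (fun F => exists X : 'M_n, exists nu : 'I_n -> C,
    [/\ X \in unitmx, injective nu & forall i, row i X *m A F = nu i *: row i X]).
Proof.
case: n A V mu => [|n] A V mu regA mu_inj hV V0.
  apply: generic_all => F; exists 1%:M, (fun=> 0).
  by split; rewrite ?unitmx1 //; case.
pose chi F := char_poly (A F).
pose B F := horner_mx (A F) (chi F)^`().
have regX k : regularmx F0 (fun F => A F ^+ k).
  elim: k => [|k IH] i j; first exact: regular_const.
  by apply: regular_eq (regularmxM regA IH i j) => F; rewrite exprS.
have BE F : B F = \sum_(k < n.+1) (chi F)^`()`_k *: A F ^+ k.
  rewrite /B /horner_mx /horner_morph.
  rewrite (@horner_coef_wide _ n.+1); last first.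
    apply: leq_trans (size_poly _ _) _; rewrite -ltnS -(size_char_poly (A F)).
    by apply: lt_size_deriv; rewrite -size_poly_gt0 size_char_poly.
  apply: eq_bigr => k _; rewrite coef_map /=.
  exact: mul_scalar_mx.
have regB : regularmx F0 B.
  move=> i j; apply: (@regular_eq _ _ _
      (fun F => (\sum_(k < n.+1) (chi F)^`()`_k *: A F ^+ k) i j)).
    by move=> F; rewrite BE.
  apply: regularmx_sum => k; apply: regularmxZ => //.
  apply: (@regular_eq _ _ _ (fun F => k.+1%:R * (chi F)`_k.+1)).
    by move=> F; rewrite coef_deriv mulr_natl.
  by apply: regularM; [exact: regular_const | exact: regularp_char_poly].
have chiE F (s : seq C) : uniq s -> size s = n.+1 -> all (root (chi F)) s ->
    chi F = \prod_(z <- s) ('X - z%:P).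
  move=> us ss rs; rewrite (all_roots_prod_XsubC _ rs) ?uniq_rootsE //.
    by rewrite (monicP (char_poly_monic _)) scale1r.
  by rewrite size_char_poly ss.
(* At [F0] the distinct [mu i] are all the roots of chi, which gives a Bezout relation u chi + v
   chi' = 1; by Cayley-Hamilton v(A) is then inverse to chi'(A). *)
have B0 : \det (B F0) != 0.
  have chi0 : chi F0 = \prod_(z <- [seq mu i | i <- enum 'I_n.+1]) ('X - z%:P).
    apply: chiE; first by rewrite map_inj_uniq // enum_uniq.
      by rewrite size_map size_enum_ord.
    apply/allP => _ /mapP[i _ ->]; rewrite -eigenvalue_root_char.
    by apply/eigenvalueP; exists (row i V).
  have: separable_poly (chi F0).
    by rewrite chi0 separable_prod_XsubC map_inj_uniq // enum_uniq.
  rewrite unlock => /Bezout_eq1_coprimepP[[u v] /= uv].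
  have: horner_mx (A F0) v * B F0 = 1.
    have /(congr1 (horner_mx (A F0))) := uv.
    by rewrite rmorphD !rmorphM /= Cayley_Hamilton mulr0 add0r rmorph1.
  move/(congr1 (fun X => \det X)); rewrite det1 det_mulmx => h.
  by apply: contraNneq (oner_neq0 C) => d0; rewrite -h d0 mulr0.
apply: generic_imp (regular_neq0 (regular_det regB) B0) _ => F.
rewrite -unitfE -unitmxE => uB.
(* A common root of chi and chi' would be an eigenvalue whose eigenvector is killed by the
   invertible [B F]. *)
have sep : separable_poly (chi F).
  rewrite unlock /coprimep -[_ == _]negbK; apply/negP => /closed_rootP[a].
  rewrite root_gcd => /andP[].
  rewrite -eigenvalue_root_char => /eigenvalueP[v hv v0] ra.
  have := eigenvector_horner (chi F)^`() hv.
  rewrite -/(B F) (rootP ra) scale0r => h.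
  by case/eqP: v0; rewrite -(mulmxK uB v) h mul0mx.
have [s hs] := closed_field_poly_normal (chi F).
rewrite (monicP (char_poly_monic _)) scale1r in hs.
have us : uniq s by rewrite -separable_prod_XsubC -hs.
have ss : size s = n.+1.
  by have := size_char_poly (A F); rewrite -/(chi F) hs size_prod_XsubC => -[].
pose nu (i : 'I_n.+1) := s`_i.
have ev i : exists v : 'rV_n.+1, (v *m A F == nu i *: v) && (v != 0).
  have /eigenvalueP[v hv v0] : eigenvalue (A F) (nu i).
    by rewrite eigenvalue_root_char -/(chi F) hs root_prod_XsubC mem_nth ?ss.
  by exists v; rewrite hv eqxx.
pose X := \matrix_i xchoose (ev i).
have nu_inj : injective nu.
  by move=> i j /eqP; rewrite nth_uniq ?ss // => /eqP/val_inj.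
have hX i : row i X *m A F = nu i *: row i X.
  by rewrite rowK; apply/eqP; case/andP: (xchooseP (ev i)).
exists X, nu; split=> //; apply: eigenvectors_free hX _ => // i.
by rewrite rowK; case/andP: (xchooseP (ev i)).
Qed.

End Eigen.

(** * Spanning of the polynomial ring by the e_w *)

Section Params.
Variables (n : nat) (d : 'I_n -> nat).

(** The slot l of x_i stands for the coefficient of t^(l+1): constant terms are 0 and are not
    unknowns. *)
Definition cidx : finType := {i : 'I_n & 'I_(d i)}.
Definition ncoef := #|cidx|.
Definition cix (i : 'I_n) (l : 'I_(d i)) : 'I_ncoef :=
  enum_rank (Tagged (fun i => 'I_(d i)) l).

Lemma cix_surj t : exists i (l : 'I_(d i)), t = cix l.
Proof.
exists (tag (enum_val t)), (tagged (enum_val t)).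
by rewrite /cix; case: (enum_val t) (enum_valK t).
Qed.

(* Coefficient of t^l in 1 + x_i(t), the indeterminates being the coefficients
   of the x_i in positive degree. *)
Definition pc (K : pzRingType) (p : 'I_ncoef -> K) (i : 'I_n) (l : nat) : K :=
  if l is l'.+1 then
    if insub l' is Some j then p (cix (j : 'I_(d i))) else 0
  else 1.

Lemma pcS (K : pzRingType) (p : 'I_ncoef -> K) i (j : 'I_(d i)) :
  pc p i j.+1 = p (cix j).
Proof. by rewrite /pc valK. Qed.

Lemma pc_gt (K : pzRingType) (p : 'I_ncoef -> K) i l :
  (d i < l)%N -> pc p i l = 0.
Proof. by case: l => // l h; rewrite /pc insubF // ltnNge -ltnS h. Qed.

Lemma pc_rmorph (K L : pzRingType) (f : {rmorphism K -> L}) p i l :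
  f (pc p i l) = pc (f \o p) i l.
Proof.
case: l => [|l] /=; first by rewrite rmorph1.
by case: insubP => [j _ _|_] /=; rewrite ?rmorph0.
Qed.

Lemma eq_pc (K : pzRingType) (p q : 'I_ncoef -> K) i l :
  p =1 q -> pc p i l = pc q i l.
Proof. by move=> e; case: l => //= l; case: insubP => [j|]//= _ _; rewrite e. Qed.

Definition xg (K : nzRingType) (p : 'I_ncoef -> K) i : {poly K} :=
  \poly_(l < (d i).+1) pc p i l.

Lemma coef_xg (K : nzRingType) (p : 'I_ncoef -> K) i l : (xg p i)`_l = pc p i l.
Proof. by rewrite coef_poly ltnS; case: leqP => // h; rewrite pc_gt. Qed.

Lemma map_xg (K L : nzRingType) (f : {rmorphism K -> L}) p i :
  map_poly f (xg p i) = xg (f \o p) i.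
Proof. by apply/polyP=> l; rewrite coef_map /= !coef_xg pc_rmorph. Qed.

(** The shape is dictated by the recursion in [spanning]: in a word of content d' starting with i,
    the first letter contributes the top coefficients, of degree d' j, of the x_j with j < i. *)
Fixpoint ew (K : comNzRingType) (p : 'I_ncoef -> K) (w : seq 'I_n) : K :=
  if w is i :: w' then (\prod_(j < n | (j < i)%N) pc p j (count_mem j w')) * ew p w'
  else 1.

(** The number of inversions of [w]; the sum of lam^wdeg over the words of a given content is a
    Gaussian multinomial coefficient. *)
Fixpoint wdeg (w : seq 'I_n) : nat :=
  if w is i :: w' then (\sum_(j < n | (j < i)%N) count_mem j w' + wdeg w')%N else 0.

Lemma ew_rmorph (K L : comNzRingType) (f : {rmorphism K -> L}) p w :
  f (ew p w) = ew (f \o p) w.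
Proof.
elim: w => [|i w IH] /=; first by rewrite rmorph1.
by rewrite rmorphM rmorph_prod IH; under eq_bigr do rewrite pc_rmorph.
Qed.

Lemma eq_ew (K : comNzRingType) (p q : 'I_ncoef -> K) w :
  p =1 q -> ew p w = ew q w.
Proof.
move=> e; elim: w => //= i w ->; congr (_ * _).
by apply: eq_bigr => j _; apply: eq_pc.
Qed.

(** This is 1 + f0(x(t)), so its coefficients in positive degree are the E_k of f0. *)
Definition Gp (K : comNzRingType) (p : 'I_ncoef -> K) : {poly K} := \prod_i xg p i.

Lemma map_Gp (K L : comNzRingType) (f : {rmorphism K -> L}) p :
  map_poly f (Gp p) = Gp (f \o p).
Proof. by rewrite rmorph_prod; apply: eq_bigr => i _; apply: map_xg. Qed.

Definition wtc (t : 'I_ncoef) : nat := (tagged (enum_val t)).+1.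

Lemma wtc_cix i (l : 'I_(d i)) : wtc (cix l) = l.+1.
Proof. by rewrite /wtc /cix enum_rankK. Qed.

Definition wt (m : 'X_{1..ncoef}) : nat := (\sum_t m t * wtc t)%N.

Lemma wt0 : wt 0%MM = 0%N.
Proof. by rewrite /wt big1 // => t _; rewrite mnm0E. Qed.

Lemma wtD m1 m2 : wt (m1 + m2)%MM = (wt m1 + wt m2)%N.
Proof. by rewrite /wt -big_split; apply: eq_bigr => t _; rewrite mnmDE mulnDl. Qed.

Lemma wtU t : wt U_(t)%MM = wtc t.
Proof.
rewrite /wt (bigD1 t) //= mnm1E eqxx mul1n big1 ?addn0 // => s st.
by rewrite mnm1E eq_sym (negPf st).
Qed.

(** Every unknown has positive weight; hence polynomials of bounded weight form a finite-dimensional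
    space. *)
Lemma mdeg_wt m : (mdeg m <= wt m)%N.
Proof. by rewrite mdegE; apply: leq_sum => t _; rewrite leq_pmulr. Qed.

End Params.

(** * The filtration by weight *)

Section Weight.
Variables (C : fieldType) (n : nat) (d : 'I_n -> nat).
Notation N := (ncoef d).
Notation P := {mpoly C[N]}.
Notation X := (fun t : 'I_N => 'X_t : P).
Implicit Types (q : P) (m : 'X_{1..N}).

(** Only an upper bound is recorded, which keeps all spaces finite-dimensional; exact homogeneity
    enters later, through the scaling [scp]. *)
Definition wle (e : nat) q := forall m, m \in msupp q -> (wt m <= e)%N.

Lemma wle_mono e e' q : (e <= e')%N -> wle e q -> wle e' q.
Proof. by move=> h hq m /hq /leq_trans; apply. Qed.

Lemma wle0 e : wle e 0.
Proof. by move=> m; rewrite msupp0. Qed.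

Lemma wle1 e : wle e 1.
Proof. by move=> m; rewrite msupp1 inE => /eqP ->; rewrite wt0. Qed.

Lemma wleD e p q : wle e p -> wle e q -> wle e (p + q).
Proof. by move=> hp hq m /msuppD_le; rewrite mem_cat => /orP[/hp|/hq]. Qed.

Lemma wleB e p q : wle e p -> wle e q -> wle e (p - q).
Proof. by move=> hp hq m /msuppB_le; rewrite mem_cat => /orP[/hp|/hq]. Qed.

Lemma wleZ e c q : wle e q -> wle e (c *: q).
Proof. by move=> hq m /msuppZ_le /hq. Qed.

Lemma wleM e1 e2 p q : wle e1 p -> wle e2 q -> wle (e1 + e2) (p * q).
Proof.
move=> hp hq m /msuppM_le /allpairsP[[m1 m2] /= [h1 h2 ->]].
by rewrite wtD leq_add ?hp ?hq.
Qed.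

Lemma wleX e m : (wt m <= e)%N -> wle e 'X_[m].
Proof. by move=> h k; rewrite msuppX inE => /eqP ->. Qed.

Lemma wle_sum e (I : Type) (s : seq I) (Q : pred I) f :
  (forall i, Q i -> wle e (f i)) -> wle e (\sum_(i <- s | Q i) f i).
Proof. by move=> h; elim/big_ind: _ => //; [exact: wle0 | exact: wleD]. Qed.

Lemma wle_prod (I : Type) (s : seq I) (Q : pred I) (e : I -> nat) f :
  (forall i, Q i -> wle (e i) (f i)) ->
  wle (\sum_(i <- s | Q i) e i) (\prod_(i <- s | Q i) f i).
Proof. by move=> h; elim/big_ind2: _ => //; [exact: wle1 | move=> *; exact: wleM]. Qed.

Lemma wle_exp e q k : wle e q -> wle (e * k) (q ^+ k).
Proof.
move=> h; elim: k => [|k IH]; first exact: wle1.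
by rewrite exprS mulnS; apply: wleM.
Qed.

Lemma wle_ind e (Q : P -> Prop) :
  (forall p q, Q p -> Q q -> Q (p + q)) -> Q 0 ->
  (forall c m, (wt m <= e)%N -> Q (c *: 'X_[m])) ->
  forall q, wle e q -> Q q.
Proof.
move=> hD h0 hX q hq; rewrite [q]mpolyE big_seq.
by elim/big_ind: _ => // m /hq /hX.
Qed.

Lemma wle_pc i l : wle l (pc X i l).
Proof.
case: l => [|l] /=; first exact: wle1.
case: insubP => [j _ jl|_]; last exact: wle0.
by apply: wleX; rewrite wtU wtc_cix jl.
Qed.

Lemma wle_ew w : wle (wdeg w) (ew X w).
Proof.
elim: w => [|i w IH] /=; first exact: wle1.
by apply: wleM => //; apply: wle_prod => j _; apply: wle_pc.
Qed.

Definition pwle (q : {poly P}) := forall k, wle k q`_k.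

Lemma pwle1 : pwle 1.
Proof. by move=> k; rewrite coef1; case: k => [|k]; [exact: wle1|exact: wle0]. Qed.

Lemma pwleM (p q : {poly P}) : pwle p -> pwle q -> pwle (p * q).
Proof.
move=> hp hq k; rewrite coefM; apply: wle_sum => j _.
by rewrite -{1}(subnKC (leq_ord j)); apply: wleM.
Qed.

Lemma pwle_prod (I : Type) (s : seq I) (f : I -> {poly P}) :
  (forall i, pwle (f i)) -> pwle (\prod_(i <- s) f i).
Proof. by move=> h; elim/big_ind: _ => //; [exact: pwle1|exact: pwleM]. Qed.

Lemma pwle_exp (q : {poly P}) k : pwle q -> pwle (q ^+ k).
Proof.
move=> h; elim: k => [|k IH]; first exact: pwle1.
by rewrite exprS; apply: pwleM.
Qed.

Lemma pwle_xg i : pwle (xg X i).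
Proof. by move=> k; rewrite coef_xg; apply: wle_pc. Qed.

Lemma pwle_Gp : pwle (Gp X).
Proof. by apply: pwle_prod => i; apply: pwle_xg. Qed.

End Weight.

Lemma coef_prod_top (R : comNzRingType) (I : Type) (s : seq I)
    (p : I -> {poly R}) (e : I -> nat) :
  (forall i, size (p i) <= (e i).+1)%N ->
  (size (\prod_(i <- s) p i)%R <= (\sum_(i <- s) e i).+1)%N /\
  (\prod_(i <- s) p i)`_(\sum_(i <- s) e i)%N = \prod_(i <- s) (p i)`_(e i).
Proof.
move=> h; elim: s => [|i s [IH1 IH2]].
  by rewrite !big_nil size_poly1 coef1.
rewrite !big_cons; set q := \prod_(j <- s) _ in IH1 IH2 *; set k := (\sum_(j <- s) _)%N in IH1 IH2 *.
split.
  apply: leq_trans (size_polyMleq _ _) _.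
  have := leq_add (h i) IH1; rewrite addSn addnS; lia.
rewrite -IH2 coefM (bigD1 (Ordinal (leq_addr k (e i) : e i < (e i + k).+1)%N)) //= addKn big1 ?addr0 //.
move=> j ji; have [jl|jl] := ltnP (e i) j.
  by rewrite nth_default ?mul0r // (leq_trans (h i)).
rewrite [X in _ * X]nth_default ?mulr0 // (leq_trans IH1) //.
have {ji} : (j != e i :> nat) by apply: contra ji => /eqP e1; apply/eqP/val_inj.
by move: jl; move: (nat_of_ord j) => j' h1 h2; lia.
Qed.

Section Spanning.
Variables (C : fieldType) (n : nat) (d : 'I_n -> nat).
Notation N := (ncoef d).
Notation P := {mpoly C[N]}.
Notation X := (fun t : 'I_N => 'X_t : P).
Notation D := (dsum d).
Implicit Types (q : P) (m : 'X_{1..N}).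

(** Specialization to smaller degrees d' inside one fixed polynomial ring, so that the recursion on
    d' never changes the ring. *)
Definition kill (d' : 'I_n -> nat) : P -> P :=
  mmap (@mpolyC N C) (fun t =>
    if (wtc t <= d' (tag (enum_val t)))%N then 'X_t else 0).
HB.instance Definition _ d' := GRing.RMorphism.on (kill d').

Lemma killZ d' c q : kill d' (c *: q) = c *: kill d' q.
Proof. by rewrite /kill mmapZ mul_mpolyC. Qed.

Lemma kill_cix d' i (l : 'I_(d i)) :
  kill d' 'X_(cix l) = if (l < d' i)%N then 'X_(cix l) else 0.
Proof. by rewrite /kill mmapX mmap1U wtc_cix /cix enum_rankK. Qed.

Lemma kill_pc d' i l : kill d' (pc X i l) = if (l <= d' i)%N then pc X i l else 0.
Proof.
case: l => [|l] /=; first by rewrite rmorph1.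
case: insubP => [j _ jl|_]; last by rewrite rmorph0 if_same.
by rewrite kill_cix jl.
Qed.

Lemma kill_id d' q : (forall i, d i <= d' i)%N -> kill d' q = q.
Proof.
move=> h; rewrite {2}[q]mpolyE /kill /mmap; apply: eq_bigr => m _.
rewrite mul_mpolyC mpolyXE_id /mmap1; congr (_ *: _); apply: eq_bigr => t _.
have [i [l ->]] := cix_surj t; rewrite wtc_cix /cix enum_rankK /=.
by rewrite (leq_trans (ltn_ord l)).
Qed.

Definition Emon (kap : 'X_{1..D}) : P := mmap1 (fun k => (Gp X)`_k.+1) kap.

Lemma EmonD k1 k2 : Emon (k1 + k2)%MM = Emon k1 * Emon k2.
Proof. by apply: commr_mmap1_M => i x; apply: mulrC. Qed.

Definition has_content (d' : 'I_n -> nat) (w : seq 'I_n) := forall i, count_mem i w = d' i.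

(** [mnmwgt kap] is the weight of E^kap, each E_k having weight k; the index bounds the weight of
    every generator used, not just that of the sum. *)
Inductive spanned d' : nat -> P -> Prop :=
| spanned0 e : spanned d' e 0
| spannedD e p q : spanned d' e p -> spanned d' e q -> spanned d' e (p + q)
| spanned_gen e w kap c : has_content d' w -> (wdeg w + mnmwgt kap <= e)%N ->
    spanned d' e (c *: (ew X w * Emon kap)).

Lemma spanned_mulE d' e q (k : 'I_D) :
  spanned d' e q -> spanned d' (e + k.+1) ((Gp X)`_k.+1 * q).
Proof.
elim=> {e q} [f|f p r _ IHp _ IHr|f w kap c hw hk].
- by rewrite mulr0; apply: spanned0.
- by rewrite mulrDr; apply: spannedD.
have -> : (Gp X)`_k.+1 * (c *: (ew X w * Emon kap)) =
   c *: (ew X w * Emon (U_(k) + kap)%MM).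
  by rewrite EmonD /Emon mmap1U -scalerAr; congr (_ *: _); ring.
by apply: spanned_gen => //; rewrite mnmwgtD mnmwgt1; lia.
Qed.

(** Writing i in front of a word of content d'' multiplies its [ew] by exactly these top
    coefficients, since d'' and d' agree on the letters j < i. *)
Lemma spanned_prefix d' d'' i e q :
  d' i = (d'' i).+1 -> (forall j, j != i -> d' j = d'' j) -> spanned d'' e q ->
  spanned d' (e + \sum_(j < n | (j < i)%N) d' j)
    ((\prod_(j < n | (j < i)%N) pc X j (d' j)) * q).
Proof.
move=> hi hj; elim=> {e q} [f|f p r _ IHp _ IHr|f w kap c hw hk].
- by rewrite mulr0; apply: spanned0.
- by rewrite mulrDr; apply: spannedD.
have hne (j : 'I_n) : (j < i)%N -> d' j = count_mem j w.
  by move=> ji; rewrite hw hj // -val_eqE neq_ltn ji.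
have -> : (\prod_(j < n | (j < i)%N) pc X j (d' j)) * (c *: (ew X w * Emon kap)) =
   c *: (ew X (i :: w) * Emon kap).
  rewrite -scalerAr /= mulrA; congr (_ *: (_ * _ * _)).
  by apply: eq_bigr => j ji; rewrite hne.
apply: spanned_gen.
  move=> j /=; rewrite hw; have [->|ji] := eqVneq j i; first by rewrite hi ?eqxx.
  by rewrite hj // eq_sym (negPf ji).
rewrite /= (eq_bigr d'); last by move=> j ji; rewrite hne.
by rewrite -addnA addnC leq_add.
Qed.

(** The monomials of [q] are sorted by divisibility by the top unknown a_(i, d' i). Those not
    divisible have the same image under both specializations; the divisible ones vanish under d''
    and are divided once to give [qB]. *)
Lemma kill_split d' d'' i e q :
  (d' i <= d i)%N -> d' i = (d'' i).+1 -> (forall j, j != i -> d' j = d'' j) ->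
  wle e q ->
  exists2 qB, forall m, m \in msupp qB -> (wt m + d' i <= e)%N
           & kill d' q = kill d'' q + pc X i (d' i) * kill d' qB.
Proof.
move=> hi hi' hj; have lti : (d'' i < d i)%N by rewrite -hi'.
pose t := cix (Ordinal lti).
have pct : pc X i (d' i) = 'X_t by rewrite hi' (pcS X (Ordinal lti)).
move: q; apply: wle_ind => [p q' [pB hp Ep] [qB hq Eq]||c m hm].
- exists (pB + qB); last by rewrite !rmorphD /= Ep Eq; ring.
  by move=> m /msuppD_le; rewrite mem_cat => /orP[/hp|/hq].
- by exists 0; rewrite ?rmorph0 ?mulr0 ?addr0 // => m; rewrite msupp0.
have [mt|mt] := boolP (U_(t) <= m)%MM.
  have mE := submK mt; exists (c *: 'X_[m - U_(t)]).
    move=> k /msuppZ_le; rewrite msuppX inE => /eqP ->.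
    by move: hm; rewrite -{1}mE wtD wtU wtc_cix -hi'.
  rewrite -{1 2}mE mpolyXD !killZ !rmorphM /= pct !kill_cix /= -hi' leqnn.
  by rewrite hi' ltnn mulr0 scaler0 add0r -!scalerAr mulrC.
exists 0 => [k|]; first by rewrite msupp0.
rewrite rmorph0 mulr0 addr0.
rewrite !killZ /kill !mmapX; congr (_ *: _); apply: eq_bigr => s _.
have [i' [l ->]] := cix_surj s; rewrite wtc_cix /cix enum_rankK /= -/(cix l).
have [e1|ne] := eqVneq i' i; last by rewrite hj.
subst i'.
have [lE|lne] := eqVneq (l : nat) (d'' i); last first.
  by rewrite hi' ltnS leq_eqVlt (negPf lne).
have -> : cix l = t by congr cix; apply: val_inj.
move: mt; rewrite lep1mP negbK => /eqP ->.
by rewrite !expr0.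
Qed.

(** Induction on |d'|, then on the weight bound. Modulo the top coefficient of x_i the degrees drop
    to d' - 1_i, where words are one letter shorter; dividing by the top coefficients one after
    another leaves a spanned part plus their product, that is E_|d'|, times a polynomial of smaller
    weight. Since [Q] is compared with [q] only after specialization, the [Q] found for d' - 1_i can
    be reused unspecialized for d'. *)
Lemma spanning k d' : (forall i, d' i <= d i)%N -> (\sum_i d' i)%N = k ->
  forall e q, wle e q -> exists2 Q, spanned d' e Q & kill d' q = kill d' Q.
Proof.
elim: k d' => [|k IHk] d' d'le d'k e q.
  have d'0 i : d' i = 0%N by apply/eqP; rewrite -leqn0 -d'k (bigD1 i) //= leq_addr.
  move: q; apply: wle_ind => [p r [P1 sp Ep] [P2 sr Er]||c m hm].
  - by exists (P1 + P2); [exact: spannedD | rewrite !rmorphD /= Ep Er].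
  - by exists 0; [exact: spanned0|].
  have [->|m0] := eqVneq m 0%MM.
    exists (c *: (ew X [::] * Emon 0%MM)).
      by apply: spanned_gen; rewrite ?mnmwgt0 // => i; rewrite d'0.
    by rewrite /Emon mmap11 mpolyX0 mulr1.
  exists 0; first exact: spanned0.
  rewrite rmorph0 killZ /kill mmapX.
  have: mdeg m != 0%N by rewrite mdeg_eq0.
  rewrite mdegE sum_nat_eq0 negb_forall => /existsP[t /=] mt.
  rewrite /mmap1 (bigD1 t) //= d'0 leqn0 /wtc /= expr0n (negPf mt) mul0r.
  by rewrite scaler0.
elim/ltn_ind: e q => e IHe q hq.
pose pre s := \prod_(j < n | (j < s)%N) pc X j (d' j).
pose ds s := (\sum_(j < n | (j < s)%N) d' j)%N.
(* After the letters below s are treated, the remainder carries their top coefficients as the factor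
   [pre s], and the weight of its cofactor has dropped by [ds s]. *)
have loop s : (s <= n)%N -> exists Q, exists qs,
    [/\ spanned d' e Q, forall m, m \in msupp qs -> (wt m + ds s <= e)%N
      & kill d' q = kill d' (Q + pre s * qs)].
  elim: s => [|s IHs] sn.
    exists 0, q; split; first exact: spanned0.
      by move=> m /hq; rewrite /ds big_pred0 ?addn0.
    by rewrite add0r /pre big_pred0 ?mul1r.
  have [Q [qs [spQ hqs EQ]]] := IHs (ltnW sn).
  pose i : 'I_n := Ordinal sn.
  have recE (j : 'I_n) : (j < s.+1)%N = (j < s)%N || (j == i).
    by rewrite ltnS leq_eqVlt orbC -val_eqE.
  have preS : pre s.+1 = pre s * pc X i (d' i).
    rewrite /pre (bigID (fun j : 'I_n => j == i)) /= mulrC; congr (_ * _).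
      apply: eq_bigl => j; rewrite recE; case: eqP => [->|_] /=.
        by rewrite ltnn.
      by rewrite orbF andbT.
    rewrite (eq_bigl (pred1 i)) ?big_pred1_eq // => j.
    by rewrite recE /=; case: eqP => //=; rewrite ?orbT ?andbF.
  have dsS : ds s.+1 = (ds s + d' i)%N.
    rewrite /ds (bigID (fun j : 'I_n => j == i)) /= addnC; congr (_ + _)%N.
      apply: eq_bigl => j; rewrite recE; case: eqP => [->|_] /=.
        by rewrite ltnn.
      by rewrite orbF andbT.
    rewrite (eq_bigl (pred1 i)) ?big_pred1_eq // => j.
    by rewrite recE /=; case: eqP => //=; rewrite ?orbT ?andbF.
  case di0: (d' i) => [|di].
    exists Q, qs; split=> //; first by move=> m /hqs; rewrite dsS di0 addn0.
    by rewrite preS di0 mulr1.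
  (* A nonzero [qs] has a leading monomial, from which [ds s <= e] is read off; the truncated
     subtraction [e - ds s] relies on it. *)
  have [qs0|qs0] := eqVneq qs 0.
    exists Q, 0; split=> //; first by move=> m; rewrite msupp0.
    by rewrite EQ qs0 !mulr0.
  pose d'' j := if j == i then di else d' j.
  have h1 : d' i = (d'' i).+1 by rewrite /d'' eqxx.
  have h2 j : j != i -> d' j = d'' j by rewrite /d'' => /negPf ->.
  have le'' j : (d'' j <= d j)%N.
    rewrite /d''; case: eqP => [->|_ //]; apply: leq_trans (d'le i).
    by rewrite di0.
  have sum'' : (\sum_j d'' j)%N = k.
    apply: succn_inj; rewrite -d'k (bigD1 i) //= [in RHS](bigD1 i) //= h1 addSn.
    by congr (_ + _).+1; apply: eq_bigr => j /h2 ->.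
  have dse : (ds s <= e)%N.
    apply: leq_trans (leq_addl _ _) (hqs (mlead qs) _).
    exact: mlead_supp.
  have wqs : wle (e - ds s) qs by move=> m /hqs; rewrite leq_subRL // addnC.
  have [Q' spQ' EQ'] := IHk d'' le'' sum'' _ _ wqs.
  have wQ' : wle (e - ds s) Q'.
    elim: spQ' => {Q' EQ'} [f|f p r _ IHp _ IHr|f w kap c hw hk].
    - exact: wle0.
    - exact: wleD.
    apply/wleZ/(wle_mono hk)/wleM; first exact: wle_ew.
    rewrite /Emon /mnmwgt /mmap1; apply: wle_prod => j _.
    by rewrite mulnC; apply/wle_exp/pwle_Gp.
  have [qB hB EB] := kill_split (d'le i) h1 h2 (wleB wqs wQ').
  exists (Q + pre s * Q'), qB; split.
  - apply: spannedD => //.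
    have := spanned_prefix h1 h2 spQ'.
    by rewrite (subnK dse).
  - by move=> m /hB; rewrite dsS; move: dse; lia.
  move: EB; rewrite !rmorphB /= EQ' subrr add0r => EB.
  rewrite EQ preS !rmorphD !rmorphM /=.
  have -> : kill d' qs = kill d' Q' + pc X i (d' i) * kill d' qB.
    by rewrite -EB addrC subrK.
  by rewrite (kill_pc d' i) leqnn; ring.
have [Q [qn [spQ hqn EQ]]] := loop n (leqnn n).
have dsn : ds n = k.+1 by rewrite /ds -d'k; apply: eq_bigl => j; rewrite ltn_ord.
have [qn0|qn0] := eqVneq qn 0; first by exists Q; rewrite // EQ qn0 mulr0 addr0.
have ke : (k.+1 <= e)%N.
  rewrite -dsn; apply: leq_trans (leq_addl _ _) (hqn (mlead qn) _).
  exact: mlead_supp.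
have wqn : wle (e - k.+1) qn by move=> m /hqn; rewrite dsn leq_subRL // addnC.
have [|Q' spQ' EQ'] := IHe (e - k.+1)%N _ _ wqn; first by lia.
have kD : (k < D)%N by rewrite -d'k; apply: leq_sum => i _; apply: d'le.
(* After specialization the i-th factor has degree at most d' i, so the coefficient of t^|d'| in the
   product is the product of the top coefficients. *)
have topE : kill d' (pre n) = kill d' (Gp X)`_k.+1.
  have szk i : (size (map_poly (kill d') (xg X i)) <= (d' i).+1)%N.
    apply/leq_sizeP => j jd; rewrite coef_map /= coef_xg kill_pc.
    by rewrite leqNgt jd.
  have [_] := coef_prod_top (index_enum 'I_n) szk.
  rewrite d'k -rmorph_prod coef_map /= => ->.
  rewrite /pre rmorph_prod; rewrite (eq_bigl xpredT) => [|j]; last exact: ltn_ord.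
  by apply: eq_bigr => j _; rewrite coef_map coef_xg.
exists (Q + (Gp X)`_k.+1 * Q').
  apply: spannedD => //; rewrite -(subnK ke).
  exact: (spanned_mulE (Ordinal kD) spQ').
by rewrite EQ !rmorphD !rmorphM /= topE EQ'.
Qed.

Lemma spanning_top e q : wle e q -> spanned d e q.
Proof.
move=> /(@spanning _ d (fun i => leqnn _) erefl) [Q sQ].
by rewrite !kill_id // => ->.
Qed.

End Spanning.

(** * Linear independence of the e_w *)

Lemma rmorph_mmap1 (S S' : comNzRingType) (phi : {rmorphism S -> S'}) k
    (h : 'I_k -> S) m :
  phi (mmap1 h m) = mmap1 (phi \o h) m.
Proof. by rewrite rmorph_prod; apply: eq_bigr => i _; rewrite rmorphXn. Qed.

Lemma rmorph_mmap (R : nzRingType) (S S' : comNzRingType)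
    (phi : {rmorphism S -> S'}) (f : R -> S) k (h : 'I_k -> S) q :
  phi (mmap f h q) = mmap (phi \o f) (phi \o h) q.
Proof.
rewrite rmorph_sum; apply: eq_bigr => m _.
by rewrite rmorphM rmorph_mmap1.
Qed.

Lemma eq_mmap (R : nzRingType) (S : comNzRingType) (f f' : R -> S) k
    (h h' : 'I_k -> S) q : f =1 f' -> h =1 h' -> mmap f h q = mmap f' h' q.
Proof.
by move=> ef eh; apply: eq_bigr => m _; rewrite ef (mmap1_eq _ eh).
Qed.

(** Interpolation: a product of affine forms, one vanishing at each other point but not at a,
    isolates [lam a]. *)
Lemma eval_points_free (K : fieldType) (k : nat) (I : finType)
    (pts : I -> 'I_k -> K) (lam : I -> K) :
  (forall a b, a != b -> exists t, pts a t != pts b t) ->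
  (forall m, \sum_a lam a * mmap1 (pts a) m = 0) -> forall a, lam a = 0.
Proof.
move=> hd hm a.
have hq (q : {mpoly K[k]}) : \sum_b lam b * q.@[pts b] = 0.
  rewrite [q]mpolyE; under eq_bigr do rewrite raddf_sum mulr_sumr.
  rewrite exchange_big big1 //= => m _.
  transitivity (q@_m * \sum_b lam b * mmap1 (pts b) m); last by rewrite hm mulr0.
  rewrite mulr_sumr; apply: eq_bigr => b _.
  by rewrite mevalZ mevalX mulrCA.
pose fac b : {mpoly K[k]} :=
  if [pick t | pts b t != pts a t] is Some t then 'X_t - (pts b t)%:MP else 0.
have facP b : b != a -> (fac b).@[pts b] = 0 /\ (fac b).@[pts a] != 0.
  move=> ba; rewrite /fac; case: pickP => [t ht|h].
    by rewrite !mevalB !mevalXU !mevalC subrr subr_eq0 eq_sym.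
  by have [t] := hd b a ba; rewrite h.
have := hq (\prod_(b | b != a) fac b).
rewrite (bigD1 a) //= [X in _ + X]big1 ?addr0 => [/eqP|b ba].
  rewrite mulf_eq0 => /orP[/eqP//|]; rewrite rmorph_prod /= => /eqP/eqP.
  by case/prodf_eq0=> b /facP[_ /negPf ->].
by rewrite rmorph_prod (bigD1 b) //= (facP b ba).1 mul0r mulr0.
Qed.

Section Points.
Variables (n : nat) (d : 'I_n -> nat).
Notation N := (ncoef d).
Notation D := (dsum d).

Definition wd (a : 'I_#|dwords d|) : D.-tuple 'I_n := enum_val a.

Lemma wd_content a : has_content d (wd a).
Proof.
by move=> i; have := enum_valP a; rewrite inE => /forallP/(_ i)/eqP.
Qed.

Lemma wd_inj : injective wd.
Proof. exact: enum_val_inj. Qed.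

Lemma wdP (w : D.-tuple 'I_n) : has_content d w -> exists a, wd a = w.
Proof.
move=> h; have wD : w \in dwords d by rewrite inE; apply/forallP=> i; rewrite h.
by exists (enum_rank_in wD w); rewrite /wd enum_rankK_in.
Qed.

Lemma content_size w : has_content d w -> size w = D.
Proof.
move=> h; rewrite -sum1_size (partition_big id xpredT) //=.
by apply: eq_bigr => i _; rewrite -h sum1_count.
Qed.

Section Field.
Variables (K : fieldType) (rho : 'I_D -> K).

(** A word distributes the D linear factors 1 + rho_k t over the colours, so all the points [pw w]
    lie in one fibre of E. The field is left open: it will be C with roots of unity, and a fraction
    field with indeterminates. *)
Definition gw (w : D.-tuple 'I_n) i : {poly K} :=
  \prod_(k < D | tnth w k == i) (1 + rho k *: 'X).

Definition pw (w : D.-tuple 'I_n) (t : 'I_N) : K :=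
  (gw w (tag (enum_val t)))`_(wtc t).

Lemma count_tnth (w : D.-tuple 'I_n) i :
  count_mem i w = (\sum_(k < D | tnth w k == i) 1)%N.
Proof.
by rewrite -sum1_count (big_tuple _ _ w (fun j => j == i) (fun=> 1%N)).
Qed.

Lemma size_gw (w : D.-tuple 'I_n) i : has_content d w -> (size (gw w i) <= (d i).+1)%N.
Proof.
move=> h; rewrite -h count_tnth /gw; elim/big_ind2: _ => //.
- by rewrite size_poly1.
- move=> p e q f hp hq; apply: leq_trans (size_polyMleq _ _) _; lia.
move=> k _; apply: leq_trans (size_polyD _ _) _.
rewrite geq_max size_poly1 /=.
by apply: leq_trans (size_scale_leq _ _) _; rewrite size_polyX.
Qed.

Lemma pc_pw (w : D.-tuple 'I_n) i l : has_content d w -> pc (pw w) i l = (gw w i)`_l.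
Proof.
move=> h; case: l => [|l].
  rewrite -horner_coef0 horner_prod big1 // => k _.
  by rewrite !hornerE ?mulr0 ?addr0.
have [ld|ld] := ltnP l (d i).
  by rewrite (pcS (pw w) (Ordinal ld)) /pw wtc_cix /cix enum_rankK.
rewrite pc_gt // nth_default //; exact: leq_trans (size_gw _ h) _.
Qed.

Lemma xg_pw (w : D.-tuple 'I_n) i : has_content d w -> xg (pw w) i = gw w i.
Proof. by move=> h; apply/polyP=> l; rewrite coef_xg pc_pw. Qed.

Lemma Gp_pw (w : D.-tuple 'I_n) : has_content d w -> Gp (pw w) = \prod_(k < D) (1 + rho k *: 'X).
Proof.
move=> h; rewrite /Gp (partition_big (tnth w) xpredT) //=.
by apply: eq_bigr => i _; rewrite xg_pw.
Qed.

Hypothesis rho_inj : injective rho.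
Hypothesis rho0 : forall k, rho k != 0.

(** The k-th letter is the only colour whose factor vanishes at -1/rho_k. *)
Lemma pw_inj (w w' : D.-tuple 'I_n) : has_content d w -> has_content d w' ->
  pw w =1 pw w' -> w = w'.
Proof.
move=> h h' e; apply/eq_from_tnth=> k; set i := tnth w k.
have: (gw w i).[- (rho k)^-1] = 0.
  rewrite horner_prod (bigD1 k) //= !hornerE.
  by rewrite mulrN divff ?subrr ?mul0r.
rewrite -xg_pw //.
have -> : xg (pw w) i = gw w' i.
  by rewrite -xg_pw //; apply/polyP=> l; rewrite !coef_xg; apply: eq_pc.
rewrite horner_prod => /eqP/prodf_eq0[k' /eqP <-]; rewrite !hornerE.
rewrite mulrN subr_eq0 => /eqP e1.
have: rho k' = rho k by rewrite -[LHS](mulfVK (rho0 k)) -e1 mul1r.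
by move/rho_inj ->.
Qed.

Variables (C : fieldType) (iota : {rmorphism C -> K}).
Notation X := (fun t : 'I_N => 'X_t : {mpoly C[N]}).

Lemma mmap_ew (p : 'I_N -> K) w : mmap iota p (ew X w) = ew p w.
Proof. by rewrite ew_rmorph; apply: eq_ew => t /=; rewrite mmapX mmap1U. Qed.

Lemma mmap_Gp (p : 'I_N -> K) k : mmap iota p (Gp X)`_k = (Gp p)`_k.
Proof.
rewrite -coef_map /= map_Gp; suff -> : Gp (mmap iota p \o X) = Gp p by [].
apply: eq_bigr => i _; apply/polyP=> l; rewrite !coef_xg.
by apply: eq_pc => t /=; rewrite mmapX mmap1U.
Qed.

(** There are as many points as words. A combination of evaluations killing every e_w kills every
    e_w E^kap, because E is constant on the points; these span, so it kills all polynomials, and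
    evaluations at distinct points are independent. *)
Lemma ew_points_unit :
  \matrix_(b, a) ew (pw (wd b)) (wd a) \in unitmx.
Proof.
rewrite -row_free_unit; apply: inj_row_free => u hu.
have hq (q : {mpoly C[N]}) : \sum_b u 0 b * mmap iota (pw (wd b)) q = 0.
  pose e := (\max_(m <- msupp q) wt m)%N.
  have wq : wle e q by move=> m mq; apply: (leq_bigmax_seq _ mq).
  elim: (spanning_top wq) => [f|f p r _ IHp _ IHr|f w kap c hw hk].
  - by rewrite big1 // => b _; rewrite rmorph0 mulr0.
  - under eq_bigr do rewrite rmorphD mulrDr.
    by rewrite big_split /= IHp IHr addr0.
  have sw := content_size hw.
  have [a wa] : exists a, wd a = w :> seq _.
    have hw' : has_content d (tcast sw (in_tuple w)).
      by move=> i; rewrite val_tcast hw.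
    by have [a ha] := wdP hw'; exists a; rewrite ha val_tcast.
  have /rowP/(_ a) := hu; rewrite mxE [RHS]mxE => ha.
  pose cc := iota c * mmap1 (fun k : 'I_D => (\prod_(k < D) (1 + rho k *: 'X))`_k.+1) kap.
  transitivity (cc * \sum_b u 0 b * ew (pw (wd b)) w); last first.
    transitivity (cc * 0); last by rewrite mulr0.
    congr (_ * _); rewrite -[RHS]ha; apply: eq_bigr => b _.
    by rewrite mxE wa.
  rewrite mulr_sumr; apply: eq_bigr => b _.
  rewrite mmapZ rmorphM /= mmap_ew /Emon rmorph_mmap1 /=.
  rewrite (mmap1_eq (f2 := fun k : 'I_D => (\prod_(k < D) (1 + rho k *: 'X))`_k.+1)).
    by rewrite /cc; ring.
  by move=> k /=; rewrite mmap_Gp Gp_pw //; apply: wd_content.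
apply/rowP=> b; rewrite [RHS]mxE.
apply: (@eval_points_free _ _ _ (fun b => pw (wd b)) (fun b => u 0 b)) => [a a' ne|m].
  case: (pickP (fun t => pw (wd a) t != pw (wd a') t)) => [t ht|h].
    by exists t.
  case/eqP: ne; apply/wd_inj/pw_inj; try exact: wd_content.
  by move=> t; apply/eqP; have := h t => /negbFE.
by rewrite -[RHS](hq 'X_[m]); apply: eq_bigr => a _; rewrite mmapX.
Qed.

End Field.

Lemma coef_prod_mesym (R : idomainType) D' k :
  (\prod_(j < D') (1 + ('X_j : {mpoly R[D']}) *: 'X) : {poly _})`_k = mesym D' R k.
Proof.
under eq_bigr do rewrite addrC.
rewrite bigA_distr coef_sum /mesym [RHS]big_mkcond /=; apply: eq_bigr => J _.
have -> : \prod_j (if j \in J then ('X_j : {mpoly R[D']}) *: 'X else 1) =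
   (\prod_(j in J) 'X_j) *: 'X^(#|J|) :> {poly {mpoly R[D']}}.
  rewrite -big_mkcond /= -sum1_card.
  elim/big_rec3: _ => [|j x y z _ ->]; first by rewrite scale1r.
  by rewrite addSn exprS -scalerAl -scalerAr scalerA.
by rewrite coefZ coefXn eq_sym; case: eqP; rewrite ?mulr1 ?mulr0.
Qed.

Variable C : fieldType.
Notation X := (fun t : 'I_N => 'X_t : {mpoly C[N]}).
Notation E0 := (fun k : 'I_D => (Gp X)`_k.+1).

(** At the points built from indeterminates rho_k the E_k become the elementary symmetric
    polynomials. [ew_points_unit] makes each h_a vanish on these, and they are algebraically
    independent. *)
Lemma ew_free (h : 'I_#|dwords d| -> {mpoly C[D]}) :
  \sum_a mmap (@mpolyC N C) E0 (h a) * ew X (wd a) = 0 -> forall a, h a = 0.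
Proof.
move=> h0 a.
pose K := {fraction {mpoly C[D]}}.
pose toF : {rmorphism {mpoly C[D]} -> K} := @FracField.tofrac {mpoly C[D]}.
have toF_inj : injective toF by move=> x y /eqP; rewrite tofrac_eq => /eqP.
pose iota : {rmorphism C -> K} := toF \o @mpolyC D C.
pose rho (k : 'I_D) : K := toF 'X_k.
have rho_inj : injective rho.
  move=> k k' /toF_inj /(congr1 (fun q => q@_U_(k))).
  rewrite !mcoeffX eqxx eq_mnm1; case: eqP => // _ /eqP.
  by rewrite oner_eq0.
have rho0 k : rho k != 0.
  rewrite -(rmorph0 toF) (inj_eq toF_inj); apply/eqP => /(congr1 (fun q => q@_U_(k))).
  by rewrite mcoeffX eqxx mcoeff0 => /eqP; rewrite oner_eq0.
have uV := ew_points_unit rho_inj rho0 iota.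
pose c (k : 'I_D) : K := (\prod_(k < D) (1 + rho k *: 'X))`_k.+1.
pose hv : 'cV[K]_#|dwords d| := \col_a mmap iota c (h a).
have Vh : (\matrix_(b, a) ew (pw rho (wd b)) (wd a)) *m hv = 0.
  apply/colP => b; rewrite mxE [RHS]mxE.
  have := congr1 (mmap iota (pw rho (wd b))) h0; rewrite rmorph0 rmorph_sum => e.
  rewrite -[RHS]e; apply: eq_bigr => a' _.
  rewrite !mxE rmorphM /= mmap_ew mulrC; congr (_ * _).
  rewrite rmorph_mmap; apply: eq_mmap => [x|k] /=; first by rewrite mmapC.
  by rewrite mmap_Gp Gp_pw //; apply: wd_content.
have /colP/(_ a) : hv = 0 by rewrite -[hv](mulKmx uV) Vh mulmx0.
rewrite !mxE => ha; apply: msym_fundamental_un0; apply: toF_inj.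
rewrite rmorph0 -[RHS]ha /comp_mpoly rmorph_mmap.
apply: eq_mmap => // k /=; rewrite tnth_map tnth_ord_tuple /c.
rewrite -coef_prod_mesym -coef_map /= rmorph_prod; apply: (congr1 (fun q : {poly K} => q`_k.+1)).
by apply: eq_bigr => j _; rewrite rmorphD rmorph1 /= map_polyZ map_polyX.
Qed.

End Points.

(** * Openness of spanning and independence *)

Definition en (T : finType) (i : 'I_#|T|) : T := enum_val i.

Lemma en_rank (T : finType) (x : T) : en (enum_rank x) = x.
Proof. exact: enum_rankK. Qed.

Lemma enK (T : finType) (i : 'I_#|T|) : enum_rank (en i) = i.
Proof. exact: enum_valK. Qed.

Lemma en_inj (T : finType) : injective (@en T).
Proof. exact: enum_val_inj. Qed.

Lemma sum_en (V : nmodType) (T : finType) (f : T -> V) :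
  \sum_(i < #|T|) f (en i) = \sum_x f x.
Proof. by rewrite [RHS](reindex (@en T)) //; apply/onW_bij/enum_val_bij. Qed.

Section Osc.
Variables (n : nat) (d : 'I_n -> nat).
Notation N := (ncoef d).
Notation D := (dsum d).
Notation M := #|{: coefmon n D}|.

Definition cmon (j : 'I_M) : 'X_{1..n} := bmnm (val (enum_val j)).

Definition xr (K : nzRingType) (p : 'I_N -> K) i : {poly K} := xg p i - 1.

Lemma coef_xr (K : nzRingType) (p : 'I_N -> K) i l :
  (xr p i)`_l = if l is 0 then 0 else pc p i l.
Proof.
by rewrite coefB coef_xg coef1; case: l => [|l] /=; rewrite ?subrr ?subr0.
Qed.

Lemma map_xr (K L : nzRingType) (f : {rmorphism K -> L}) p i :
  map_poly f (xr p i) = xr (f \o p) i.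
Proof. by rewrite rmorphB rmorph1 /= map_xg. Qed.

Definition monx (K : comNzRingType) (p : 'I_N -> K) (m : 'X_{1..n}) : {poly K} :=
  mmap1 (xr p) m.

Lemma map_monx (K L : comNzRingType) (f : {rmorphism K -> L}) p m :
  map_poly f (monx p m) = monx (f \o p) m.
Proof.
rewrite rmorph_mmap1; apply: mmap1_eq => i /=; exact: map_xr.
Qed.

Definition low (K : nzRingType) e (q : {poly K}) := forall k, (k < e)%N -> q`_k = 0.

Lemma lowM (K : nzRingType) e f (p q : {poly K}) :
  low e p -> low f q -> low (e + f) (p * q).
Proof.
move=> hp hq k kef; rewrite coefM big1 // => j _.
have [je|ej] := ltnP j e; first by rewrite hp ?mul0r.
by rewrite hq ?mulr0 //; have := ltn_ord j; lia.
Qed.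

Lemma coef_monx_lt (K : comNzRingType) (p : 'I_N -> K) m k :
  (k < mdeg m)%N -> (monx p m)`_k = 0.
Proof.
suff h : low (mdeg m) (monx p m) by apply: h.
rewrite mdegE /monx /mmap1; elim/big_ind2: _ => [k'|e1 q1 e2 q2|i _] //.
  by move=> *; apply: lowM.
elim: (m i) => [|e IH] //; rewrite exprS -add1n; apply: lowM => //.
by case=> // _; rewrite coef_xr.
Qed.

(** Since x(0) = 0, x(t)^m has order at least |m|, so monomials of degree above k do not reach t^k.
    The ring [K] serves both the unknown coefficients and actual parametrizations. *)
Lemma coef_comp (C : fieldType) (K : comNzRingType) (iota : {rmorphism C -> K})
    (p : 'I_N -> K) (f : {mpoly C[n]}) k :
  f@_0%MM = 0 -> (k <= D)%N ->
  (mmap (polyC \o iota) (xr p) f)`_k =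
    \sum_(j < M) iota (coefvec D f j) * (monx p (cmon j))`_k.
Proof.
move=> f0 kD; pose h m := iota f@_m * (monx p m)`_k.
have -> : (mmap (polyC \o iota) (xr p) f)`_k = \sum_(m <- msupp f) h m.
  by rewrite coef_sum; apply: eq_bigr => m _; rewrite coefCM.
rewrite /coefvec.
rewrite (sum_en (fun c : coefmon n D => h (bmnm (val c)))).
rewrite -big_enum /=.
rewrite -(big_map (fun c : coefmon n D => bmnm (val c)) xpredT h).
rewrite [RHS](bigID (mem (msupp f))) /= [X in _ + X]big1 ?addr0; last first.
  by move=> m /memN_msupp_eq0; rewrite /h => ->; rewrite rmorph0 mul0r.
rewrite (bigID (fun m => (0 < mdeg m <= D)%N)) /= [X in _ + X]big1 ?addr0; last first.
  move=> m; rewrite negb_and -leqNgt leqn0 -ltnNge /h => /orP[|hm].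
    by rewrite mdeg_eq0 => /eqP ->; rewrite f0 rmorph0 mul0r.
  by rewrite coef_monx_lt ?mulr0 // (leq_ltn_trans kD).
rewrite -big_filter -[RHS]big_filter; apply: perm_big; apply: uniq_perm.
- by rewrite filter_uniq // msupp_uniq.
- rewrite filter_uniq // map_inj_uniq ?enum_uniq // => c c' e.
  by apply/val_inj/val_inj.
move=> m; rewrite !mem_filter andbC; case: (m \in msupp f) => //=.
apply/idP/mapP => [/andP[m0 mD]|[c _ ->]].
  pose b : 'X_{1..n < D.+1} := @BMultinom n D.+1 m mD.
  by exists (exist _ b m0 : coefmon n D); rewrite ?mem_enum.
by rewrite (valP c) -ltnS (bmdeg (val c)).
Qed.

Section Generic.
Variable C : numClosedFieldType.
Notation P := {mpoly C[N]}.
Notation X := (fun t : 'I_N => 'X_t : P).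
Notation r := #|dwords d|.
Implicit Types (F : 'I_M -> C) (q : P).

Definition Ef F (k : nat) : P := \sum_(j < M) F j *: (monx X (cmon j))`_k.

Lemma eval_monx (p : 'I_N -> C) m k : ((monx X m)`_k).@[p] = (monx p m)`_k.
Proof.
rewrite -coef_map /= map_monx; apply: (congr1 (fun q : {poly C} => q`_k)).
apply: mmap1_eq => i; apply/polyP => l; rewrite !coef_xr; case: l => // l.
by apply: eq_pc => t; rewrite /= mevalXU.
Qed.

Lemma eval_Ef F k (p : 'I_N -> C) :
  (Ef F k).@[p] = \sum_(j < M) F j * (monx p (cmon j))`_k.
Proof.
rewrite raddf_sum; apply: eq_bigr => j _.
by rewrite /= mevalZ eval_monx.
Qed.

Lemma wle_Ef F k : wle k (Ef F k).
Proof.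
apply: wle_sum => j _; apply: wleZ; move: k; rewrite -/(pwle _).
apply: pwle_prod => i; apply: pwle_exp => k; rewrite coef_xr.
by case: k => [|k]; [exact: wle0 | exact: wle_pc].
Qed.

Definition f0 : {mpoly C[n]} := \prod_i (1 + 'X_i) - 1.
Definition F0 : 'I_M -> C := coefvec D f0.

Lemma Ef_F0 k : (0 < k <= D)%N -> Ef F0 k = (Gp X)`_k.
Proof.
case/andP=> k0 kD.
have f00 : f0@_0%MM = 0.
  rewrite /f0 mcoeffB mcoeff1 eqxx rmorph_prod big1 ?subrr // => i _ /=.
  by rewrite mcoeffD mcoeff1 eqxx mcoeffX mnm1_eq0 addr0.
have := @coef_comp C P (@mpolyC N C) X f0 k f00 kD.
rewrite /Ef => e; transitivity (\sum_(j < M) (coefvec D f0 j)%:MP * (monx X (cmon j))`_k).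
  by apply: eq_bigr => j _; rewrite mul_mpolyC.
rewrite -e.
have -> : mmap (polyC \o @mpolyC N C) (xr X) f0 = Gp X - 1.
  rewrite /f0 rmorphB rmorph1 rmorph_prod; congr (_ - _); apply: eq_bigr => i _.
  by rewrite rmorphD rmorph1 /= mmapX mmap1U /xr addrC subrK.
by rewrite coefB coef1 gtn_eqF // subr0.
Qed.

Notation generic := (generic F0).
Notation regular := (regular F0).

Definition regularP (phi : ('I_M -> C) -> P) :=
  forall m, regular (fun F => (phi F)@_m).

Lemma regularP_const q : regularP (fun=> q).
Proof. by move=> m; apply: regular_const. Qed.

Lemma regularPM phi psi :
  regularP phi -> regularP psi -> regularP (fun F => phi F * psi F).
Proof.
move=> h1 h2 m.
apply: (@regular_eq _ _ _ (fun F =>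
  \sum_(k : 'X_{1..N < (mdeg m).+1, (mdeg m).+1} | m == (k.1 + k.2)%MM)
     (phi F)@_k.1 * (psi F)@_k.2)).
  by move=> F; rewrite mcoeffM.
by apply: regular_sum => k; apply: regularM.
Qed.

Lemma regularP_exp phi k : regularP phi -> regularP (fun F => phi F ^+ k).
Proof.
move=> h; elim: k => [|k IH] m.
  by apply: regular_eq (regularP_const 1 m) => F; rewrite expr0.
by apply: regular_eq (regularPM h IH m) => F; rewrite exprS.
Qed.

Lemma regularP_prod (I : Type) (s : seq I) (phi : I -> _) :
  (forall i, regularP (phi i)) -> regularP (fun F => \prod_(i <- s) phi i F).
Proof.
move=> h; elim: s => [|i s IH] m.
  by apply: regular_eq (regularP_const 1 m) => F; rewrite big_nil.
by apply: regular_eq (regularPM (h i) IH m) => F; rewrite big_cons.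
Qed.

Lemma regularP_Ef k : regularP (fun F => Ef F k).
Proof.
move=> m; apply: (@regular_eq _ _ _
   (fun F => \sum_(j < M) F j * (monx X (cmon j))`_k@_m)).
  by move=> F; rewrite raddf_sum; apply: eq_bigr => j _; rewrite /= mcoeffZ.
apply: regular_sum => j; apply: regularM; first exact: regular_coord.
exact: regular_const.
Qed.

Definition evE F : {mpoly C[D]} -> P := mmap (@mpolyC N C) (fun k => Ef F k.+1).
HB.instance Definition _ F := GRing.RMorphism.on (evE F).

Lemma evEZ F c h : evE F (c *: h) = c *: evE F h.
Proof. by rewrite /evE mmapZ mul_mpolyC. Qed.

Lemma evE_F0 h : evE F0 h = mmap (@mpolyC N C) (fun k : 'I_D => (Gp X)`_k.+1) h.
Proof. by apply: eq_mmap => // k; rewrite Ef_F0 //= ltn_ord. Qed.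

Lemma eval_evE F h (p : 'I_N -> C) :
  (evE F h).@[p] = h.@[fun k : 'I_D => (Ef F k.+1).@[p]].
Proof.
rewrite /evE [LHS]rmorph_mmap; apply: eq_mmap => // x /=.
by rewrite mevalC.
Qed.

Definition psi F (a : 'I_r) (kap : 'X_{1..D}) : P := ew X (wd a) * evE F 'X_[kap].

Lemma psiF0 a kap : psi F0 a kap = ew X (wd a) * Emon C kap.
Proof. by rewrite /psi evE_F0 mmapX. Qed.

Lemma regularP_psi a kap : regularP (fun F => psi F a kap).
Proof.
apply: regularPM; first exact: regularP_const.
have h : regularP (fun F => mmap1 (fun k : 'I_D => Ef F k.+1) kap).
  by apply: regularP_prod => k; apply/regularP_exp/regularP_Ef.
by move=> m; apply: regular_eq (h m) => F; rewrite /evE mmapX.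
Qed.

Lemma wle_psi F a kap e : (wdeg (wd a) + mnmwgt kap <= e)%N -> wle e (psi F a kap).
Proof.
move=> h; apply/(wle_mono h)/wleM; first exact: wle_ew.
rewrite /evE mmapX /mnmwgt /mmap1; apply: wle_prod => j _.
by rewrite mulnC; apply/wle_exp/wle_Ef.
Qed.

(** The degree bound [e.+1] is a consequence of the weight bound and makes the type finite; likewise
    in [BL]. *)
Definition GL e : finType := {g : 'I_r * 'X_{1..D < e.+1} | (wdeg (wd g.1) + mnmwgt g.2 <= e)%N}.
Definition BL e : finType := {m : 'X_{1..N < e.+1} | (wt m <= e)%N}.
Definition ga e (g : GL e) : 'I_r := (val g).1.
Definition gk e (g : GL e) : 'X_{1..D} := (val g).2.
Definition bl e (m : BL e) : 'X_{1..N} := bmnm (val m).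

Lemma bl_inj e : injective (@bl e).
Proof. by move=> m m' E; apply/val_inj/val_inj. Qed.

Lemma BL_expand e q : wle e q -> q = \sum_(m : BL e) q@_(bl m) *: 'X_[bl m].
Proof.
move=> wq; rewrite {1}[q]mpolyE -big_enum /=.
rewrite -(big_map (@bl e) xpredT (fun m => q@_m *: 'X_[m])).
rewrite [RHS](bigID (mem (msupp q))) /= [X in _ + X]big1 ?addr0; last first.
  by move=> m /memN_msupp_eq0 ->; rewrite scale0r.
rewrite -[RHS]big_filter; apply: perm_big; apply: uniq_perm.
- exact: msupp_uniq.
- rewrite filter_uniq // map_inj_uniq ?enum_uniq //; exact: bl_inj.
move=> m; rewrite mem_filter; case mq: (m \in msupp q) => //=.
apply/esym/mapP; have me := wq m mq.
pose b : 'X_{1..N < e.+1} := @BMultinom N e.+1 m (leq_ltn_trans (mdeg_wt m) (me : wt m < e.+1)%N).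
by exists (exist _ b me : BL e); rewrite ?mem_enum.
Qed.

Lemma spanned_coef e q : spanned d e q -> exists c : GL e -> C,
  q = \sum_g c g *: psi F0 (ga g) (gk g).
Proof.
elim=> {e q} [e|e p q _ [cp ->] _ [cq ->]|e w kap c hw hk].
- by exists (fun=> 0); rewrite big1 // => g _; rewrite scale0r.
- exists (fun g => cp g + cq g); rewrite -big_split; apply: eq_bigr => g _.
  by rewrite scalerDl.
have [a wa] : exists a : 'I_r, wd a = w :> seq _.
  have hw' : has_content d (tcast (content_size hw) (in_tuple w)).
    by move=> i; rewrite val_tcast hw.
  by have [a ha] := wdP hw'; exists a; rewrite ha val_tcast.
have ke : (mdeg kap < e.+1)%N.
  rewrite ltnS (leq_trans _ hk) // (leq_trans _ (leq_addl _ _)) //.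
  exact: leq_mdeg_mnmwgt.
rewrite -wa in hk *.
pose g0 : GL e := exist _ (a, BMultinom ke) hk.
exists (fun g => if g == g0 then c else 0).
rewrite (bigD1 g0) //= eqxx big1 ?addr0 => [|g /negPf ->]; last by rewrite scale0r.
by rewrite psiF0.
Qed.

(** At [F0] the matrix [Cm] expresses monomials through the e_w E^kap, so [Cm *m Psi F] is the
    identity there and invertible nearby; this yields a left inverse [Z F] of [Psi F] with regular
    entries. *)
Lemma generic_span q : exists H : 'I_r -> ('I_M -> C) -> {mpoly C[D]}, exists B,
  [/\ forall a kap, regular (fun F => (H a F)@_kap),
      forall a F, (msize (H a F) <= B)%N
    & generic (fun F => q = \sum_a evE F (H a F) * ew X (wd a))].
Proof.
pose e := (\max_(m <- msupp q) wt m)%N.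
have wq : wle e q by move=> m mq; apply: (leq_bigmax_seq _ mq).
have /fin_all_exists[c hc] : forall m : BL e, exists c : GL e -> C,
    'X_[bl m] = \sum_g c g *: psi F0 (ga g) (gk g).
  by move=> m; apply/spanned_coef/spanning_top/wleX/(valP m).
pose Psi F : 'M[C]_(#|{: GL e}|, #|{: BL e}|) :=
  \matrix_(g, m) (psi F (ga (en g)) (gk (en g)))@_(bl (en m)).
pose Cm : 'M[C]_(#|{: BL e}|, #|{: GL e}|) := \matrix_(m, g) c (en m) (en g).
have regPsi : regularmx F0 Psi.
  by move=> g m; apply: regular_eq (regularP_psi _ _ _) => F; rewrite mxE.
have regY : regularmx F0 (fun F => Cm *m Psi F).
  by apply: regularmxM => //; apply: regularmx_const.
have Y0 : Cm *m Psi F0 = 1%:M.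
  apply/matrixP => m m'; rewrite !mxE.
  transitivity ('X_[bl (en m)]@_(bl (en m')) : C).
    rewrite hc raddf_sum /= -[RHS]sum_en; apply: eq_bigr => g _.
    by rewrite !mxE mcoeffZ.
  rewrite mcoeffX; congr (_%:R); congr nat_of_bool.
  apply/eqP/eqP => [h|-> //].
  by apply: en_inj; apply: bl_inj.
have detY0 : \det (Cm *m Psi F0) != 0 by rewrite Y0 det1 oner_neq0.
pose Z F : 'M_(#|{: BL e}|, #|{: GL e}|) := invmx (Cm *m Psi F) *m Cm.
have regZ : regularmx F0 Z.
  by apply: regularmxM; [exact: regular_invmx | exact: regularmx_const].
pose z F (g : GL e) := \sum_(m : BL e) q@_(bl m) * Z F (enum_rank m) (enum_rank g).
have regz g : regular (fun F => z F g).
  by apply: regular_sum => m; apply: regularM => //; apply: regular_const.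
exists (fun a F => \sum_(g : GL e | (ga g) == a) z F g *: 'X_[(gk g)]), e.+1.
split.
- move=> a kap; apply: (@regular_eq _ _ _ (fun F =>
     \sum_(g : GL e | (ga g) == a) z F g * ('X_[(gk g)]@_kap))).
    move=> F; rewrite raddf_sum; apply: eq_bigr => g _ /=.
    by rewrite mcoeffZ.
  by apply: regular_sum => g; apply: regularM => //; apply: regular_const.
- move=> a F; apply: leq_trans (msize_sum _ _ _) _.
  apply/bigmax_leqP_seq => g _ _; apply: leq_trans (msizeZ_le _ _) _.
  by rewrite msizeX; apply: bmdeg.
apply: generic_imp (regular_neq0 (regular_det regY) detY0) _ => F.
rewrite -unitfE -unitmxE => uY.
have ZP : Z F *m Psi F = 1%:M by rewrite /Z -mulmxA mulVmx.
have mono (m : BL e) : 'X_[bl m] =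
    \sum_g Z F (enum_rank m) (enum_rank g) *: psi F (ga g) (gk g).
  (* The weight bound on [psi] holds for every [F], so comparing coefficients on [BL e] misses no
     monomial. *)
  have wS : wle e (\sum_(g : GL e) Z F (enum_rank m) (enum_rank g)
                      *: psi F (ga g) (gk g)).
    by apply: wle_sum => g _; apply/wleZ/wle_psi/(valP g).
  have wm : wle e ('X_[bl m] : P) by apply/wleX/(valP m).
  rewrite [LHS](BL_expand wm) [RHS](BL_expand wS); apply: eq_bigr => m' _.
  congr (_ *: _); rewrite raddf_sum /= mcoeffX.
  have /matrixP/(_ (enum_rank m) (enum_rank m')) := ZP; rewrite !mxE.
  rewrite (inj_eq enum_rank_inj) => e1.
  transitivity ((m == m')%:R : C); first by rewrite -(inj_eq (@bl_inj e)).
  rewrite -e1 -(sum_en (fun g => (Z F (enum_rank m) (enum_rank g)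
       *: psi F (ga g) (gk g))@_(bl m'))).
  by apply: eq_bigr => g _; rewrite mcoeffZ enK; congr (_ * _); rewrite mxE en_rank.
rewrite [LHS](BL_expand wq).
transitivity (\sum_(g : GL e) z F g *: psi F (ga g) (gk g)).
  under [RHS]eq_bigr do rewrite scaler_suml.
  rewrite [RHS]exchange_big; apply: eq_bigr => m _.
  rewrite [in LHS]mono scaler_sumr; apply: eq_bigr => g _.
  by rewrite scalerA.
rewrite (partition_big (fun g : GL e => (ga g)) xpredT) //=.
apply: eq_bigr => a _; rewrite raddf_sum mulr_suml; apply: eq_bigr => g /eqP <-.
by rewrite /= evEZ /psi -scalerAl mulrC.
Qed.

(** With the sizes bounded by [B] only finitely many products are involved, and their independence
    is a rank condition. *)
Lemma generic_free B : generic (fun F => forall h : 'I_r -> {mpoly C[D]},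
  (forall a, msize (h a) <= B)%N ->
  \sum_a evE F (h a) * ew X (wd a) = 0 -> forall a, h a = 0).
Proof.
pose T : finType := ('I_r * 'X_{1..D < B})%type.
(* Columns are truncated at the degrees occurring at [F0], where nothing is lost; at other [F]
   independence of the truncated rows still implies independence. *)
pose Bc := (\max_(g : T) msize (psi F0 g.1 g.2))%N.
pose Psi F : 'M[C]_(#|T|, #|{: 'X_{1..N < Bc}}|) :=
  \matrix_(g, m) (psi F (en (T := T) g).1 (en (T := T) g).2)@_(bmnm (en m)).
have regPsi : regularmx F0 Psi.
  by move=> g m; apply: regular_eq (regularP_psi _ _ _) => F; rewrite mxE.
pose hu (u : 'rV[C]_#|T|) a : {mpoly C[D]} :=
  \sum_(kap : 'X_{1..D < B}) u 0 (enum_rank ((a, kap) : T)) *: 'X_[kap].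
have huE F u : \sum_a evE F (hu u a) * ew X (wd a) =
    \sum_(g : T) u 0 (enum_rank g) *: psi F g.1 g.2.
  transitivity (\sum_a \sum_(kap : 'X_{1..D < B})
     u 0 (enum_rank ((a, kap) : T)) *: psi F a kap); last first.
    by rewrite pair_bigA; apply: eq_bigr => -[a kap].
  apply: eq_bigr => a _; rewrite raddf_sum mulr_suml; apply: eq_bigr => kap _.
  by rewrite /= evEZ /psi -scalerAl mulrC.
have hu0 u : (forall a, hu u a = 0) -> u = 0.
  move=> h; apply/rowP => g; rewrite [RHS]mxE -[g]enK.
  case: (en g) => a kap.
  have := congr1 (mcoeff kap) (h a); rewrite mcoeff0 raddf_sum /= => <-.
  rewrite (bigD1 kap) //= mcoeffZ mcoeffX eqxx mulr1 big1 ?addr0 // => kap' ne.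
  rewrite mcoeffZ mcoeffX; case: eqP => [E|_]; last by rewrite mulr0.
  by case/eqP: ne; apply: val_inj.
have uPsi F (u : 'rV[C]_#|T|) m : (u *m Psi F) 0 m =
    (\sum_(g : T) u 0 (enum_rank g) *: psi F g.1 g.2)@_(bmnm (en m)).
  rewrite mxE raddf_sum /= -[RHS]sum_en; apply: eq_bigr => g _.
  by rewrite mxE mcoeffZ enK.
have free0 : row_free (Psi F0).
  apply: inj_row_free => u uP; apply: hu0; apply: ew_free.
  transitivity (\sum_a evE F0 (hu u a) * ew X (wd a)).
    by apply: eq_bigr => a _; rewrite evE_F0.
  rewrite huE; set s := (X in X = 0); apply/mpolyP => m; rewrite mcoeff0.
  have [mB|mB] := ltnP (mdeg m) Bc.
    have := uPsi F0 u (enum_rank (BMultinom mB)); rewrite uP mxE en_rank.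
    by move=> /= <-.
  apply: memN_msupp_eq0; apply: msize_mdeg_ge; apply: leq_trans mB.
  apply: leq_trans (msize_sum _ _ _) _; apply/bigmax_leqP_seq => g _ _.
  apply: leq_trans (msizeZ_le _ _) _.
  by rewrite /Bc (bigD1 g) //= leq_maxl.
apply: generic_imp (generic_rank regPsi) _ => F.
rewrite (eqP free0) => rk h hB h0 a.
have freeF : row_free (Psi F) by rewrite /row_free eqn_leq rank_leq_row rk.
pose u : 'rV[C]_#|T| := \row_g (h (en (T := T) g).1)@_(bmnm (en (T := T) g).2).
have hE b : hu u b = h b.
  rewrite [RHS](mpolywE (hB b)); apply: eq_bigr => kap _.
  by rewrite mxE en_rank.
have u0 : u = 0.
  apply: (row_free_inj freeF); rewrite mul0mx; apply/rowP => m.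
  rewrite uPsi -huE; under eq_bigr do rewrite hE.
  by rewrite h0 mcoeff0 mxE.
rewrite -hE /hu u0 big1 // => kap _; by rewrite mxE scale0r.
Qed.

End Generic.
End Osc.

(** * Multiplication matrices *)

Lemma poly_nonroot (C : numDomainType) (q : {poly C}) :
  q != 0 -> exists z, q.[z] != 0.
Proof.
move=> q0; pose s := [seq k%:R : C | k <- iota 0 (size q)].
have us : uniq s by rewrite map_inj_uniq ?iota_uniq //; apply: mulrIn; rewrite oner_eq0.
case: (boolP (all (root q) s)) => [rs|/allPn[z _ hz]]; last by exists z.
by have := max_poly_roots q0 rs us; rewrite size_map size_iota ltnn.
Qed.

(** Weights on the moment curve: each condition is a nonzero polynomial in the single unknown z, and
    so is their product. *)
Lemma separating_weights (C : numDomainType) (I : finType) k (c : I -> 'I_k -> C) :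
  (forall i, exists t, c i t != 0) ->
  exists z, forall i, \sum_t c i t * z ^+ t != 0.
Proof.
move=> hc; pose q i : {poly C} := \sum_(t < k) (c i t)%:P * 'X^t.
have qE i z : (q i).[z] = \sum_t c i t * z ^+ t.
  by rewrite horner_sum; apply: eq_bigr => t _; rewrite !hornerE.
have q0 i : q i != 0.
  have [t ht] := hc i; apply: contra_neq ht => qi.
  have := congr1 (fun p : {poly C} => p`_t) qi; rewrite coef0 coef_sum => <-.
  rewrite (bigD1 t) //= coefCM coefXn eqxx mulr1 big1 ?addr0 // => s st.
  by rewrite coefCM coefXn eq_sym (inj_eq val_inj) (negPf st) mulr0.
have: \prod_i q i != 0 by apply/prodf_neq0.
case/poly_nonroot=> z; rewrite horner_prod => /prodf_neq0 hz.
by exists z => i; rewrite -qE; apply: hz.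
Qed.

(** * Reparametrization t -> lam t *)

Section Scaling.
Variables (n : nat) (d : 'I_n -> nat) (C : fieldType).
Notation N := (ncoef d).

(** The action of t -> lam t on coefficients, see [xr_scp]. *)
Definition scp (lam : C) (p : 'I_N -> C) (t : 'I_N) : C := lam ^+ wtc t * p t.

Lemma pc_scp lam p i l : pc (scp lam p) i l = lam ^+ l * pc p i l.
Proof.
case: l => [|l] /=; first by rewrite mul1r.
case: insubP => [j _ jl|_]; last by rewrite mulr0.
by rewrite /scp wtc_cix jl.
Qed.

Lemma coef_monx_scp lam p m k :
  (monx (scp lam p) m)`_k = lam ^+ k * (monx p m)`_k.
Proof.
pose hom (q q' : {poly C}) := forall k, q`_k = lam ^+ k * q'`_k.
have homM q1 q1' q2 q2' : hom q1 q1' -> hom q2 q2' -> hom (q1 * q2) (q1' * q2').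
  move=> h1 h2 j; rewrite !coefM mulr_sumr; apply: eq_bigr => i _.
  by rewrite h1 h2 mulrACA -exprD subnKC // leq_ord.
have hom1 : hom 1 1 by case=> [|j]; rewrite coef1 ?mulr1 ?mulr0.
suff: hom (monx (scp lam p) m) (monx p m) by apply.
apply: big_ind2 => // i _; elim: (m i) => [|e IH] //.
rewrite !exprS; apply: homM => // -[|l]; rewrite !coef_xr ?mulr0 //.
exact: pc_scp.
Qed.

Lemma ew_scp lam p w : ew (scp lam p) w = lam ^+ wdeg w * ew p w.
Proof.
elim: w => [|i w IH] /=; first by rewrite mulr1.
rewrite IH; under eq_bigr do rewrite pc_scp.
by rewrite big_split exprD (big_morph _ (exprD lam) (expr0 lam)) /=; ring.
Qed.

Lemma xr_scp lam p i s : (xr (scp lam p) i).[s] = (xr p i).[lam * s].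
Proof.
have sz (q : 'I_N -> C) : (size (xr q i : {poly C}) <= (d i).+1)%N.
  apply/leq_sizeP => l hl; rewrite coef_xr; case: l hl => // l hl.
  exact: pc_gt.
rewrite !(horner_coef_wide _ (sz _)); apply: eq_bigr => l _.
case: l => -[|l] hl; rewrite !coef_xr ?mul0r //.
by rewrite pc_scp exprMn [RHS]mulrCA mulrA.
Qed.

End Scaling.

(** * Solutions as joint eigenvalues *)

Section Points.
Variables (n : nat) (d : 'I_n -> nat) (C : numClosedFieldType).
Notation N := (ncoef d).
Notation D := (dsum d).
Notation M := #|{: coefmon n D}|.
Notation P := {mpoly C[N]}.
Notation X := (fun t : 'I_N => 'X_t : P).
Notation r := #|dwords d|.
Notation F0 := (@F0 n d C).
Notation generic := (generic F0).
Notation regular := (regular F0).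
Implicit Types (F : 'I_M -> C) (q : P).

Lemma eval_ew (p : 'I_N -> C) w : (ew X w).@[p] = ew p w.
Proof. exact: (@mmap_ew n d C C idfun p w). Qed.

Lemma eval_Gp (p : 'I_N -> C) k : ((Gp X)`_k).@[p] = (Gp p)`_k.
Proof. exact: (@mmap_Gp n d C C idfun p k). Qed.

Lemma Ef_scp F k lam p : (Ef F k).@[scp lam p] = lam ^+ k * (Ef F k).@[p].
Proof.
rewrite !eval_Ef mulr_sumr; apply: eq_bigr => j _.
by rewrite coef_monx_scp mulrCA.
Qed.

Hypothesis D_gt0 : (0 < D)%N.
Variable zeta : C.
Hypothesis zetaP : D.-primitive_root zeta.

Definition del (k : 'I_D) : C := - (k.+1 == D)%:R.
Definition sol F (p : 'I_N -> C) := forall k : 'I_D, (Ef F k.+1).@[p] = del k.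

Lemma sol_scp F p k : sol F p -> sol F (scp (zeta ^+ k) p).
Proof.
move=> h j; rewrite Ef_scp h /del; case: eqP => [->|_]; last by rewrite oppr0 mulr0.
by rewrite -exprM mulnC exprM (prim_expr_order zetaP) expr1n mul1r.
Qed.

(** The factor 1 + rho0_k t vanishes at zeta^k. *)
Definition rho0 (k : 'I_D) : C := - (zeta ^+ k)^-1.

Lemma zetaX_neq0 k : zeta ^+ k != 0.
Proof.
apply: expf_neq0; apply: contra_eq_neq (prim_expr_order zetaP) => ->.
by rewrite expr0n gtn_eqF // eq_sym oner_neq0.
Qed.

Lemma rho0_neq0 k : rho0 k != 0.
Proof. by rewrite oppr_eq0 invr_eq0 zetaX_neq0. Qed.

Lemma rho0_inj : injective rho0.
Proof.
move=> k k' /oppr_inj/invr_inj/eqP; rewrite (eq_prim_root_expr zetaP).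
by rewrite !modn_small // => /eqP/val_inj.
Qed.

Lemma prod_rho0 : \prod_(k < D) (1 + rho0 k *: 'X) = 1 - 'X^D :> {poly C}.
Proof.
pose c : C := - \prod_(k < D) (- zeta ^+ k).
have h : 1 - 'X^D = c *: \prod_(k < D) (1 + rho0 k *: 'X) :> {poly C}.
  rewrite -opprB -(factor_Xn_sub_1 zetaP) big_mkord /c scaleNr; congr (- _).
  rewrite -mul_polyC rmorph_prod -big_split; apply: eq_bigr => k _ /=.
  rewrite mulrDr mulr1 -mul_polyC mulrA -polyCM /rho0 mulrNN divff ?zetaX_neq0 //.
  by rewrite mul1r polyCN addrC.
have := congr1 (fun q : {poly C} => q.[0]) h.
rewrite hornerZ horner_prod big1 => [|k _]; last by rewrite !hornerE ?mulr0 ?addr0.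
by rewrite !hornerE ?expr0n ?gtn_eqF // ?subr0 ?mulr1 => e; rewrite h -e scale1r.
Qed.

Definition p0 (a : 'I_r) := pw rho0 (wd a).

Lemma sol_p0 a : sol F0 (p0 a).
Proof.
move=> k; rewrite Ef_F0 /= ?ltn_ord //.
rewrite eval_Gp Gp_pw ?prod_rho0; last exact: wd_content.
by rewrite coefB coef1 coefXn sub0r.
Qed.

Definition vp (p : 'I_N -> C) : 'rV[C]_r := \row_a ew p (wd a).

Definition comb F (c : 'cV[{mpoly C[D]}]_r) : P :=
  \sum_a evE F (c a 0) * ew X (wd a).

Lemma combD F c c' : comb F (c + c') = comb F c + comb F c'.
Proof.
rewrite /comb -big_split; apply: eq_bigr => a _.
by rewrite mxE rmorphD mulrDl.
Qed.

Lemma combZ F h c : comb F (h *: c) = evE F h * comb F c.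
Proof.
rewrite /comb mulr_sumr; apply: eq_bigr => a _.
by rewrite mxE rmorphM mulrA.
Qed.

Lemma combB F c c' : comb F (c - c') = comb F c - comb F c'.
Proof. by rewrite combD -scaleN1r combZ rmorphN1 mulN1r. Qed.

Lemma comb0 F : comb F 0 = 0.
Proof. by rewrite /comb big1 // => a _; rewrite mxE rmorph0 mul0r. Qed.

Lemma comb_sum F (I : Type) (s : seq I) c :
  comb F (\sum_(i <- s) c i) = \sum_(i <- s) comb F (c i).
Proof.
by apply: (big_morph (comb F)); [exact: combD | exact: comb0].
Qed.

Lemma eval_comb F c p : (comb F c).@[p] =
  \sum_a (c a 0).@[fun k : 'I_D => (Ef F k.+1).@[p]] * ew p (wd a).
Proof.
rewrite raddf_sum; apply: eq_bigr => a _; rewrite /= mevalM eval_evE.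
by rewrite eval_ew.
Qed.

Definition freeF B F := forall c : 'cV[{mpoly C[D]}]_r,
  (forall a, msize (c a 0%R) <= B)%N -> comb F c = 0 -> c = 0.

Lemma generic_freeF B : generic (freeF B).
Proof.
apply: generic_imp (@generic_free n d C B) _ => F h c hB c0.
by apply/colP => a; rewrite [RHS]mxE; apply: (h (fun a => c a 0)).
Qed.

Definition bnd (m k B : nat) (A : 'M[{mpoly C[D]}]_(m, k)) :=
  forall i j, (msize (A i j) <= B)%N.

Lemma bndM m k l B1 B2 (A1 : 'M_(m, k)) (A2 : 'M_(k, l)) :
  bnd B1 A1 -> bnd B2 A2 -> bnd (B1 + B2).+1 (A1 *m A2).
Proof.
move=> h1 h2 i j; rewrite mxE; apply: leq_trans (msize_sum _ _ _) _.
apply/bigmax_leqP_seq => x _ _; apply: leq_trans (msizeM_le _ _) _.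
by rewrite ltnS leq_add.
Qed.

Lemma bndD m k B1 B2 (A1 A2 : 'M_(m, k)) :
  bnd B1 A1 -> bnd B2 A2 -> bnd (B1 + B2) (A1 + A2).
Proof.
move=> h1 h2 i j; rewrite mxE; apply: leq_trans (msizeD_le _ _) _.
by rewrite geq_max (leq_trans (h1 i j) (leq_addr _ _)) (leq_trans (h2 i j) (leq_addl _ _)).
Qed.

Lemma bndN m k B (A : 'M_(m, k)) : bnd B A -> bnd B (- A).
Proof. by move=> h i j; rewrite mxE msizeN. Qed.

Lemma bndZ m k B c (A : 'M_(m, k)) : bnd B A -> bnd B (c%:MP *: A).
Proof.
by move=> h i j; rewrite mxE mul_mpolyC; apply: leq_trans (msizeZ_le _ _) (h i j).
Qed.

Lemma bnd_sum (I : finType) m k (B : I -> nat) (A : I -> 'M_(m, k)) :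
  (forall i, bnd (B i) (A i)) -> bnd (\sum_i B i) (\sum_i A i).
Proof.
move=> h; apply: (big_ind2 (fun B A => bnd B A)) => [i j|*|i _] //.
  by rewrite mxE msize0.
exact: bndD.
Qed.

(* Am t is the matrix of multiplication by the t-th coordinate on the module
   generated by the ew X w over the ring of the Ef F k; u0 represents 1. *)
Section Mult.
Variables (Am : 'I_N -> ('I_M -> C) -> 'M[{mpoly C[D]}]_r).
Variables (u0 : ('I_M -> C) -> 'cV[{mpoly C[D]}]_r) (B : nat).
Hypothesis bAm : forall t F, bnd B (Am t F).
Hypothesis bu0 : forall F, bnd B (u0 F).

Definition good F :=
  (forall t a, 'X_t * ew X (wd a) = comb F (col a (Am t F))) /\ 1 = comb F (u0 F).

Definition Abar (y : 'I_D -> C) t F : 'M[C]_r := map_mx (meval y) (Am t F).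
Definition cbar m (y : 'I_D -> C) (c : 'cV[{mpoly C[D]}]_m) : 'cV[C]_m :=
  map_mx (meval y) c.

Lemma comb_mulX F t c : good F -> 'X_t * comb F c = comb F (Am t F *m c).
Proof.
move=> [hA _]; have -> : Am t F *m c = \sum_a c a 0 *: col a (Am t F).
  apply/colP => i; rewrite mxE summxE; apply: eq_bigr => a _.
  by rewrite !mxE mulrC.
rewrite comb_sum /comb mulr_sumr; apply: eq_bigr => a _.
by rewrite -/(comb F _) combZ -hA mulrCA.
Qed.

Lemma vp_Abar F p (y : 'I_D -> C) t : good F ->
  (forall k : 'I_D, (Ef F k.+1).@[p] = y k) ->
  vp p *m Abar y t F = p t *: vp p.
Proof.
move=> [hA _] hy; apply/rowP => a; rewrite !mxE.
have := congr1 (meval p) (hA t a); rewrite mevalM mevalXU.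
rewrite eval_ew => ->; rewrite eval_comb; apply: eq_bigr => b _.
by rewrite !mxE mulrC; congr (_ * _); apply: meval_eq => k; rewrite hy.
Qed.

Lemma vp_neq0 F p : good F -> vp p != 0.
Proof.
move=> [_ h1]; apply: contraNneq (oner_neq0 C) => v0.
have := congr1 (meval p) h1; rewrite rmorph1 eval_comb => ->.
rewrite big1 // => a _; have /rowP/(_ a) := v0; rewrite !mxE => ->.
by rewrite mulr0.
Qed.

(** The column is q(A) u0, built one unknown at a time, so a common left eigenvector sees [q] only
    through q(p). Here [p] is merely the tuple of eigenvalues, not yet known to be a solution. *)
Lemma chain q : exists c : ('I_M -> C) -> 'cV[{mpoly C[D]}]_r, exists Bq,
  (forall F, bnd Bq (c F)) /\
  forall F, good F -> q = comb F (c F) /\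
    forall (y : 'I_D -> C) (x : 'rV[C]_r) p, (forall t, x *m Abar y t F = p t *: x) ->
      x *m cbar y (c F) = q.@[p] *: (x *m cbar y (u0 F)).
Proof.
have mono m : exists c : ('I_M -> C) -> 'cV[{mpoly C[D]}]_r, exists Bq,
  (forall F, bnd Bq (c F)) /\
  forall F, good F -> 'X_[m] = comb F (c F) /\
    forall (y : 'I_D -> C) (x : 'rV[C]_r) p, (forall t, x *m Abar y t F = p t *: x) ->
      x *m cbar y (c F) = ('X_[m]).@[p] *: (x *m cbar y (u0 F)).
  elim: {m}(mdeg m) {-2}m (erefl (mdeg m)) => [|e IH] m.
    move/eqP; rewrite mdeg_eq0 => /eqP ->.
    exists u0, B; split=> // F gF; split; first by rewrite mpolyX0; case: gF.
    by move=> y x p _; rewrite mpolyX0 rmorph1 scale1r.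
  move=> me; have: mdeg m != 0%N by rewrite me.
  rewrite mdegE sum_nat_eq0 negb_forall => /existsP[t /= mt].
  have tm : (U_(t) <= m)%MM by rewrite lep1mP.
  have mE := submK tm.
  have [|c [Bc [bc hc]]] := IH (m - U_(t))%MM.
    by have := congr1 (@mdeg _) mE; rewrite mdegD mdeg1 me addn1 => -[].
  exists (fun F => Am t F *m c F), (B + Bc).+1; split=> [F|F gF].
    exact: bndM.
  have [h1 h2] := hc F gF; split.
    by rewrite -{1}mE addmC mpolyXD -comb_mulX // -h1.
  move=> y x p hx; rewrite /cbar map_mxM mulmxA -/(Abar y t F) hx -scalemxAl.
  by rewrite (h2 y x p hx) scalerA -{2}mE addmC mpolyXD mevalM mevalXU.
elim/mpolyind: q => [|a m q _ _ [c [Bc [bc hc]]]].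
  exists (fun=> 0), 0; split=> [F i j|F gF]; first by rewrite mxE msize0.
  split=> [|y x p _]; last by rewrite /cbar map_mx0 mulmx0 rmorph0 scale0r.
  by rewrite comb0.
have [c' [Bc' [bc' hc']]] := mono m.
exists (fun F => a%:MP *: c' F + c F), (Bc' + Bc)%N; split=> [F|F gF].
  by apply: bndD => //; apply: bndZ.
have [h1 h2] := hc F gF; have [h1' h2'] := hc' F gF; split.
  by rewrite combD combZ /evE mmapC mul_mpolyC -h1 -h1'.
move=> y x p hx; rewrite /cbar map_mxD map_mxZ mulmxDr -scalemxAr.
rewrite (h2 y x p hx) (h2' y x p hx) /= mevalC scalerA -scalerDl.
by rewrite mevalD mevalZ.
Qed.

(** Both products represent X_s X_t e_j in column j, and by freeness a representation of bounded
    size is unique. *)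
Lemma generic_comm :
  generic (fun F => good F -> forall s t, Am s F *m Am t F = Am t F *m Am s F).
Proof.
apply: generic_imp (generic_freeF ((B + B).+1 + (B + B).+1)) _ => F fF gF s t.
apply/matrixP => i j.
suff: col j (Am s F *m Am t F) - col j (Am t F *m Am s F) = 0.
  by move/colP/(_ i); rewrite !mxE => /eqP; rewrite subr_eq0 => /eqP.
apply: fF.
  move=> a; apply: (bndD (B1 := (B + B).+1)) => [|x y]; last apply: bndN => {x y}.
  - by move=> x y; rewrite mxE; apply: bndM.
  - by move=> x y; rewrite mxE; apply: bndM.
have E s' t' : comb F (col j (Am s' F *m Am t' F)) = 'X_s' * ('X_t' * ew X (wd j)).
  by rewrite (proj1 gF) comb_mulX // !colE mulmxA.
by rewrite combB !E mulrCA subrr.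
Qed.

(** Converse of [vp_Abar]. By freeness the column given by [chain] for e_a is the a-th unit vector,
    so x_a is e_a(p) times the scalar x u0. Likewise the column for E_k is E_k u0, and
    specialization forces E_k(p) = [del k]. *)
Lemma generic_eigen_points :
  generic (fun F => good F -> forall (x : 'rV[C]_r) p,
    x != 0 -> (forall t, x *m Abar del t F = p t *: x) ->
    sol F p /\ exists2 c : C, c != 0 & x = c *: vp p).
Proof.
have [ce /fin_all_exists[Be hce]] := fin_all_exists (fun a : 'I_r => chain (ew X (wd a))).
(* [chain] is applied monomial by monomial of f, to polynomials that do not involve [F], so that the
   size bounds stay uniform. *)
have [cm /fin_all_exists[Bm hcm]] :=
  fin_all_exists (fun g : 'I_M * 'I_D => chain (monx X (cmon g.1))`_g.2.+1).
have g1 : generic (fun F => forall a, freeF (Be a + 1) F).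
  by apply: generic_forall => a; apply: generic_freeF.
have g2 : generic (fun F => forall k : 'I_D,
    freeF (\sum_j Bm (j, k) + (2 + B).+1) F).
  by apply: generic_forall => k; apply: generic_freeF.
apply: generic_imp (generic_and g1 g2) _ => F [f1 f2] gF x p x0 hx.
have xE a : x 0 a = ew p (wd a) * (x *m cbar del (u0 F)) 0 0.
  have [bce /(_ F gF)[e1 e2]] := hce a.
  have ceE : ce a F = delta_mx a 0.
    apply/eqP; rewrite -subr_eq0; apply/eqP; apply: (f1 a).
      move=> b; apply: bndD => //; apply: bndN => i j; rewrite mxE.
      by case: (_ && _); rewrite ?msize1 ?msize0.
    rewrite combB -e1 /comb (bigD1 a) //= big1 => [|b ba].
      by rewrite mxE !eqxx rmorph1 mul1r addr0 subrr.
    by rewrite mxE (negPf ba) rmorph0 mul0r.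
  have := e2 del x p hx; rewrite ceE eval_ew => /matrixP/(_ 0 0).
  rewrite [RHS]mxE => <-; rewrite mxE (bigD1 a) //= big1 => [|b ba].
    by rewrite !mxE !eqxx rmorph1 mulr1 addr0.
  by rewrite !mxE (negPf ba) rmorph0 mulr0.
set c := (x *m cbar del (u0 F)) 0 0 in xE.
have c0 : c != 0.
  by apply: contra_neq x0 => c0; apply/rowP => a; rewrite xE c0 mulr0 mxE.
split; last first.
  by exists c => //; apply/rowP => a; rewrite xE !mxE mulrC.
move=> k; apply: (mulIf c0).
have cmE : \sum_j (F j)%:MP *: cm (j, k) F = 'X_k *: u0 F.
  apply/eqP; rewrite -subr_eq0; apply/eqP; apply: (f2 k).
    move=> b; apply: bndD.
      apply: bnd_sum => j; apply: bndZ; exact: (hcm (j, k)).1.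
    apply: bndN => i j; rewrite mxE; apply: leq_trans (msizeM_le _ _) _.
    by rewrite ltnS; apply: leq_add; [rewrite msizeX mdeg1 | apply: bu0].
  rewrite combB combZ -(proj2 gF) mulr1 comb_sum.
  rewrite /evE mmapX mmap1U; apply/eqP; rewrite subr_eq0; apply/eqP.
  apply: eq_bigr => j _; rewrite combZ /evE mmapC mul_mpolyC.
  by rewrite -((hcm (j, k)).2 F gF).1.
have := congr1 (fun v => (x *m cbar del v) 0 0) cmE.
rewrite /cbar map_mxZ /= mevalXU -scalemxAr [RHS]mxE -/(cbar _ _) -/c => <-.
rewrite /cbar (raddf_sum (map_mx (meval del))) mulmx_sumr summxE eval_Ef mulr_suml.
apply: eq_bigr => j _ /=.
rewrite map_mxZ /= mevalC -scalemxAr mxE -/(cbar _ _) (((hcm (j, k)).2 F gF).2 del x p hx).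
by rewrite mxE -/c mulrA eval_monx.
Qed.

End Mult.
End Points.

(** * Solutions for generic f *)

Section GenericPoints.
Variables (n : nat) (d : 'I_n -> nat) (C : numClosedFieldType).
Notation N := (ncoef d).
Notation D := (dsum d).
Notation M := #|{: coefmon n D}|.
Notation P := {mpoly C[N]}.
Notation X := (fun t : 'I_N => 'X_t : P).
Notation r := #|dwords d|.
Notation F0 := (@F0 n d C).
Notation generic := (generic F0).
Notation regular := (regular F0).
Implicit Types (F : 'I_M -> C).

Hypothesis D_gt0 : (0 < D)%N.
Variable zeta : C.
Hypothesis zetaP : D.-primitive_root zeta.
Notation p0 := (@p0 n d C zeta).

Definition Vmx (pts : 'I_r -> 'I_N -> C) : 'M[C]_r :=
  \matrix_(b, a) ew (pts b) (wd a).

Lemma row_Vmx pts b : row b (Vmx pts) = vp (pts b).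
Proof. by apply/rowP => a; rewrite !mxE. Qed.

Lemma Vmx_p0_unit : Vmx p0 \in unitmx.
Proof.
exact: (@ew_points_unit n d C (@rho0 n d C zeta) (rho0_inj zetaP)
          (rho0_neq0 D_gt0 zetaP) C idfun).
Qed.

Lemma p0_inj a b : p0 a =1 p0 b -> a = b.
Proof.
move=> e; apply: wd_inj.
exact: (pw_inj (rho0_inj zetaP) (rho0_neq0 D_gt0 zetaP) (wd_content a) (wd_content b) e).
Qed.

(** The fibre over 0 is stable under every [scp z], so a nonzero coordinate p_t would make z^(wtc t)
    p_t an eigenvalue of one matrix for all z. *)
Lemma zero_fibre (Am : 'I_N -> ('I_M -> C) -> 'M[{mpoly C[D]}]_r) u0 F p :
  good Am u0 F -> (forall k : 'I_D, (Ef F k.+1).@[p] = 0) -> forall t, p t = 0.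
Proof.
move=> gF hp t; apply/eqP; apply: contraT => pt0.
pose A := Abar Am (fun=> 0) t F.
pose q := char_poly A \Po (p t *: 'X^(wtc t)).
have q0 : q != 0.
  rewrite comp_poly_eq0 ?monic_neq0 ?char_poly_monic //.
  by rewrite size_scale // size_polyXn.
have [z /negP[]] := poly_nonroot q0.
rewrite horner_comp !hornerE -/(root _ _) -eigenvalue_root_char.
apply/eigenvalueP; exists (vp (scp z p)); last exact: vp_neq0 gF.
rewrite [RHS](_ : _ = scp z p t *: vp (scp z p)); last by rewrite /scp mulrC.
by apply: (vp_Abar t gF) => k; rewrite Ef_scp hp mulr0.
Qed.

(** A combination [Al] of the multiplication matrices that separates the solutions at [F0] keeps a
    simple spectrum for generic [F]. The matrices commuting with it share its eigenvectors, and
    these are the solutions. *)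
Theorem generic_points : exists Ab : 'I_N -> ('I_M -> C) -> 'M[C]_r,
  (forall t, regularmx F0 (Ab t)) /\
  generic (fun F => [/\ forall p t, sol F p -> vp p *m Ab t F = p t *: vp p,
    forall p, (forall k : 'I_D, (Ef F k.+1).@[p] = 0) -> forall t, p t = 0
  & exists pts : 'I_r -> 'I_N -> C, [/\ forall b, sol F (pts b),
      Vmx pts \in unitmx & forall p, sol F p -> exists b, p =1 pts b]]).
Proof.
have [H /fin_all_exists[B hH]] := fin_all_exists
  (fun g : 'I_N * 'I_r => generic_span ('X_(g.1) * ew X (wd g.2))).
have [H1 [B1 [rH1 bH1 gH1]]] := @generic_span n d C 1.
pose Am t F : 'M[{mpoly C[D]}]_r := \matrix_(a', a) H (t, a) a' F.
pose u0 F : 'cV[{mpoly C[D]}]_r := \col_a H1 a F.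
pose BB := (B1 + \sum_g B g)%N.
have bAm t F : bnd BB (Am t F).
  move=> i j; rewrite mxE; have [_ h _] := hH (t, j).
  by apply: leq_trans (h i F) _; rewrite /BB (bigD1 (t, j)) //=; lia.
have bu0 F : bnd BB (u0 F).
  by move=> i j; rewrite mxE; apply: leq_trans (bH1 i F) (leq_addr _ _).
have ggood : generic (good Am u0).
  have g1 : generic (fun F => forall g : 'I_N * 'I_r,
      'X_(g.1) * ew X (wd g.2) = comb F (col g.2 (Am g.1 F))).
    apply: generic_forall => -[t a]; have [_ _ g] := hH (t, a).
    apply: generic_imp g _ => F /= ->; apply: eq_bigr => b _.
    by rewrite !mxE.
  apply: generic_imp (generic_and g1 gH1) _ => F [h1 h2]; split.
    by move=> t a; apply: (h1 (t, a)).
  by rewrite h2; apply: eq_bigr => a _; rewrite mxE.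
pose Ab t F := Abar Am (@del n d C) t F.
have regAb t : regularmx F0 (Ab t).
  move=> i j; have [rH bH _] := hH (t, j).
  apply: (@regular_eq _ _ _ (fun F => \sum_(kap : 'X_{1..D < B (t, j)})
     (H (t, j) i F)@_kap * mmap1 (@del n d C) kap)).
    by move=> F; rewrite !mxE /meval (mmapE (B (t, j))).
  by apply: regular_sum => kap; apply: regularM => //; apply: regular_const.
exists Ab; split=> //.
have [z hz] : exists z : C, forall g : {g : 'I_r * 'I_r | g.1 != g.2},
    \sum_t (p0 (val g).1 t - p0 (val g).2 t) * z ^+ t != 0.
  apply: separating_weights => -[[a b] /= ab].
  case: (pickP (fun t => p0 a t - p0 b t != 0)) => [t ht|h]; first by exists t.
  case/eqP: ab; apply: p0_inj => t; apply/eqP; rewrite -subr_eq0.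
  by have := h t => /negbFE.
pose ell (p : 'I_N -> C) := \sum_t p t * z ^+ t.
pose Al F := \sum_(t < N) z ^+ t *: Ab t F.
have ell_inj : injective (fun a => ell (p0 a)).
  move=> a b e; apply: contraTeq isT => ab.
  have := hz (exist _ (a, b) ab); rewrite /= => /negP; case.
  under eq_bigr do rewrite mulrBl.
  by rewrite sumrB subr_eq0; apply/eqP.
have regAl : regularmx F0 Al.
  by apply: regularmx_sum => t; apply: regularmxZ => //; apply: regular_const.
have vpAl F p : (forall t, vp p *m Ab t F = p t *: vp p) -> vp p *m Al F = ell p *: vp p.
  move=> h; rewrite /Al mulmx_sumr /ell scaler_suml; apply: eq_bigr => t _.
  by rewrite -scalemxAr h scalerA mulrC.
have gF0 := generic_at ggood.
have spec := @generic_simple_spectrum C M F0 r Al (Vmx p0) (fun a => ell (p0 a))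
  regAl ell_inj.
have {}spec : generic (fun F => exists Y : 'M_r, exists nu : 'I_r -> C,
    [/\ Y \in unitmx, injective nu & forall i, row i Y *m Al F = nu i *: row i Y]).
  apply: spec => b; rewrite row_Vmx; last exact: vp_neq0 gF0.
  by apply: vpAl => t; apply: (vp_Abar t gF0); apply: sol_p0.
have gcomm := generic_comm u0 bAm.
have geig := generic_eigen_points bAm bu0.
apply: generic_imp (generic_and (generic_and ggood spec) (generic_and gcomm geig)) _.
move=> F [[gF [Y [nu [uY nu_inj hY]]]] [/(_ gF) comm /(_ gF) eig]].
have vpA p t : sol F p -> vp p *m Ab t F = p t *: vp p.
  by move=> sp; apply: (vp_Abar t gF).
split=> //; first by move=> p; apply: zero_fibre gF.
have commA s t : Ab s F *m Ab t F = Ab t F *m Ab s F.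
  by rewrite /Ab /Abar -!map_mxM comm.
have commAl t : Ab t F *m Al F = Al F *m Ab t F.
  rewrite /Al mulmx_sumr mulmx_suml; apply: eq_bigr => s _.
  by rewrite -scalemxAr -scalemxAl commA.
have simple (v : 'rV[C]_r) c : v *m Al F = c *: v ->
    forall b, (v *m invmx Y) 0 b * (nu b - c) = 0.
  move=> hv b; pose y := v *m invmx Y.
  have yY : y *m Y = v by rewrite /y mulmxKV.
  have: (\row_i (y 0 i * nu i)) *m Y = (c *: y) *m Y.
    rewrite -scalemxAl yY -hv -yY mulmx_sum_row (mulmx_sum_row y Y) mulmx_suml.
    by apply: eq_bigr => i _; rewrite mxE -scalemxAl hY scalerA.
  move/(can_inj (mulmxK uY))/rowP/(_ b); rewrite !mxE -/(y 0 b) => e.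
  by rewrite mulrBr -/y e mulrC subrr.
(* By commutation [Ab t F] maps the b-th eigenline of [Al F] into itself. *)
have exq b : exists p : 'I_N -> C, forall t, row b Y *m Ab t F = p t *: row b Y.
  apply: (@fin_all_exists _ (fun=> C) (fun t c => row b Y *m Ab t F = c *: row b Y)) => t.
  have := simple (row b Y *m Ab t F) (nu b).
  rewrite -mulmxA commAl mulmxA hY -scalemxAl => /(_ erefl) h.
  exists ((row b Y *m Ab t F *m invmx Y) 0 b).
  rewrite -{1}[row b Y *m Ab t F](mulmxKV uY) mulmx_sum_row (bigD1 b) //=.
  rewrite big1 ?addr0 // => c cb; have /eqP := h c.
  rewrite mulf_eq0 subr_eq0 (inj_eq nu_inj) (negPf cb) orbF => /eqP ->.
  by rewrite scale0r.
have [pts hpts] := fin_all_exists exq.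
have Y0 b : row b Y != 0.
  apply: contraTneq uY => yb0; rewrite unitmxE unitfE (expand_det_row _ b).
  rewrite big1 ?eqxx // => j _; have /rowP/(_ j) := yb0.
  by rewrite !mxE => ->; rewrite mul0r.
have eigb b := eig _ _ (Y0 b) (hpts b).
exists pts; split.
- by move=> b; case: (eigb b).
- apply: (@eigenvectors_free _ _ (Al F) _ nu) => // b.
    rewrite row_Vmx; have [_ [c c0 e]] := eigb b.
    have := hY b; rewrite e -scalemxAl scalerA mulrC -scalerA => h.
    by apply: (can_inj (@scalerK _ _ c _)) h.
  by rewrite row_Vmx; apply: vp_neq0 gF.
(* Completeness: [vp p] is an eigenvector of [Al F], hence a multiple of one row of [Y], whose joint
   eigenvalues are [pts b]. *)
move=> p sp; have vA := vpAl F p (fun t => vpA p t sp).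
have sm := simple _ _ vA.
have [b yb] : exists b, (vp p *m invmx Y) 0 b != 0.
  case: (pickP (fun b => (vp p *m invmx Y) 0 b != 0)) => [b hb|h]; first by exists b.
  have := vp_neq0 p gF; rewrite -[vp p](mulmxKV uY).
  have -> : vp p *m invmx Y = 0.
    by apply/rowP => b; have := h b => /negbFE/eqP ->; rewrite mxE.
  by rewrite mul0mx eqxx.
exists b => t; have /eqP := sm b; rewrite mulf_eq0 (negPf yb) subr_eq0 /= => /eqP nub.
have vE : vp p = (vp p *m invmx Y) 0 b *: row b Y.
  rewrite -{1}[vp p](mulmxKV uY) mulmx_sum_row (bigD1 b) //= big1 ?addr0 // => c cb.
  have /eqP := sm c; rewrite mulf_eq0 -nub subr_eq0 (inj_eq nu_inj) (negPf cb) orbF.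
  by move/eqP ->; rewrite scale0r.
have := vpA p t sp; rewrite vE -scalemxAl hpts !scalerA mulrC => /eqP.
rewrite -subr_eq0 -scalerBl scaler_eq0 (negPf (Y0 b)) orbF subr_eq0.
by move/eqP/(mulIf yb) ->.
Qed.

End GenericPoints.

(** * Cyclic actions and necklaces *)

Section Cyclic.
Variables (T : finType) (f : T -> T) (D : nat).
Hypothesis D_gt0 : (0 < D)%N.
Hypothesis fD : forall x, iter D f x = x.

Definition orb (x : T) : {set T} := [set iter k f x | k : 'I_D].
Definition freept (x : T) : bool := [forall k : 'I_D, (0 < k)%N ==> (iter k f x != x)].
Definition freeset : {set T} := [set x | freept x].

Lemma iter_modD k x : iter (k %% D) f x = iter k f x.
Proof.
rewrite [in RHS](divn_eq k D) addnC iterD; congr iter.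
by elim: (k %/ D)%N => //= q IH; rewrite mulSn iterD -IH fD.
Qed.

Lemma iter_inj k : injective (iter k f).
Proof.
move=> x y e; have h z : iter (k * D - k) f (iter k f z) = z.
  rewrite -iterD subnK ?leq_pmulr //; elim: (k) => //= q IH.
  by rewrite mulSn iterD IH fD.
by rewrite -(h x) e h.
Qed.

Lemma freeptP x : reflect (forall k, iter k f x = x -> (D %| k)%N) (freept x).
Proof.
apply: (iffP forallP) => [h k hk|h k]; last first.
  apply/implyP => k0; apply/eqP => /h; rewrite gtnNdvd //.
have kD : (k %% D < D)%N by rewrite ltn_mod.
have := h (Ordinal kD); rewrite /= iter_modD hk eqxx implybF -eqn0Ngt.
by rewrite /dvdn.
Qed.

Lemma iter_eq x i j : (i <= j)%N -> iter i f x = iter j f x -> iter (j - i) f x = x.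
Proof.
move=> ij e; apply: (@iter_inj i); rewrite -iterD subnKC //.
Qed.

Lemma freept_card x : freept x = (#|orb x| == D).
Proof.
rewrite -[X in _ == X]card_ord /orb; apply/idP/imset_injP => [/freeptP h i j _ _ e|h].
  have [ij|ji] := leqP i j.
    by have := h _ (iter_eq ij e) => hd; apply/val_inj/eqP; rewrite /= eqn_leq ij -subn_eq0 -leqn0 leqNgt;
       apply/negP => p; have := dvdn_leq p hd; have := ltn_ord j; lia.
  by have := h _ (iter_eq (ltnW ji) (esym e)) => hd; have := dvdn_leq _ hd;
     have := ltn_ord i; lia.
apply/forallP => k; apply/implyP => k0; apply/eqP => e.
have := h k (Ordinal D_gt0) isT isT e => /(congr1 val) /= k00.
by rewrite k00 in k0.
Qed.

Lemma mem_orb x : x \in orb x.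
Proof. by apply/imsetP; exists (Ordinal D_gt0). Qed.

Lemma orb_iter k x : iter k f x \in orb x.
Proof.
have kD : (k %% D < D)%N by rewrite ltn_mod.
by apply/imsetP; exists (Ordinal kD); rewrite //= iter_modD.
Qed.

Lemma orb_sub x y : y \in orb x -> orb y \subset orb x.
Proof.
by case/imsetP=> k _ ->; apply/subsetP => _ /imsetP[j _ ->]; rewrite -iterD orb_iter.
Qed.

Lemma orb_sym x y : y \in orb x -> x \in orb y.
Proof.
case/imsetP=> k _ ->.
have {1}-> : x = iter (D - k) f (iter k f x) by rewrite -iterD subnK ?fD // ltnW.
exact: orb_iter.
Qed.

Lemma orb_eq x y : y \in orb x -> orb y = orb x.
Proof. by move=> h; apply/eqP; rewrite eqEsubset !orb_sub // orb_sym. Qed.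

Lemma freept_orb x y : y \in orb x -> freept y = freept x.
Proof. by move=> /orb_eq e; rewrite !freept_card e. Qed.

Lemma card_freeset : #|freeset| = (#|orb @: freeset| * D)%N.
Proof.
apply: card_uniform_partition => [_ /imsetP[x + ->]|].
  by rewrite inE freept_card => /eqP.
apply/and3P; split.
- rewrite eqEsubset; apply/andP; split; apply/subsetP => x.
    case/bigcupP=> _ /imsetP[y + ->] xy; rewrite !inE => fy.
    by rewrite (freept_orb xy).
  by move=> xF; apply/bigcupP; exists (orb x); [exact: imset_f | exact: mem_orb].
- apply/trivIsetP => _ _ /imsetP[x _ ->] /imsetP[y _ ->] ne.
  rewrite -setI_eq0; apply: contraNT ne => /set0Pn[z /setIP[zx zy]].
  by rewrite -(orb_eq zx) (orb_eq zy).
- by apply/imsetP => -[x _ e]; have := mem_orb x; rewrite -e inE.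
Qed.

Lemma card_free_pairs :
  #|[set bc : T * T | freept bc.1 && (bc.2 \notin orb bc.1)]| =
  (#|freeset| * (#|T| - D))%N.
Proof.
rewrite -sum1dep_card (eq_bigl (fun bc : T * T =>
   (bc.1 \in freeset) && (bc.2 \in ~: orb bc.1))); last by move=> bc; rewrite !inE.
rewrite -(pair_big_dep (mem freeset) (fun b c => c \in ~: orb b) (fun _ _ => 1%N)) /=.
rewrite -sum_nat_const; apply: eq_bigr => b; rewrite inE freept_card => /eqP bD.
by rewrite sum1_card cardsCs setCK bD.
Qed.

Definition minper k : {set T} :=
  [set x | [&& (0 < k)%N, iter k f x == x
             & [forall j : 'I_k, (0 < j)%N ==> (iter j f x != x)]]].

Lemma minper_dvd j k x : x \in minper j -> iter k f x = x -> (j %| k)%N.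
Proof.
rewrite inE => /and3P[j0 /eqP hj /forallP h] hk.
have kj : (k %% j < j)%N by rewrite ltn_mod.
have := h (Ordinal kj); rewrite /= (_ : iter (k %% j) f x = x).
  by rewrite eqxx implybF -eqn0Ngt /dvdn.
have hq q : iter (q * j) f x = x by elim: q => //= q IH; rewrite mulSn iterD IH.
by rewrite -[RHS]hk [in RHS](divn_eq k j) addnC iterD hq.
Qed.

Lemma card_fix k : (0 < k)%N ->
  #|[set x | iter k f x == x]| =
    (\sum_(j < k.+1 | (0 < j)%N && (j %| k)%N) #|minper j|)%N.
Proof.
move=> k0.
have per x : iter k f x == x -> exists m : 'I_k.+1, x \in minper m.
  move=> hx; have ex : exists m, (0 < m)%N && (iter m f x == x) by exists k; rewrite k0.
  case: (ex_minnP ex) => m /andP[m0 hm] mmin.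
  have mk : (m < k.+1)%N by rewrite ltnS; apply: mmin; rewrite k0.
  exists (Ordinal mk); rewrite inE m0 hm /=; apply/forallP => j; apply/implyP => j0.
  by apply: contraTN (ltn_ord j) => hj; rewrite -leqNgt; apply: mmin; rewrite j0.
under [RHS]eq_bigr do rewrite -sum1_card.
rewrite (exchange_big_dep [pred x | iter k f x == x]) /=; last first.
  move=> j x /andP[j0 jk]; rewrite inE => /and3P[_ /eqP hj _].
  case/dvdnP: jk => q ->; apply/eqP.
  by elim: q => //= q IH; rewrite mulSn iterD IH.
rewrite -sum1_card; apply: eq_big => [x|x hx]; first by rewrite inE.
have {}hx : iter k f x == x by rewrite inE in hx.
have [m hm] := per x hx; rewrite (bigD1 m) /=; last first.
  rewrite hm andbT (minper_dvd hm (eqP hx)) andbT.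
  by move: hm; rewrite inE => /and3P[].
rewrite big1 // => j /andP[/andP[_ hj] jm]; case/eqP: jm; apply: val_inj => /=.
apply/eqP; rewrite eqn_dvd (minper_dvd hj) ?(minper_dvd hm) //.
  by move: hj; rewrite inE => /and3P[_ /eqP].
by move: hm; rewrite inE => /and3P[_ /eqP].
Qed.

Lemma freeset_minper : freeset = minper D.
Proof. by apply/setP => x; rewrite !inE D_gt0 fD eqxx. Qed.

End Cyclic.

(** The fixed points of the k-th iterate are counted by minimal periods j dividing k; strong
    induction inverts this relation in place of Moebius inversion. *)
Lemma card_freeset_eq (T T' : finType) (f : T -> T) (g : T' -> T') D :
  (0 < D)%N -> (forall x, iter D f x = x) -> (forall x, iter D g x = x) ->
  (forall k, #|[set x | iter k f x == x]| = #|[set x | iter k g x == x]|) ->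
  #|freeset f D| = #|freeset g D|.
Proof.
move=> D0 fD gD h; rewrite !freeset_minper //.
elim/ltn_ind: D D0 {fD gD} => k IH k0.
have := h k; rewrite !card_fix // (bigD1 ord_max) ?dvdnn ?k0 //=.
rewrite [in RHS](bigD1 ord_max) ?dvdnn ?k0 //= => e.
apply/eqP; rewrite -(eqn_add2r (\sum_(i < k.+1 | (0 < i)%N && (i %| k)%N && (i != ord_max)) #|minper f i|)%N).
rewrite {}e; apply/eqP; congr (_ + _)%N; apply: eq_bigr => j /andP[/andP[j0 _] jk].
apply/esym/IH => //; rewrite ltn_neqAle -ltnS ltn_ord andbT.
by apply: contra jk => /eqP e; apply/eqP/val_inj.
Qed.

(** * Rotation of words *)

Section Words.
Variables (n : nat) (d : 'I_n -> nat).
Notation D := (dsum d).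
Notation r := #|dwords d|.
Hypothesis D_gt0 : (0 < D)%N.

Lemma rot1_dwords (w : D.-tuple 'I_n) : w \in dwords d -> [tuple of rot 1 w] \in dwords d.
Proof.
by rewrite !inE => /forallP h; apply/forallP => i; rewrite /= /rot count_cat addnC -count_cat cat_take_drop.
Qed.

Definition tau (a : 'I_r) : 'I_r :=
  enum_rank_in (enum_valP a) [tuple of rot 1 (wd a)].

Lemma wd_tau a : wd (tau a) = [tuple of rot 1 (wd a)].
Proof. by rewrite /wd enum_rankK_in //; apply/rot1_dwords/enum_valP. Qed.

Lemma wd_iter_tau k a : (k <= D)%N -> wd (iter k tau a) = rot k (wd a) :> seq _.
Proof.
elim: k => [|k IH] kD; first by rewrite rot0.
rewrite iterS wd_tau /= IH ?(ltnW kD) // -[in RHS]add1n rotD ?size_tuple //.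
Qed.

Lemma tauD a : iter D tau a = a.
Proof.
by apply/wd_inj/val_inj; rewrite /= wd_iter_tau // -{1}(size_tuple (wd a)) rot_size.
Qed.

Lemma wd_orb a : @wd n d @: orb tau D a = necklace_orbit (wd a).
Proof.
apply/setP => w; apply/imsetP/imsetP => [[_ /imsetP[k _ ->] ->]|[k _ ->]].
  by exists k => //; apply/val_inj; rewrite /= wd_iter_tau // ltnW.
exists (iter k tau a); first exact: imset_f.
by apply/val_inj; rewrite /= wd_iter_tau // ltnW.
Qed.

Lemma card_primitive_necklaces :
  #|orb tau D @: freeset tau D| = num_primitive_necklaces d.
Proof.
rewrite /num_primitive_necklaces -(card_imset _ (imset_inj (@wd_inj n d))).
apply: eq_card => A; apply/imsetP/imsetP => [[_ /imsetP[a aF ->] ->]|[w]].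
  exists (wd a); last exact: wd_orb.
  rewrite inE (enum_valP a) /= -wd_orb card_imset; last exact: wd_inj.
  by rewrite -freept_card //; [rewrite inE in aF | exact: tauD].
rewrite inE => /andP[wD wp ->]; pose a : 'I_r := enum_rank_in wD w.
have wa : wd a = w by rewrite /wd enum_rankK_in.
exists (orb tau D a); last by rewrite -wa wd_orb.
apply: imset_f; rewrite inE freept_card //; last exact: tauD.
by rewrite -(card_imset _ (@wd_inj n d)) wd_orb wa.
Qed.

End Words.

(** * Traces and semicontinuity *)

Lemma rank_diag_mx (K : fieldType) k (v : 'rV[K]_k) :
  \rank (diag_mx v) = #|[set i | v 0 i != 0]|.
Proof.
set S := [set i | _]; pose L : 'M[K]_(k, #|S|) := \matrix_(i, j) (i == enum_val j)%:R.
pose R : 'M[K]_(#|S|, k) := \matrix_(j, i) (v 0 i * (enum_val j == i)%:R).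
pose R' : 'M[K]_(#|S|, k) := \matrix_(j, i) ((v 0 i)^-1 * (enum_val j == i)%:R).
have LR : L *m R = diag_mx v.
  apply/matrixP => i j; rewrite !mxE.
  have [iS|iS] := boolP (i \in S).
    rewrite (bigD1 (enum_rank_in iS i)) //= big1 ?addr0 => [|l li].
      by rewrite !mxE enum_rankK_in // eqxx mul1r mulr_natr eq_sym; case: eqP => [->|].
    rewrite !mxE; case: eqP => [e|_]; last by rewrite mul0r.
    by case/eqP: li; apply: enum_val_inj; rewrite enum_rankK_in.
  rewrite big1 => [|l _]; last first.
    rewrite !mxE; case: eqP => [e|_]; last by rewrite mul0r.
    by rewrite e enum_valP in iS.
  by move: iS; rewrite inE negbK => /eqP ->; rewrite mul0rn.
have RL : R' *m diag_mx v *m L = 1%:M.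
  apply/matrixP => i j; rewrite mul_mx_diag !mxE.
  rewrite (bigD1 (enum_val i)) //= big1 ?addr0 => [|l li].
    rewrite !mxE eqxx mulr1 mulVf ?mul1r ?(inj_eq enum_val_inj) //.
    by have := enum_valP i; rewrite inE.
  by rewrite !mxE [enum_val i == l]eq_sym (negPf li) mulr0 !mul0r.
apply/eqP; rewrite eqn_leq; apply/andP; split.
  by rewrite -LR (leq_trans (mxrankM_maxl _ _)) // rank_leq_col.
rewrite -{1}(mxrank1 K #|S|) -RL.
by apply: leq_trans (mxrankM_maxl _ _) (mxrankM_maxr _ _).
Qed.

Section Semicontinuity.
Variables (n : nat) (d : 'I_n -> nat) (C : numClosedFieldType).
Notation N := (ncoef d).
Notation D := (dsum d).
Notation M := #|{: coefmon n D}|.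
Notation r := #|dwords d|.
Notation F0 := (@F0 n d C).
Notation generic := (generic F0).
Notation regular := (regular F0).
Notation point := ('I_N -> C).
Implicit Types (F : 'I_M -> C) (Q : point -> point -> C).

Hypothesis D_gt0 : (0 < D)%N.
Variable zeta : C.
Hypothesis zetaP : D.-primitive_root zeta.
Notation p0 := (@p0 n d C zeta).

(** As zeta rho0_(k+1) = rho0_k, the factor at position k+1 becomes the one at position k, which is
    a left rotation. *)
Lemma scp_p0 a : scp zeta (p0 a) =1 p0 (tau a).
Proof.
move=> t; have [i [l ->]] := cix_surj t.
rewrite -(pcS (scp zeta (p0 a))) -(pcS (p0 (tau a))) pc_scp.
rewrite !pc_pw; try exact: wd_content.
pose hom (q q' : {poly C}) := forall k, zeta ^+ k * q`_k = q'`_k.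
suff: hom (gw (rho0 zeta) (wd a) i) (gw (rho0 zeta) (wd (tau a)) i) by apply.
have -> : gw (rho0 zeta) (wd (tau a)) i =
    \prod_(k < D | tnth (wd a) k == i) (1 + (zeta * rho0 zeta k) *: 'X).
  rewrite [RHS](reindex_inj (@ordS_inj D)) wd_tau; apply: eq_big => k.
    rewrite !(tnth_nth i) /= /rot nth_cat size_drop size_tuple.
    have kD := ltn_ord k; have [k1|k1] := ltnP k (D - 1).
      by rewrite nth_drop add1n modn_small //; lia.
    (* The last position wraps around to the first letter. *)
    have -> : (k = D.-1 :> nat) by lia.
    rewrite prednK // modnn (_ : D.-1 - (D - 1) = 0)%N; last by lia.
    by rewrite nth_take.
  move=> _; congr (1 + _ *: 'X); rewrite /rho0 /= (prim_expr_mod zetaP) exprS.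
  rewrite invfM mulrN mulrA divff ?mul1r //.
  exact: (zetaX_neq0 D_gt0 zetaP 1).
apply: (big_ind2 (fun q q' => hom q q')) => [k|q1 q1' q2 q2' h1 h2 k|k _ j].
- by rewrite coef1; case: k => [|k]; rewrite ?mul1r ?mulr0.
- rewrite !coefM mulr_sumr; apply: eq_bigr => j _.
  by rewrite -h1 -h2 mulrACA -exprD subnKC // leq_ord.
by rewrite !coefD !coef1 !coefZ !coefX; case: j => [|[|j]] /=;
  rewrite ?(mulr0, mulr1, addr0, add0r).
Qed.

(* The permutation matrix of the rotation of the points is conjugate to a
   diagonal matrix that does not depend on the points. *)
Lemma card_fix_trace (pts : 'I_r -> point) (s : 'I_r -> 'I_r) lam :
  Vmx pts \in unitmx -> (forall b, scp lam (pts b) =1 pts (s b)) ->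
  #|[set b | s b == b]|%:R = \sum_(a < r) lam ^+ wdeg (wd (d := d) a) :> C.
Proof.
move=> uV hs; pose S : 'M[C]_r := \matrix_(b, c) (s b == c)%:R.
pose dg : 'rV[C]_r := \row_a lam ^+ wdeg (wd (d := d) a).
have SV : S *m Vmx pts = Vmx pts *m diag_mx dg.
  apply/matrixP => b a; rewrite mul_mx_diag !mxE (bigD1 (s b)) //= big1 => [|c cb].
    rewrite !mxE eqxx mul1r addr0 -(eq_ew _ (hs b)) ew_scp.
    by rewrite mulrC.
  by rewrite !mxE eq_sym (negPf cb) mul0r.
have: \tr S = \tr (diag_mx dg).
  by rewrite -[S](mulmxK uV) SV mxtrace_mulC mulKmx.
rewrite mxtrace_diag => e; transitivity (\tr S); last first.
  by rewrite e; apply: eq_bigr => a _; rewrite mxE.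
rewrite -sum1_card natr_sum big_mkcond; apply: eq_bigr => b _.
by rewrite inE mxE; case: eqP.
Qed.

Variable Ab : 'I_N -> ('I_M -> C) -> 'M[C]_r.
Hypothesis regAb : forall t, regularmx F0 (Ab t).
Hypothesis vpAb : generic (fun F => forall p t, sol F p -> vp p *m Ab t F = p t *: vp p).

Definition pairrow (p p' : point) : 'rV[C]_(r * r) := vp p *t vp p'.

(** [Q] is the eigenvalue at vp p (x) vp p' of a single matrix with regular entries. Such functions
    form a ring containing the coordinates of both points, hence the resultants below. *)
Definition repr Q := exists A : ('I_M -> C) -> 'M[C]_(r * r),
  regularmx F0 A /\
  generic (fun F => forall p p', sol F p -> sol F p' ->
    pairrow p p' *m A F = Q p p' *: pairrow p p').

Lemma repr_ext Q Q' : (forall p p', Q p p' = Q' p p') -> repr Q -> repr Q'.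
Proof.
move=> e [A [rA gA]]; exists A; split=> //.
by apply: generic_imp gA _ => F h p p' sp sp'; rewrite h // e.
Qed.

Lemma repr_const c : repr (fun _ _ => c).
Proof.
exists (fun=> c%:M); split; first exact: regularmx_const.
by apply: generic_all => F p p' _ _; rewrite mul_mx_scalar.
Qed.

Lemma regularmx_tens (A A' : ('I_M -> C) -> 'M[C]_r) :
  regularmx F0 A -> regularmx F0 A' -> regularmx F0 (fun F => A F *t A' F).
Proof.
move=> rA rA' i j; apply: regular_eq (regularM (rA _ _) (rA' _ _)) => F.
by rewrite mxE.
Qed.

Lemma tensmxZ1 (c : C) m k m' k' (A : 'M[C]_(m, k)) (B : 'M[C]_(m', k')) :
  (c *: A) *t B = c *: (A *t B) /\ A *t (c *: B) = c *: (A *t B).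
Proof.
by split; apply/matrixP => i j; rewrite !mxE; ring.
Qed.

Lemma repr_l t : repr (fun p _ => p t).
Proof.
exists (fun F => Ab t F *t 1%:M); split.
  by apply: regularmx_tens => //; apply: regularmx_const.
apply: generic_imp vpAb _ => F h p p' sp sp'.
have -> : pairrow p p' *m (Ab t F *t 1%:M) = (vp p *m Ab t F) *t (vp p' *m 1%:M).
  exact: (@tensmx_mul C 1 r 1 r r r (vp p) (vp p') (Ab t F) 1%:M).
by rewrite h // mulmx1 (tensmxZ1 _ _ _).1.
Qed.

Lemma repr_r t : repr (fun _ p' => p' t).
Proof.
exists (fun F => 1%:M *t Ab t F); split.
  by apply: regularmx_tens => //; apply: regularmx_const.
apply: generic_imp vpAb _ => F h p p' sp sp'.
have -> : pairrow p p' *m (1%:M *t Ab t F) = (vp p *m 1%:M) *t (vp p' *m Ab t F).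
  exact: (@tensmx_mul C 1 r 1 r r r (vp p) (vp p') 1%:M (Ab t F)).
by rewrite h // mulmx1 (tensmxZ1 _ _ _).2.
Qed.

Lemma reprD Q Q' : repr Q -> repr Q' -> repr (fun p p' => Q p p' + Q' p p').
Proof.
move=> [A [rA gA]] [A' [rA' gA']]; exists (fun F => A F + A' F); split.
  exact: regularmxD.
apply: generic_imp (generic_and gA gA') _ => F [h h'] p p' sp sp'.
by rewrite mulmxDr h // h' // scalerDl.
Qed.

Lemma reprM Q Q' : repr Q -> repr Q' -> repr (fun p p' => Q p p' * Q' p p').
Proof.
move=> [A [rA gA]] [A' [rA' gA']]; exists (fun F => A F *m A' F); split.
  exact: regularmxM.
apply: generic_imp (generic_and gA gA') _ => F [h h'] p p' sp sp'.
by rewrite mulmxA h // -scalemxAl h' // scalerA.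
Qed.

Lemma repr_sum (I : Type) (s : seq I) (Q : I -> _) :
  (forall i, repr (Q i)) -> repr (fun p p' => \sum_(i <- s) Q i p p').
Proof.
move=> h; elim: s => [|i s IH].
  by apply: repr_ext (repr_const 0) => p p'; rewrite big_nil.
by apply: repr_ext (reprD (h i) IH) => p p'; rewrite big_cons.
Qed.

Lemma repr_prod (I : Type) (s : seq I) (Q : I -> _) :
  (forall i, repr (Q i)) -> repr (fun p p' => \prod_(i <- s) Q i p p').
Proof.
move=> h; elim: s => [|i s IH].
  by apply: repr_ext (repr_const 1) => p p'; rewrite big_nil.
by apply: repr_ext (reprM (h i) IH) => p p'; rewrite big_cons.
Qed.

Lemma repr_det k (A : point -> point -> 'M[C]_k) :
  (forall i j, repr (fun p p' => A p p' i j)) -> repr (fun p p' => \det (A p p')).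
Proof.
move=> h; apply: repr_sum => s; apply: reprM; first exact: repr_const.
by apply: repr_prod => i; apply: h.
Qed.

Lemma repr_pcl i l : repr (fun p _ => pc p i l).
Proof.
case: l => [|l]; first exact: repr_const.
by rewrite /pc; case: insub => [j|]; [exact: repr_l | exact: repr_const].
Qed.

Lemma repr_pcr i l : repr (fun _ p' => pc p' i l).
Proof.
case: l => [|l]; first exact: repr_const.
by rewrite /pc; case: insub => [j|]; [exact: repr_r | exact: repr_const].
Qed.

Definition nonzero Q (pts : 'I_r -> point) : {set 'I_r * 'I_r} :=
  [set bc | Q (pts bc.1) (pts bc.2) != 0].

(** The tensor products of the rows of the invertible [Vmx pts] form a basis in which [A] is
    diagonal with the values of [Q] as entries. *)
Lemma rank_pairs (A : 'M[C]_(r * r)) Q (pts : 'I_r -> point) :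
  Vmx pts \in unitmx ->
  (forall b c, pairrow (pts b) (pts c) *m A =
     Q (pts b) (pts c) *: pairrow (pts b) (pts c)) ->
  \rank A = #|nonzero Q pts|.
Proof.
move=> uV hA; pose W := Vmx pts *t Vmx pts.
have uW : W \in unitmx.
  have [r0|r0] := eqVneq r 0%N; last exact: tensmx_unit.
  rewrite unitmxE /W; suff -> : \det (Vmx pts *t Vmx pts) = 1 by apply: unitr1.
  move: (_ *t _); rewrite [in (r * r)%N]r0 => B; exact: det_mx00.
pose q : 'rV[C]_(r * r) := \row_i Q (pts (mxtens_unindex i).1) (pts (mxtens_unindex i).2).
have WA : W *m A = diag_mx q *m W.
  apply/row_matrixP => i; case: (mxtens_indexP i) => b c.
  rewrite !row_mul.
  have rW : row (mxtens_index (b, c)) W = pairrow (pts b) (pts c).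
    by apply/rowP => j; rewrite !mxE mxtens_indexK.
  rewrite rW hA -row_mul; apply/rowP => j; rewrite mul_diag_mx !mxE.
  by rewrite !mxtens_indexK.
have -> : \rank A = \rank (diag_mx q).
  have fW : row_full W by rewrite row_full_unit.
  by rewrite -(eqmxMfull A fW) WA mxrankMfree // row_free_unit.
rewrite rank_diag_mx.
rewrite -(card_imset _ (can_inj (@mxtens_unindexK r r))).
apply: eq_card => bc; apply/imsetP/idP => [[k]|].
  by rewrite inE mxE => hk ->; rewrite inE.
rewrite inE => h; exists (mxtens_index bc); last by rewrite mxtens_indexK.
by rewrite inE mxE mxtens_indexK.
Qed.

(** The count is a rank, which cannot drop near [F0]; no correspondence between [p0] and [pts] is
    implied. *)
Lemma generic_nonzero Q : repr Q -> generic (fun F => forall pts,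
  (forall b, sol F (pts b)) -> Vmx pts \in unitmx ->
  (#|nonzero Q p0| <= #|nonzero Q pts|)%N).
Proof.
move=> [A [rA gA]].
have h0 := generic_at gA.
have e0 : \rank (A F0) = #|nonzero Q p0|.
  apply: rank_pairs; first exact: Vmx_p0_unit.
  by move=> b c; apply: h0; apply: sol_p0.
apply: generic_imp (generic_and gA (generic_rank rA)) _ => F [hF rk] pts sp uV.
have <- : \rank (A F) = #|nonzero Q pts|.
  by apply: rank_pairs => // b c; apply: hF; apply: sp.
by rewrite -e0.
Qed.

End Semicontinuity.

(** * Resultant criteria *)

(* Sylvester matrix for prescribed bounds du and dv on the degrees, so that its
   entries are polynomial in the coefficients of u and v. *)
Definition Syl (K : nzRingType) (du dv : nat) (u v : {poly K}) : 'M[K]_(dv + du) :=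
  col_mx (\matrix_(i < dv, j < dv + du) (u * 'X^i)`_j)
         (\matrix_(i < du, j < dv + du) (v * 'X^i)`_j).

Lemma map_Syl (K L : comNzRingType) (f : {rmorphism K -> L}) du dv u v :
  map_mx f (Syl du dv u v) = Syl du dv (map_poly f u) (map_poly f v).
Proof.
rewrite /Syl map_col_mx; congr col_mx; apply/matrixP => i j; rewrite !mxE;
  by rewrite !coefMXn; case: ifP; rewrite ?rmorph0 // coef_map.
Qed.

(** The column of powers of s lies in the kernel and has first entry 1; the adjugate turns this into
    the vanishing of the determinant. *)
Lemma Syl_root (K : idomainType) du dv (u v : {poly K}) s :
  (0 < dv + du)%N -> (size u <= du.+1)%N -> (size v <= dv.+1)%N ->
  u.[s] = 0 -> v.[s] = 0 -> \det (Syl du dv u v) = 0.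
Proof.
move=> k0 su sv us vs.
pose x : 'cV[K]_(dv + du) := \col_j s ^+ j.
have shift (q : {poly K}) e (i : 'I_e) f : (size q <= f.+1)%N -> (f + e = dv + du)%N ->
    q.[s] = 0 -> \sum_(j < dv + du) (q * 'X^i)`_j * x j 0 = 0.
  move=> sq fe qs; transitivity ((q * 'X^i).[s]); last by rewrite hornerM qs mul0r.
  rewrite (@horner_coef_wide _ (dv + du)); first by apply: eq_bigr => j _; rewrite mxE.
  have [->|q0] := eqVneq q 0; first by rewrite mul0r size_poly0.
  by rewrite size_mulXn // -fe; have := ltn_ord i; move: sq; lia.
have Sx : Syl du dv u v *m x = 0.
  rewrite mul_col_mx; apply/colP => i; rewrite mxE [RHS]mxE.
  case: split_ordP => j _; rewrite mxE.
    rewrite -[RHS](shift u dv j du su (addnC _ _) us); apply: eq_bigr => k _.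
    by congr (_ * _); rewrite mxE.
  rewrite -[RHS](shift v du j dv sv erefl vs); apply: eq_bigr => k _.
  by congr (_ * _); rewrite mxE.
have := congr1 (mulmx (\adj (Syl du dv u v))) Sx.
rewrite mulmxA mul_adj_mx mulmx0 mul_scalar_mx => /colP/(_ (Ordinal k0)).
by rewrite !mxE expr0 mulr1.
Qed.

(** A row in the left kernel encodes A u + B v = 0 with deg B < du. Coprimality makes u divide B,
    and the exact degree of u forces B = 0. *)
Lemma Syl_coprime (K : fieldType) du dv (u v : {poly K}) :
  size u = du.+1 -> (size v <= dv.+1)%N -> coprimep u v ->
  \det (Syl du dv u v) != 0.
Proof.
move=> su sv cuv; rewrite -unitfE -unitmxE -row_free_unit.
apply: inj_row_free => w hw.
pose A := rVpoly (lsubmx w); pose B := rVpoly (rsubmx w).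
have sA : (size A <= dv)%N by apply: size_poly.
have sB : (size B <= du)%N by apply: size_poly.
have expand e (y : 'rV[K]_e) (q : {poly K}) j :
    (rVpoly y * q)`_j = \sum_(i < e) y 0 i * (q * 'X^i)`_j.
  have -> : rVpoly y = \sum_(i < e) y 0 i *: 'X^i.
    rewrite /rVpoly poly_def; apply: eq_bigr => i _; by rewrite valK.
  rewrite mulr_suml coef_sum; apply: eq_bigr => i _.
  by rewrite -scalerAl coefZ [q * _]mulrC.
have AB : A * u + B * v = 0.
  apply/polyP => j; rewrite coef0; have [jk|kj] := ltnP j (dv + du).
    have := congr1 (fun y : 'rV[K]__ => y 0 (Ordinal jk)) hw.
    rewrite -{1}(hsubmxK w) mul_row_col [RHS]mxE => e0; rewrite -[RHS]e0.
    rewrite coefD !expand [RHS]mxE; congr (_ + _); rewrite [RHS]mxE;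
      by apply: eq_bigr => i _; congr (_ * _); rewrite mxE.
  rewrite nth_default // (leq_trans (size_polyD _ _)) // geq_max.
  rewrite !(leq_trans (size_polyMleq _ _)) //; move: su sv sA sB kj; lia.
have uB : u %| B.
  rewrite -(Gauss_dvdpl _ cuv); apply/dvdpP; exists (- A).
  by apply/eqP; rewrite mulNr -subr_eq0 opprK addrC AB.
have B0 : B = 0.
  apply/eqP; apply: contraTT uB => B0; apply/negP => /(dvdp_leq B0).
  by rewrite su ltnNge sB.
have A0 : A = 0.
  move: AB; rewrite B0 mul0r addr0 => /eqP; rewrite mulf_eq0 => /orP[/eqP //|].
  by rewrite -size_poly_eq0 su.
rewrite -(hsubmxK w) -[lsubmx w]rVpolyK -[rsubmx w]rVpolyK -/A -/B A0 B0.
by rewrite !raddf0 row_mx0.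
Qed.

Section Diff.
Variable K : comNzRingType.

(* The quotient (q(t + h) - q(t)) / h, as a polynomial in h. *)
Definition tq (e : nat) (q : {poly K}) (t : K) : {poly K} :=
  \poly_(k < e) (q^`N(k.+1)).[t].

Lemma tqP e (q : {poly K}) t h : (size q <= e.+1)%N ->
  q.[t + h] = q.[t] + h * (tq e q t).[h].
Proof.
move=> sq; rewrite (@nderiv_taylor_wide _ e.+1); first last.
- by [].
- exact: mulrC.
rewrite big_ord_recl /= nderivn0 mulr1 horner_poly mulr_sumr; congr (_ + _).
by apply: eq_bigr => k _; rewrite exprS mulrCA.
Qed.

Lemma tq_sum e (I : Type) (s : seq I) (c : I -> K) (q : I -> {poly K}) t :
  tq e (\sum_(i <- s) c i *: q i) t = \sum_(i <- s) c i *: tq e (q i) t.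
Proof.
apply/polyP => k; rewrite coef_poly [RHS]coef_sum; under [RHS]eq_bigr do rewrite coefZ coef_poly.
case: ifP => _; last by rewrite big1 // => i _; rewrite mulr0.
by rewrite linear_sum horner_sum; apply: eq_bigr => i _; rewrite linearZ hornerZ.
Qed.

End Diff.

Lemma coprimep_roots (K : closedFieldType) (u v : {poly K}) :
  (forall s, u.[s] = 0 -> v.[s] != 0) -> coprimep u v.
Proof.
move=> h; rewrite /coprimep -[_ == _]negbK; apply/negP => /closed_rootP[s].
by rewrite root_gcd => /andP[/rootP/h/negP us vs]; apply: us.
Qed.

Lemma separating_weights_seq (C : numDomainType) k (s : seq 'rV[C]_k) :
  0 \notin s -> exists z, forall v, v \in s -> \sum_t v 0 t * z ^+ t != 0.
Proof.
move=> s0; have hne (i : 'I_(size s)) : exists t, (nth 0 s i) 0 t != 0.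
  case: (pickP (fun t => (nth 0 s i) 0 t != 0)) => [t ht|h]; first by exists t.
  case/negP: s0; have <- : nth 0 s i = 0; last exact: mem_nth.
  by apply/rowP => t; have := h t => /negbFE/eqP ->; rewrite mxE.
have [z hz] := separating_weights hne.
exists z => v vs; have vi : (index v s < size s)%N by rewrite index_mem.
by have := hz (Ordinal vi); rewrite /= nth_index.
Qed.

(** * Resultants detecting double points and common points *)

Section Criteria.
Variables (n : nat) (d : 'I_n -> nat) (C : numClosedFieldType).
Notation N := (ncoef d).
Notation D := (dsum d).
Notation r := #|dwords d|.
Notation point := ('I_N -> C).
Variable i0 : 'I_n.
Hypothesis d_gt0 : forall i, (0 < d i)%N.

Lemma D_gt0 : (0 < D)%N.
Proof. by rewrite /dsum (bigD1 i0) //= addn_gt0 d_gt0. Qed.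

Lemma d_leD i : (d i <= D)%N.
Proof. by rewrite /dsum (bigD1 i) //= leq_addr. Qed.

Lemma size_xr (p : point) i : (size (xr p i) <= (d i).+1)%N.
Proof.
by apply/leq_sizeP => l hl; rewrite coef_xr; case: l hl => // l hl; apply: pc_gt.
Qed.

Lemma size_xr_lead (p : point) i : pc p i (d i) != 0 -> size (xr p i) = (d i).+1.
Proof.
move=> h; apply/eqP; rewrite eqn_leq size_xr ltnNge; apply/negP => /leq_sizeP/(_ _ (leqnn _)).
by rewrite coef_xr; case: (d i) (d_gt0 i) h => // l _ /negP h /eqP.
Qed.

Variable z : C.
Definition vcomb (p : point) : {poly C} := \sum_(i < n) z ^+ i *: xr p i.

Lemma size_vcomb p : (size (vcomb p) <= D.+1)%N.
Proof.
apply: leq_trans (size_sum _ _ _) _; apply/bigmax_leqP => i _.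
apply: leq_trans (size_scale_leq _ _) _; apply: leq_trans (size_xr _ _) _.
by rewrite ltnS d_leD.
Qed.

(** Resultant in h of the difference quotients at t of x_i0 and of sum_i z^i x_i, kept as a
    polynomial in t. The bound [D] exceeds the degree of the second one, so that the matrix is
    nonempty even for D = 1. *)
Definition psi1 (p : point) : {poly C} :=
  \det (Syl (d i0).-1 D (\poly_(k < d i0) (xr p i0)^`N(k.+1))
                        (\poly_(k < D) (vcomb p)^`N(k.+1))).

Lemma psi1E p t : (psi1 p).[t] =
  \det (Syl (d i0).-1 D (tq (d i0) (xr p i0) t) (tq D (vcomb p) t)).
Proof.
rewrite /psi1 -[LHS]/(horner_eval t _) -det_map_mx map_Syl; congr (\det (Syl _ _ _ _));
  by apply/polyP => k; rewrite coef_map !coef_poly; case: ifP => // _; rewrite /= horner_evalE ?horner0.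
Qed.

(** Both difference quotients at s vanish at h = t - s. *)
Lemma psi1_root p s t : s != t -> (forall i, (xr p i).[s] = (xr p i).[t]) ->
  (psi1 p).[s] = 0.
Proof.
move=> st e; have h0 : t - s != 0 by rewrite subr_eq0 eq_sym.
rewrite psi1E; apply: (@Syl_root _ _ _ _ _ (t - s)).
- by rewrite addn_gt0 D_gt0.
- by apply: leq_trans (size_poly _ _) _; rewrite prednK.
- by apply: leq_trans (size_poly _ _) _.
- apply: (mulfI h0); rewrite mulr0; have := tqP s (t - s) (size_xr p i0).
  rewrite (addrC s) subrK e => h.
  by apply: (@addrI _ (xr p i0).[t]); rewrite addr0 -h.
- apply: (mulfI h0); rewrite mulr0; have := tqP s (t - s) (size_vcomb p).
  have -> : (vcomb p).[s] = (vcomb p).[t].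
    by rewrite !horner_sum; apply: eq_bigr => i _; rewrite !hornerZ e.
  rewrite (addrC s) subrK => h.
  by apply: (@addrI _ (vcomb p).[t]); rewrite addr0 -h.
Qed.

(** Eliminates the parameter s from the condition that the curve of [p] passes at s through the
    point of parameter [t0] on the curve of [p']. *)
Definition psi2 (t0 : C) (p p' : point) : C :=
  \det (Syl (d i0) D (xr p i0 - ((xr p' i0).[t0])%:P)
                     (vcomb p - ((vcomb p').[t0])%:P)).

Lemma psi2_root t0 p p' s : (forall i, (xr p i).[s] = (xr p' i).[t0]) ->
  psi2 t0 p p' = 0.
Proof.
move=> e; apply: (@Syl_root _ _ _ _ _ s).
- by rewrite addn_gt0 D_gt0.
- apply: leq_trans (size_polyD _ _) _; rewrite geq_max size_xr size_polyN.
  by apply: leq_trans (size_polyC_leq1 _) _.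
- apply: leq_trans (size_polyD _ _) _; rewrite geq_max size_vcomb size_polyN.
  by apply: leq_trans (size_polyC_leq1 _) _.
- by rewrite hornerD hornerN hornerC e subrr.
- rewrite hornerD hornerN hornerC !horner_sum -sumrB big1 // => i _.
  by rewrite !hornerZ e subrr.
Qed.

Section Repr.
Variables (Ab : 'I_N -> ('I_#|{: coefmon n D}| -> C) -> 'M[C]_r).
Hypothesis regAb : forall t, regularmx (@F0 n d C) (Ab t).
Hypothesis vpAb : generic (@F0 n d C)
  (fun F => forall p t, sol F p -> vp p *m Ab t F = p t *: vp p).
Notation repr := (@repr n d C).

Lemma repr_coefl i l : repr (fun p _ => (xr p i)`_l).
Proof.
case: l => [|l].
  by apply: repr_ext (repr_const _ 0) => p p'; rewrite coef_xr.
by apply: repr_ext (repr_pcl regAb vpAb i l.+1) => p p'; rewrite coef_xr.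
Qed.

Lemma repr_coefr i l : repr (fun _ p' => (xr p' i)`_l).
Proof.
case: l => [|l].
  by apply: repr_ext (repr_const _ 0) => p p'; rewrite coef_xr.
by apply: repr_ext (repr_pcr regAb vpAb i l.+1) => p p'; rewrite coef_xr.
Qed.

Lemma repr_Syl du dv (u v : point -> point -> {poly C}) :
  (forall l, repr (fun p p' => (u p p')`_l)) ->
  (forall l, repr (fun p p' => (v p p')`_l)) ->
  repr (fun p p' => \det (Syl du dv (u p p') (v p p'))).
Proof.
move=> ru rv; apply: repr_det => i j.
case: (split_ordP i) => k ->.
  apply: (@repr_ext _ _ _ (fun p p' => (u p p' * 'X^k)`_j)) => [p p'|].
    by rewrite col_mxEu mxE.
  have [jk|jk] := ltnP j k.
    by apply: repr_ext (repr_const _ 0) => p p'; rewrite coefMXn jk.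
  by apply: repr_ext (ru (j - k)%N) => p p'; rewrite coefMXn ltnNge jk.
apply: (@repr_ext _ _ _ (fun p p' => (v p p' * 'X^k)`_j)) => [p p'|].
  by rewrite col_mxEd mxE.
have [jk|jk] := ltnP j k.
  by apply: repr_ext (repr_const _ 0) => p p'; rewrite coefMXn jk.
by apply: repr_ext (rv (j - k)%N) => p p'; rewrite coefMXn ltnNge jk.
Qed.

Lemma repr_vcombl l : repr (fun p _ => (vcomb p)`_l).
Proof.
apply: (@repr_ext _ _ _ (fun p _ => \sum_(i < n) z ^+ i * (xr p i)`_l)) => [p p'|].
  by rewrite coef_sum; apply: eq_bigr => i _; rewrite coefZ.
by apply: repr_sum => i; apply: reprM; [exact: repr_const | exact: repr_coefl].
Qed.

Lemma repr_tq e (q : point -> {poly C}) t :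
  (forall p, size (q p) <= e.+1)%N -> (forall l, repr (fun p _ => (q p)`_l)) ->
  forall l, repr (fun p _ => (tq e (q p) t)`_l).
Proof.
move=> sq rq l; have [le|le] := ltnP l e; last first.
  by apply: repr_ext (repr_const _ 0) => p p'; rewrite coef_poly ltnNge le.
apply: (@repr_ext _ _ _ (fun p _ =>
   \sum_(j < e.+1) (('C(l.+1 + j, l.+1))%:R * t ^+ j) * (q p)`_(l.+1 + j))) => [p p'|].
  rewrite coef_poly le (@horner_coef_wide _ e.+1); last first.
    apply: leq_trans (sq p); apply/leq_sizeP => j hj; rewrite coef_nderivn.
    by rewrite nth_default ?mul0rn // (leq_trans hj) // leq_addl.
  by apply: eq_bigr => j _; rewrite coef_nderivn [LHS]mulrAC mulr_natl.
by apply: repr_sum => j; apply: reprM => //; apply: repr_const.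
Qed.

Lemma repr_psi1 t0 : repr (fun p _ => (psi1 p).[t0]).
Proof.
apply: (@repr_ext _ _ _ (fun p _ =>
   \det (Syl (d i0).-1 D (tq (d i0) (xr p i0) t0) (tq D (vcomb p) t0)))) => [p p'|].
  by rewrite psi1E.
apply: repr_Syl; apply: repr_tq => [p|l].
- exact: size_xr.
- exact: repr_coefl.
- exact: size_vcomb.
- exact: repr_vcombl.
Qed.

Lemma repr_hornerr i t0 : repr (fun _ p' => (xr p' i).[t0]).
Proof.
apply: (@repr_ext _ _ _ (fun _ p' => \sum_(j < (d i).+1) t0 ^+ j * (xr p' i)`_j)) => [p p'|].
  by rewrite (horner_coef_wide _ (size_xr p' i)); apply: eq_bigr => j _; rewrite mulrC.
by apply: repr_sum => j; apply: reprM; [exact: repr_const | exact: repr_coefr].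
Qed.

Lemma repr_subC (u : point -> point -> {poly C}) (c : point -> point -> C) :
  (forall l, repr (fun p p' => (u p p')`_l)) -> repr c ->
  forall l, repr (fun p p' => (u p p' - (c p p')%:P)`_l).
Proof.
move=> ru rc [|l].
  apply: (@repr_ext _ _ _ (fun p p' => (u p p')`_0 + (-1) * c p p')) => [p p'|].
    by rewrite coefB coefC mulN1r.
  by apply: reprD => //; apply: reprM => //; apply: repr_const.
by apply: repr_ext (ru l.+1) => p p'; rewrite coefB coefC subr0.
Qed.

Lemma repr_psi2 t0 : repr (psi2 t0).
Proof.
apply: repr_Syl.
  by apply: repr_subC => [l|]; [exact: repr_coefl | exact: repr_hornerr].
apply: repr_subC => [l|]; first exact: repr_vcombl.
apply: (@repr_ext _ _ _ (fun _ p' => \sum_(i < n) z ^+ i * (xr p' i).[t0])) => [p p'|].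
  by rewrite horner_sum; apply: eq_bigr => i _; rewrite hornerZ.
by apply: repr_sum => i; apply: reprM; [exact: repr_const | exact: repr_hornerr].
Qed.

Lemma repr_lead : repr (fun p _ => \prod_i pc p i (d i)).
Proof. by apply: repr_prod => i; apply: repr_pcl. Qed.

End Repr.
End Criteria.

(** * Osculants *)

Lemma ex_poly_roots (K : closedFieldType) (q : {poly K}) :
  q != 0 -> exists rs : seq K, forall s, q.[s] = 0 -> s \in rs.
Proof.
move=> q0; have [rs e] := closed_field_poly_normal q; exists rs => s /rootP.
by rewrite e rootZ ?lead_coef_eq0 // root_prod_XsubC.
Qed.

(** * Choice of t0 and z for f0 *)

Section Choice.
Variables (n : nat) (d : 'I_n -> nat) (C : numClosedFieldType).
Notation N := (ncoef d).
Notation D := (dsum d).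
Notation r := #|dwords d|.
Notation point := ('I_N -> C).
Variable i0 : 'I_n.
Hypothesis d_gt0 : forall i, (0 < d i)%N.
Variable zeta : C.
Hypothesis zetaP : D.-primitive_root zeta.
Notation p0 := (@p0 n d C zeta).
Let Dpos : (0 < D)%N := D_gt0 i0 d_gt0.

Lemma eq_xr (p q : point) i : p =1 q -> xr p i = xr q i.
Proof.
by move=> e; apply/polyP => l; rewrite !coef_xr; case: l => // l; apply: eq_pc.
Qed.

Lemma xr_inj (p q : point) : (forall i, xr p i = xr q i) -> p =1 q.
Proof.
move=> e t; have [i [l ->]] := cix_surj t.
by rewrite -!pcS; have := congr1 (fun u : {poly C} => u`_l.+1) (e i); rewrite /= !coef_xr.
Qed.

Lemma scpM a b (p : point) : scp a (scp b p) =1 scp (a * b) p.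
Proof. by move=> t; rewrite /scp exprMn mulrA. Qed.

Lemma scp_iter (pts : 'I_r -> point) s :
  (forall b, scp zeta (pts b) =1 pts (s b)) ->
  forall k b, scp (zeta ^+ k) (pts b) =1 pts (iter k s b).
Proof.
move=> h; elim=> [|k IH] b t; first by rewrite /scp expr0 expr1n mul1r.
by rewrite iterS -h exprS -scpM /scp -IH.
Qed.

Lemma lead_p0 a i : pc (p0 a) i (d i) != 0.
Proof.
rewrite pc_pw; last exact: wd_content.
have sz (k : 'I_D) : (size (1 + rho0 zeta k *: 'X : {poly C})%R <= 2)%N.
  apply: leq_trans (size_polyD _ _) _; rewrite geq_max size_poly1 /=.
  by apply: leq_trans (size_scale_leq _ _) _; rewrite size_polyX.
have [_] := coef_prod_top [seq k <- index_enum 'I_D | tnth (wd a) k == i] sz.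
rewrite !big_filter -count_tnth wd_content -/(gw _ _ _) => ->.
elim/big_ind: _ => [|x y x0 y0|k _]; first exact: oner_neq0.
  exact: mulf_neq0.
by rewrite coefD coef1 coefZ coefX add0r mulr1; apply: rho0_neq0.
Qed.

Lemma Gp_p0 a : Gp (p0 a) = 1 - 'X^D.
Proof. by rewrite Gp_pw ?prod_rho0 //; apply: wd_content. Qed.

(** On each of these curves prod_i (1 + x_i) equals 1 - t^D, so a point determines the D-th power of
    its parameter. *)
Lemma same_point a b s t : t != 0 ->
  (forall i, (xr (p0 a) i).[s] = (xr (p0 b) i).[t]) ->
  exists2 k, s = zeta ^+ k * t
           & forall i, (xr (p0 (iter k (@tau n d) a)) i).[t] = (xr (p0 b) i).[t].
Proof.
move=> t0 e.
have GE c x : \prod_i (1 + (xr (p0 c) i).[x]) = 1 - x ^+ D.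
  rewrite -[1 - _](_ : (1 - 'X^D).[x] = _); last by rewrite !hornerE ?hornerXn.
  rewrite -(Gp_p0 c) horner_prod; apply: eq_bigr => i _.
  by rewrite /xr hornerD hornerN hornerC addrC subrK.
have sD : s ^+ D = t ^+ D.
  apply: oppr_inj; apply: (addrI 1); rewrite -(GE a) -(GE b).
  by apply: eq_bigr => i _; rewrite e.
have : (s / t) ^+ D = 1 by rewrite expr_div_n sD divff // expf_neq0.
case/(prim_rootP zetaP) => k kE.
have sE : s = zeta ^+ k * t by rewrite -kE divfK.
exists k => // i; rewrite -e sE -xr_scp; congr (_.[t]).
by apply/esym/eq_xr/scp_iter => c; apply: scp_p0.
Qed.

(** Distinct solutions differ in some coordinate polynomial, and finitely many nonzero polynomials
    have a common nonroot. *)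
Lemma exists_t0 : exists2 t0 : C, t0 != 0 & forall a b,
  (forall i, (xr (p0 a) i).[t0] = (xr (p0 b) i).[t0]) -> a = b.
Proof.
pose q (ab : 'I_r * 'I_r) : {poly C} :=
  if [pick i | xr (p0 ab.1) i != xr (p0 ab.2) i] is Some i
  then xr (p0 ab.1) i - xr (p0 ab.2) i else 1.
have q0 ab : q ab != 0.
  by rewrite /q; case: pickP => [i|_]; rewrite ?subr_eq0 ?oner_neq0.
have [|t0] := @poly_nonroot C ('X * \prod_ab q ab).
  by rewrite mulf_neq0 ?polyX_eq0 //; apply/prodf_neq0.
rewrite hornerM hornerX horner_prod mulf_eq0 negb_or => /andP[t00 /prodf_neq0 ht].
exists t0 => // a b e; have := ht (a, b) isT; rewrite /q /=.
case: pickP => [i _|h _]; first by rewrite hornerD hornerN e subrr eqxx.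
by apply: (p0_inj Dpos zetaP); apply: xr_inj => i; have := h i => /negbFE/eqP.
Qed.

Variable t0 : C.
Hypothesis t0_neq0 : t0 != 0.
Hypothesis t0P : forall a b,
  (forall i, (xr (p0 a) i).[t0] = (xr (p0 b) i).[t0]) -> a = b.

Definition vec1 a h : 'rV[C]_n := \row_i (tq D (xr (p0 a) i) t0).[h].
Definition vec2 a b s : 'rV[C]_n := \row_i ((xr (p0 a) i).[s] - (xr (p0 b) i).[t0]).

Lemma vec2_neq0 a b s : b \notin orb (@tau n d) D a -> vec2 a b s != 0.
Proof.
move=> ba; apply: contraNneq ba => v0.
have e i : (xr (p0 a) i).[s] = (xr (p0 b) i).[t0].
  by have /rowP/(_ i) := v0; rewrite !mxE => /eqP; rewrite subr_eq0 => /eqP.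
have [k _ /t0P <-] := same_point t0_neq0 e.
by apply: orb_iter => // x; apply: tauD.
Qed.

Lemma size_xrD (p : point) i : (size (xr p i) <= D.+1)%N.
Proof. by apply: leq_trans (size_xr p i) _; rewrite ltnS d_leD. Qed.

(** For h nonzero, a double point would give t0 + h = zeta^k t0 with a fixed by tau^k, so D divides
    k and h = 0. For h = 0 all the derivatives at t0 would vanish, and with them that of 1 - t^D. *)
Lemma vec1_neq0 a h : freept (@tau n d) D a -> vec1 a h != 0.
Proof.
move=> fa; apply/eqP => v0.
have T0 i : (tq D (xr (p0 a) i) t0).[h] = 0 by have /rowP/(_ i) := v0; rewrite !mxE.
have e i : (xr (p0 a) i).[t0 + h] = (xr (p0 a) i).[t0].
  by rewrite (tqP _ _ (size_xrD _ _)) T0 mulr0 addr0.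
have [h0|h0] := eqVneq h 0; last first.
  have [k kE /t0P ka] := same_point t0_neq0 e.
  have := elimT (freeptP Dpos (@tauD n d) a) fa k ka.
  rewrite (prim_order_dvd zetaP) => /eqP k1; case/eqP: h0.
  by apply: (addrI t0); rewrite kE k1 mul1r addr0.
have d0 i : ((xg (p0 a) i)^`()).[t0] = 0.
  rewrite -[RHS](T0 i) h0 horner_coef0 coef_poly Dpos poly.nderivn1.
  by rewrite /xr derivB derivC subr0.
have: ((Gp (p0 a))^`()).[t0] = 0.
  rewrite /Gp; apply: (big_ind (fun q : {poly C} => (q^`()).[t0] = 0)) => //.
    by rewrite derivC horner0.
  by move=> p q hp hq; rewrite derivM hornerD !hornerM hp hq mul0r mulr0 addr0.
move/eqP; rewrite Gp_p0 derivB derivC derivXn sub0r hornerN oppr_eq0 hornerMn hornerXn.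
by rewrite -mulr_natr mulf_eq0 pnatr_eq0 gtn_eqF // orbF expf_eq0 (negPf t0_neq0) andbF.
Qed.

(** The polynomial coming from x_i0 has finitely many roots; at each of them the whole vector is
    nonzero, and one z makes all the corresponding combinations nonzero. *)
Lemma exists_z : exists z : C,
  (forall a, freept (@tau n d) D a -> (psi1 i0 z (p0 a)).[t0] != 0) /\
  (forall a b, b \notin orb (@tau n d) D a -> psi2 i0 z t0 (p0 a) (p0 b) != 0).
Proof.
pose u1 a := tq (d i0) (xr (p0 a) i0) t0.
pose u2 (ab : 'I_r * 'I_r) := xr (p0 ab.1) i0 - ((xr (p0 ab.2) i0).[t0])%:P.
have lead a : (xr (p0 a) i0)`_(d i0) != 0.
  by rewrite coef_xr; case: (d i0) (d_gt0 i0) (lead_p0 a i0).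
have s1 a : size (u1 a) = (d i0).-1.+1.
  rewrite prednK //; apply/eqP; rewrite eqn_leq size_poly leqNgt; apply/negP => sz.
  have le : ((d i0).-1 < d i0)%N by rewrite prednK.
  have : (u1 a)`_(d i0).-1 = 0 by rewrite nth_default // -ltnS prednK.
  rewrite coef_poly le prednK // (@horner_coef_wide _ 1); last first.
    apply/leq_sizeP => j j1; rewrite coef_nderivn nth_default ?mul0rn //.
    by apply: leq_trans (size_xr _ _) _; rewrite -addn1 leq_add2l.
  rewrite big_ord1 expr0 mulr1 coef_nderivn addn0 binn mulr1n => /eqP.
  exact/negP/lead.
have s2 ab : size (u2 ab) = (d i0).+1.
  rewrite /u2 size_polyDl size_xr_lead ?lead_p0 // size_polyN.
  by rewrite (leq_ltn_trans (size_polyC_leq1 _)) // ltnS.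
have u10 a : u1 a != 0 by rewrite -size_poly_eq0 s1.
have u20 ab : u2 ab != 0 by rewrite -size_poly_eq0 s2.
have [rs1 hr1] := fin_all_exists (fun a => ex_poly_roots (u10 a)).
have [rs2 hr2] := fin_all_exists (fun ab => ex_poly_roots (u20 ab)).
pose L := [seq vec1 a h | a <- enum (freeset (@tau n d) D), h <- rs1 a] ++
  [seq vec2 ab.1 ab.2 s | ab <- [seq ab <- enum {: 'I_r * 'I_r} | ab.2 \notin orb (@tau n d) D ab.1],
      s <- rs2 ab].
have L0 : 0 \notin L.
  rewrite mem_cat negb_or; apply/andP; split; apply/negP => /allpairsPdep[x [y []]].
    rewrite mem_enum inE => fx _ e; have := vec1_neq0 y fx; by rewrite -e eqxx.
  rewrite mem_filter => /andP[hx _] _ e; have := vec2_neq0 y hx; by rewrite -e eqxx.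
have [z hz] := separating_weights_seq L0; exists z; split.
  move=> a fa; rewrite psi1E; apply: Syl_coprime (s1 a) _ _.
    by apply: leq_trans (size_poly _ _) _.
  apply: coprimep_roots => h uh; rewrite tq_sum horner_sum.
  have vL : vec1 a h \in L.
    rewrite mem_cat; apply/orP; left; apply/allpairsPdep; exists a, h.
    by split=> //; [rewrite mem_enum inE | exact: hr1].
  have := hz _ vL; apply: contra_neq => e0; rewrite -[RHS]e0.
  by apply: eq_bigr => i _; rewrite mxE hornerZ mulrC.
move=> a b ab; apply: Syl_coprime (s2 (a, b)) _ _.
  apply: leq_trans (size_polyD _ _) _; rewrite geq_max size_vcomb size_polyN.
  by apply: leq_trans (size_polyC_leq1 _) _.
apply: coprimep_roots => s us.
have vL : vec2 a b s \in L.
  rewrite mem_cat; apply/orP; right; apply/allpairsPdep; exists (a, b), s.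
  by split=> //; [rewrite mem_filter ab mem_enum | exact: hr2].
have := hz _ vL; apply: contra_neq => e0; rewrite -[RHS]e0.
rewrite hornerD hornerN hornerC !horner_sum -sumrB; apply: eq_bigr => i _.
by rewrite mxE !hornerZ -mulrBr mulrC.
Qed.

End Choice.

Lemma prim_root_exists (C : numClosedFieldType) k :
  (0 < k)%N -> exists z : C, k.-primitive_root z.
Proof.
move=> k0; have [rs e] := closed_field_poly_normal ('X^k - 1 : {poly C}).
rewrite (monicP _) ?monicXnsubC // scale1r in e.
have rs1 : all k.-unity_root rs.
  by apply/allP => z; rewrite -root_prod_XsubC -e.
have srs : (k <= size rs)%N.
  by rewrite -ltnS -(size_prod_XsubC rs id) -e size_XnsubC.
have us : uniq rs.
  by rewrite -separable_prod_XsubC -e cyclotomic.separable_Xn_sub_1 // pnatr_eq0 -lt0n.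
by have /hasP[z _ hz] := has_prim_root k0 rs1 us srs; exists z.
Qed.

Lemma dvdp_Xn_coef (K : fieldType) g (q : {poly K}) :
  ('X^g %| q)%R <-> (forall k, (k < g)%N -> q`_k = 0).
Proof.
split=> [/dvdpP[p ->] k kg|h]; first by rewrite coefMXn kg.
apply/dvdpP; exists (\poly_(k < size q) q`_(k + g)); apply/polyP => k.
rewrite coefMXn; case: ltnP => kg; first exact: h.
rewrite coef_poly subnK //; case: ltnP => // sk.
by rewrite nth_default // (leq_trans sk) // leq_subr.
Qed.

(** * Counting osculants *)

Section Final.
Variables (n : nat) (d : 'I_n -> nat) (C : numClosedFieldType).
Notation N := (ncoef d).
Notation D := (dsum d).
Notation r := #|dwords d|.
Notation point := ('I_N -> C).
Variable i0 : 'I_n.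
Hypothesis d_gt0 : forall i, (0 < d i)%N.
Let Dpos : (0 < D)%N := D_gt0 i0 d_gt0.

(** As x_i0 is not constant, some s other than 0 is sent outside the finite exceptional set; then s
    and w s have the same image. *)
Lemma onefold_rotation (x : Defs.pmap C n) w : (1 < size (x i0))%N -> onefold x ->
  (forall s i, (x i).[w * s] = (x i).[s]) -> w = 1.
Proof.
move=> sx [B hB] hw.
pose q := 'X * \prod_(b <- B) (x i0 - (b 0 i0)%:P).
have q0 : q != 0.
  rewrite mulf_neq0 ?polyX_eq0 // prodf_seq_neq0; apply/allP => b _ /=.
  rewrite subr_eq0; apply: contraTneq sx => ->.
  by rewrite -leqNgt size_polyC_leq1.
have [s] := poly_nonroot q0; rewrite hornerM hornerX horner_prod mulf_eq0 negb_or.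
rewrite prodf_seq_neq0 => /andP[s0 /allP hs].
have sB : pt x s \notin B.
  apply/negP => /hs; rewrite /= hornerD hornerN hornerC mxE subrr eqxx //.
have e : s = w * s.
  by apply: hB => //; apply/rowP => i; rewrite !mxE hw.
by apply: (mulIf s0); rewrite mul1r -e.
Qed.

Definition pofx (x : Defs.pmap C n) : point :=
  fun t => (x (tag (enum_val t)))`_(wtc t).

Lemma xr_pofx x i : is_dparam d x -> xr (pofx x) i = x i.
Proof.
move=> [sx x0]; apply/polyP => -[|l]; rewrite coef_xr.
  by rewrite -horner_coef0 x0.
have [ld|ld] := ltnP l (d i).
  by rewrite (pcS _ (Ordinal ld)) /pofx wtc_cix /cix enum_rankK.
by rewrite pc_gt // nth_default // sx.
Qed.

Lemma fcomp_coef (f : {mpoly C[n]}) (p : point) k : f@_0%MM = 0 -> (k <= D)%N ->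
  (fcomp f (xr p))`_k = (Ef (coefvec D f) k).@[p].
Proof.
move=> f0 kD; rewrite eval_Ef.
exact: (@coef_comp n d C C idfun p f k f0 kD).
Qed.

Lemma fcomp_coef0 (f : {mpoly C[n]}) (p : point) : f@_0%MM = 0 ->
  (fcomp f (xr p))`_0 = 0.
Proof.
move=> f0; rewrite fcomp_coef // eval_Ef big1 // => j _.
by rewrite coef_monx_lt ?mulr0 // (valP (enum_val j)).
Qed.

Lemma same_image_scp (p q : point) mu : mu != 0 -> scp mu p =1 q ->
  same_image (xr p) (xr q).
Proof.
move=> mu0 e y; split=> -[t <-].
  exists (mu^-1 * t); apply/rowP => i.
  by rewrite !mxE -(eq_xr _ e) xr_scp mulrA divff // mul1r.
by exists (mu * t); apply/rowP => i; rewrite !mxE -(eq_xr _ e) xr_scp.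
Qed.

Lemma same_image_eq (x x' y : Defs.pmap C n) :
  (forall i, x i = x' i) -> same_image x' y -> same_image x y.
Proof.
move=> e h p; have E t : pt x t = pt x' t by apply/rowP => i; rewrite !mxE e.
by rewrite -h; split=> -[t <-]; exists t; rewrite E.
Qed.

Theorem generic_osculants : generic (@F0 n d C) (fun F =>
  forall f : {mpoly C[n]}, f@_0%MM = 0 -> coefvec D f =1 F ->
  num_osculants_eq f d (num_primitive_necklaces d)).
Proof.
have [zeta zetaP] := @prim_root_exists C D Dpos.
have [t0 t00 t0P] := exists_t0 i0 d_gt0 zetaP.
have [z [hz1 hz2]] := exists_z i0 d_gt0 zetaP t00 t0P.
have [Ab [regAb gpts]] := generic_points Dpos zetaP.
have vpAb : generic (@F0 n d C)
    (fun F => forall p t, sol F p -> vp p *m Ab t F = p t *: vp p).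
  by apply: generic_imp gpts _ => F [].
pose Q1 (p p' : point) := (psi1 i0 z p).[t0].
(* The factor [psi1] restricts the count to first points in free orbits, each leaving exactly r - D
   second points, for [F0] as for [F]. *)
pose Q2 (p p' : point) := (psi1 i0 z p).[t0] * psi2 i0 z t0 p p'.
pose Q3 (p p' : point) := \prod_i pc p i (d i).
have rQ1 : repr Q1 := repr_psi1 i0 z regAb vpAb t0.
have rQ2 : repr Q2 by apply: reprM => //; apply: repr_psi2.
have rQ3 : repr Q3 := repr_lead regAb vpAb.
have g1 := generic_nonzero Dpos zetaP rQ1.
have g2 := generic_nonzero Dpos zetaP rQ2.
have g3 := generic_nonzero Dpos zetaP rQ3.
apply: generic_imp (generic_and gpts (generic_and g1 (generic_and g2 g3))) _.
move=> F [[_ zfib [pts [solp uV cpl]]] [h1 [h2 h3]]] f f0 fF.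
have {}h1 := h1 pts solp uV; have {}h2 := h2 pts solp uV; have {}h3 := h3 pts solp uV.
have ptsI b c : pts b =1 pts c -> b = c.
  move=> e; have: delta_mx 0 b *m Vmx pts = delta_mx 0 c *m Vmx pts :> 'rV_r.
    by rewrite -!rowE !row_Vmx; apply/rowP => a; rewrite !mxE; apply: eq_ew.
  move/(can_inj (mulmxK uV))/rowP/(_ b); rewrite !mxE !eqxx /=.
  by case: eqP => // _ /eqP; rewrite oner_eq0.
(* The action of zeta on the solutions for [F], the counterpart of [tau] at [F0]. *)
have [sg hsg] := fin_all_exists (fun b => cpl _ (sol_scp zetaP 1 (solp b))).
have {}hsg b : scp zeta (pts b) =1 pts (sg b) by move=> t; rewrite -hsg expr1.
have sgk := scp_iter hsg.
have sgD b : iter D sg b = b.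
  by apply: ptsI => t; rewrite -sgk (prim_expr_order zetaP) /scp expr1n mul1r.
(* For each k both fixed-point counts equal the same sum over words, by [card_fix_trace]. *)
have cardF : #|freeset sg D| = #|freeset (@tau n d) D|.
  apply: card_freeset_eq => // [a|k]; first exact: tauD.
  apply/eqP; rewrite -(eqr_nat C); apply/eqP.
  rewrite (card_fix_trace uV (sgk k)).
  rewrite (card_fix_trace (Vmx_p0_unit Dpos zetaP) (scp_iter (scp_p0 Dpos zetaP) k)).
  by [].
(* At [F0] no top coefficient vanishes, so the count for [Q3] is already maximal and the degrees are
   exactly d_i for [F] too. *)
have lead b i : pc (pts b) i (d i) != 0.
  have full : nonzero Q3 (@p0 n d C zeta) = setT.
    by apply/setP => bc; rewrite !inE; apply/prodf_neq0 => j _; apply: lead_p0.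
  have /eqP/setP/(_ (b, b)) : nonzero Q3 pts == setT.
    by rewrite eqEcard subsetT -full.
  by rewrite !inE /= => /prodf_neq0; apply.
have sz b i : size (xr (pts b) i) = (d i).+1 by apply: size_xr_lead.
have one b : psi1 i0 z (pts b) != 0 -> onefold (xr (pts b)).
  case/ex_poly_roots=> rs hrs; exists [seq pt (xr (pts b)) s | s <- rs].
  move=> s t sB e; apply/eqP; apply: contraNT sB => st; apply: map_f; apply: hrs.
  apply: (psi1_root i0 d_gt0 z st) => i.
  by have /rowP/(_ i) := e; rewrite !mxE.
have one_free b : onefold (xr (pts b)) -> freept sg D b.
  move=> ob; apply/(freeptP Dpos sgD) => k kb.
  rewrite (prim_order_dvd zetaP); apply/eqP.
  apply: (onefold_rotation _ ob); first by rewrite sz ltnS.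
  by move=> s i; rewrite -xr_scp (eq_xr _ (sgk k b)) kb.
have Q1n b c : Q1 (pts b) c != 0 -> psi1 i0 z (pts b) != 0.
  by apply: contra_neq => e; rewrite /Q1 e horner0.
(* Nonvanishing implies freeness; the lower bound from [F0] is the size of the set of all pairs with
   free first entry, hence the converse. *)
have free1 b : freept sg D b -> psi1 i0 z (pts b) != 0.
  move=> fb; apply: (Q1n b (pts b)).
  have sub : nonzero Q1 pts \subset setX (freeset sg D) setT.
    apply/subsetP => -[b' c']; rewrite !inE andbT => /Q1n/one; exact: one_free.
  have le : (#|setX (freeset sg D) [set: 'I_r]| <= #|nonzero Q1 pts|)%N.
    apply: leq_trans h1; rewrite cardsX cardF -cardsX; apply: subset_leq_card.
    by apply/subsetP => -[a a']; rewrite !inE andbT; apply: hz1.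
  have /eqP/setP/(_ (b, b)) : nonzero Q1 pts == setX (freeset sg D) setT.
    by rewrite eqEcard sub.
  by rewrite !inE fb.
(* Same counting for pairs: within an orbit the images coincide, so [psi2] vanishes there. *)
have free2 b c : freept sg D b -> c \notin orb sg D b -> psi2 i0 z t0 (pts b) (pts c) != 0.
  move=> fb cb.
  pose Z := [set bc : 'I_r * 'I_r | freept sg D bc.1 && (bc.2 \notin orb sg D bc.1)].
  have sub : nonzero Q2 pts \subset Z.
    apply/subsetP => -[b' c']; rewrite !inE /= mulf_eq0 negb_or => /andP[n1 n2].
    rewrite (one_free _ (one _ (Q1n _ (pts b') n1))) /=.
    apply: contraNN n2 => /imsetP[k _ ->]; apply/eqP.
    apply: (@psi2_root n d C i0 d_gt0 z t0 _ _ (zeta ^+ k * t0)) => i.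
    by rewrite -xr_scp (eq_xr _ (sgk k b')).
  have le : (#|Z| <= #|nonzero Q2 pts|)%N.
    apply: leq_trans h2; rewrite card_free_pairs // cardF.
    rewrite -(card_free_pairs Dpos (@tauD n d)); apply: subset_leq_card.
    apply/subsetP => -[a a']; rewrite !inE /= => /andP[fa aa'].
    by rewrite mulf_neq0 ?hz1 ?hz2.
  have /eqP/setP/(_ (b, c)) : nonzero Q2 pts == Z by rewrite eqEcard sub.
  by rewrite !inE /= fb cb mulf_eq0 negb_or => /andP[].
pose O := orb sg D @: freeset sg D.
have cardO : #|O| = num_primitive_necklaces d.
  rewrite -card_primitive_necklaces //; apply/eqP; rewrite -(eqn_pmul2r Dpos).
  by rewrite -!card_freeset ?cardF // => a; apply: tauD.
have fFE k p : (Ef (coefvec D f) k).@[p] = (Ef F k).@[p].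
  by rewrite !eval_Ef; apply: eq_bigr => j _; rewrite fF.
have [rep hrep] : exists rep : 'I_#|O| -> 'I_r,
    forall j, freept sg D (rep j) /\ enum_val j = orb sg D (rep j).
  apply: (@fin_all_exists _ (fun=> 'I_r) (fun j b => freept sg D b /\ enum_val j = orb sg D b)) => j.
  by have /imsetP[b] := enum_valP j; rewrite inE; exists b.
have oscp b : freept sg D b -> osc_param f d (xr (pts b)).
  move=> fb; split.
  - split=> i; first exact: sz.
    by rewrite horner_coef0 coef_xr.
  - exact/one/free1.
  apply/dvdp_Xn_coef => -[|k] kD; first exact: fcomp_coef0.
  rewrite fcomp_coef ?(ltnW kD) // fFE (solp b (Ordinal (ltnW kD))).
  by rewrite /del /= ltn_eqF // oppr0.
rewrite -cardO; exists (fun j => xr (pts (rep j))); split.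
- by move=> j; apply: oscp; case: (hrep j).
- move=> j k same; apply: enum_val_inj.
  have [fj ej] := hrep j; have [fk ek] := hrep k; rewrite ej ek.
  have [kj|kj] := boolP (rep k \in orb sg D (rep j)); first by rewrite (orb_eq Dpos sgD kj).
  (* The point of parameter [t0] on the second curve lies on the first, which a nonzero [psi2]
     excludes. *)
  have /negP := free2 _ _ fj kj; case.
  have [_ /(_ (ex_intro _ t0 erefl))[s es]] := same (pt (xr (pts (rep k))) t0).
  apply/eqP; apply: (@psi2_root n d C i0 d_gt0 z t0 _ _ s) => i.
  by have /rowP/(_ i) := es; rewrite !mxE.
move=> x [dx ox ax]; pose p := pofx x.
have xE i : xr p i = x i by apply: xr_pofx.
have Ek k : (0 < k < D)%N -> (Ef F k).@[p] = 0.
  case/andP=> k0 kD; rewrite -fFE -fcomp_coef ?(ltnW kD) //.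
  have -> : fcomp f (xr p) = fcomp f x by apply: eq_mmap.
  by move/dvdp_Xn_coef: ax; apply.
pose c := (Ef F D).@[p].
(* If E_D vanished as well, [zero_fibre] would make x identically 0, against its positive
   degrees. *)
have c0 : c != 0.
  apply/eqP => cz.
  have pz : forall t, p t = 0.
    apply: zfib => k; have := ltn_ord k; rewrite leq_eqVlt => /orP[/eqP -> //|kD].
    exact: Ek.
  have := dx.1 i0; rewrite -xE => sx.
  have x0 : xr p i0 = 0.
    apply/polyP => -[|l]; rewrite coef_xr coef0 //=.
    by case: insubP => [l' _ _|_] //=; rewrite pz.
  by move: sx; rewrite x0 size_poly0.
(* Scaling by lam multiplies E_D by lam^D, bringing it to -1. *)
pose lam := D.-root (- c^-1).
have lamD : lam ^+ D = - c^-1 by apply: rootCK.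
have lam0 : lam != 0.
  apply: contra_eq_neq lamD => ->; rewrite expr0n gtn_eqF // eq_sym oppr_eq0.
  by rewrite invr_eq0.
have [b hb] : exists b, scp lam p =1 pts b.
  apply: cpl => k; rewrite Ef_scp /del; case: eqP => [kD|kD].
    by rewrite kD lamD -/c mulNr mulVf.
  rewrite Ek ?mulr0 ?oppr0 //=.
  by have := ltn_ord k; rewrite leq_eqVlt => /orP[/eqP //|].
(* A power zeta^k fixing [pts b] also fixes p, which is a rotational symmetry of the 1-fold x. *)
have fb : freept sg D b.
  apply/(freeptP Dpos sgD) => k kb.
  rewrite (prim_order_dvd zetaP); apply/eqP.
  apply: (onefold_rotation _ ox); first by rewrite dx.1 ltnS.
  have pk : scp (zeta ^+ k) p =1 p.
    move=> t; apply: (mulfI (expf_neq0 (wtc t) lam0)).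
    have := sgk k b t; rewrite kb [in LHS]/scp -!hb /scp => <-.
    by rewrite mulrCA.
  by move=> s i; rewrite -!xE -xr_scp (eq_xr _ pk).
have [j ej] : exists j : 'I_#|O|, enum_val j = orb sg D b.
  have bO : orb sg D b \in O by apply: imset_f; rewrite inE.
  by exists (enum_rank_in bO (orb sg D b)); rewrite enum_rankK_in.
exists j; apply: (same_image_eq (x' := xr p)) => [i|]; first by rewrite xE.
have [_ e] := hrep j.
have: rep j \in orb sg D b by rewrite -ej e; apply: mem_orb.
case/imsetP=> k _ kE; apply: (@same_image_scp _ _ (zeta ^+ k * lam)).
  by rewrite mulf_neq0 // (zetaX_neq0 Dpos zetaP).
by move=> t; rewrite kE -sgk -scpM /scp -hb.
Qed.

End Final.

(* Genericity: there is a nonzero polynomial P in the coefficients of f on the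
   monomials of total degree 1..|d| such that every f through 0 whose
   coefficient vector avoids V(P) has exactly #(primitive d-necklaces)
   d-osculants. *)
Theorem theorem1p1 (R : realType) (n : nat) (d : 'I_n -> nat) :
  (0 < n)%N -> (forall i, 0 < d i)%N ->
  exists P : {mpoly (complex R)[#|{: coefmon n (dsum d)}|]},
    P != 0 /\
    forall f : {mpoly (complex R)[n]},
      f@_0%MM = 0 ->
      P.@[coefvec (dsum d) f] != 0 ->
      num_osculants_eq f d (num_primitive_necklaces d).
Proof.
move=> n_gt0 d_gt0.
have [P [P0 hP]] := @generic_osculants n d (complex R) (Ordinal n_gt0) d_gt0.
exists P; split; first by apply: contraNneq P0 => ->; rewrite meval0.
by move=> f f0 Pf; apply: (hP _ Pf).
Qed.
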